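(* Let $W$ be an irreducible affine Weyl group of rank $n$. The order types of the reflection orders on $W$ are precisely the order types of the form $$\lambda_1+\lambda_2+\cdots+\lambda_k,$$ where $\epsilon_1\epsilon_2\cdots\epsilon_k$ is a $2n$-trimmed Dyck word and, for $1\le i\le k$, $\lambda_i=\omega$ if $\epsilon_i=0$ and $\lambda_i=[n_i]+\omega^*$ for some nonnegative integer $n_i$ if $\epsilon_i=1$, subject to the following rules for the indices $i$ with $\epsilon_i=1$: (a) $n_i$ can only be $0$ if $\epsilon_j=0$ for all $j\le i-1$ and $\epsilon_l=1$ for all $l\ge i$; (b) in all other cases $n_i$ can be an arbitrary nonnegative integer. That is: the order type of every reflection order on $W$ has this form, and for every $2n$-trimmed Dyck word and every choice of the nonnegative integers $n_i$ obeying (a), there is a reflection order on $W$ whose order type is the resulting sum.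
   Context: **Affine root system.** $W$ is an irreducible affine Weyl group with associated irreducible finite Weyl group $W_0$, whose irreducible (reduced) crystallographic root system is $\Phi_{W_0}$, spanning a real Euclidean space $V$, with chosen standard positive system $\Phi_{W_0}^+$ and $\Phi_{W_0}^-=-\Phi_{W_0}^+$. The rank $n$ of $W$ is understood to be the rank of $W_0$. Let $V'=V\oplus\mathbb{R}\delta$ with the inner product extended so that $(V',\delta)=0$. The set of positive roots of $W$ is $$\Phi_W^+=\{\alpha+m\delta\mid \alpha\in\Phi_{W_0}^+,\ m\in\mathbb{Z}_{\ge 0}\}\cup\{\alpha+m\delta\mid \alpha\in\Phi_{W_0}^-,\ m\in\mathbb{Z}_{>0}\}\subset V'.$$ **Reflection orders.** A reflection order on $W$ is a total order $\prec$ on $\Phi_W^+$ such that for all $\alpha,\beta\in\Phi_W^+$ with $\alpha\prec\beta$ and all $k_1,k_2\in\mathbb{R}_{>0}$ with $k_1\alpha+k_2\beta\in\Phi_W^+$, one has $\alpha\prec k_1\alpha+k_2\beta\prec\beta$. **Order types.** The order type of a totally ordered set is its isomorphism class. $\omega$ is the order type of $\mathbb{N}$ with its natural order, $\omega^*$ is the order type of $\mathbb{N}$ with the reversed order, and $[m]$ is the order type of a totally ordered set with $m$ elements. The sum $\theta_1+\theta_2$ is the order type obtained by placing a set of type $\theta_2$ after a (disjoint) set of type $\theta_1$. **Words.** An extended Dyck word of length $2n$ is a word with $n$ letters $0$ and $n$ letters $1$ such that every nonempty proper initial segment has strictly more $0$s than $1$s. A $2n$-trimmed Dyck word is a word obtained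 from an extended Dyck word of length $2n$ by replacing some (possibly none) of its disjoint contiguous substrings of the form $\epsilon\epsilon\cdots\epsilon$ ($k$ letters, $\epsilon\in\{0,1\}$, $k\ge 2$) by $\epsilon\epsilon\cdots\epsilon$ ($k'$ letters) with $0<k'<k$. *)

(* Defs.v *)
From HB Require Import structures.
From mathcomp Require Import all_boot all_order all_algebra.
From mathcomp Require Import classical_sets functions reals.

Set Implicit Arguments.
Unset Strict Implicit.
Unset Printing Implicit Defensive.

Import Order.TTheory GRing.Theory Num.Theory.
Local Open Scope ring_scope.

Section RootSystems.
Variables (R : realType) (V : vectType R) (ip : {dot V for idfun}).

Definition reflect_root (a v : V) : V := v - (2 * ip v a / ip a a) *: a.

(* Reduced crystallographic root system spanning V. *)
Definition root_system (Phi : seq V) : Prop :=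
  [/\ 0 \notin Phi,
      <<Phi>>%VS = {:V}%VS,
      {in Phi &, forall a b, reflect_root a b \in Phi},
      {in Phi &, forall a b, 2 * ip b a / ip a a \is a Num.int} &
      forall (a : V) (c : R), a \in Phi -> c *: a \in Phi -> c = 1 \/ c = -1].

Definition irreducible_roots (Phi : seq V) : Prop :=
  (exists a, a \in Phi) /\
  forall P : pred V,
    {in Phi &, forall a b, P a -> ~~ P b -> ip a b = 0} ->
    {in Phi, forall a, P a} \/ {in Phi, forall a, ~~ P a}.

Definition nonneg_comb (Delta : seq V) (v : V) : Prop :=
  exists2 c : V -> R,
    {in Delta, forall d, 0 <= c d} & v = \sum_(d <- Delta) c d *: d.

Definition simple_system (Phi Delta : seq V) : Prop :=
  [/\ basis_of {:V}%VS Delta,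
      {subset Delta <= Phi} &
      {in Phi, forall a, nonneg_comb Delta a \/ nonneg_comb Delta (- a)}].

Definition positive_system (Phi Pos : seq V) : Prop :=
  exists2 Delta : seq V, simple_system Phi Delta &
    forall a, a \in Pos <-> a \in Phi /\ nonneg_comb Delta a.

End RootSystems.

Section AffineRoots.
Variables (R : realType) (V : vectType R).

(* V' is V * R^o; affine_root a m stands for a + m delta, with delta = (0, 1). *)
Definition affine_root (a : V) (m : nat) : V * R^o := (a, m%:R).

Definition affine_pos_roots (Pos : seq V) : set (V * R^o) :=
  [set x | (exists a m, a \in Pos /\ x = affine_root a m) \/
           (exists a m, [/\ - a \in Pos, (0 < m)%N & x = affine_root a m])].

End AffineRoots.

Definition strict_total_on (X : Type) (A : set X) (prec : X -> X -> Prop) :=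
  [/\ forall x, A x -> ~ prec x x,
      forall x y z, A x -> A y -> A z -> prec x y -> prec y z -> prec x z &
      forall x y, A x -> A y -> [\/ prec x y, x = y | prec y x]].

(* prec is only meaningful on the positive roots; its values elsewhere in V'
   are unconstrained. *)
Definition reflection_order (R : realType) (V : vectType R) (Pos : seq V)
    (prec : V * R^o -> V * R^o -> Prop) : Prop :=
  strict_total_on (affine_pos_roots Pos) prec /\
  forall (x y : V * R^o) (k1 k2 : R),
    affine_pos_roots Pos x -> affine_pos_roots Pos y -> prec x y ->
    0 < k1 -> 0 < k2 -> affine_pos_roots Pos (k1 *: x + k2 *: y) ->
    prec x (k1 *: x + k2 *: y) /\ prec (k1 *: x + k2 *: y) y.

(* Order types are represented by ordered sets (with their strict order),
   compared up to isomorphism by has_order_type. *)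
Record ordered_set := OrderedSet {
  carrier :> Type;
  olt : carrier -> carrier -> Prop }.

Definition oempty : ordered_set := @OrderedSet void (fun _ _ => False).
Definition ofin (m : nat) : ordered_set :=
  @OrderedSet 'I_m (fun i j => (i < j)%N).
Definition omega : ordered_set := @OrderedSet nat (fun i j => (i < j)%N).
Definition omega_star : ordered_set := @OrderedSet nat (fun i j => (j < i)%N).

Definition osum (A B : ordered_set) : ordered_set :=
  @OrderedSet (A + B)%type (fun x y =>
    match x, y with
    | inl a, inl a' => olt a a'
    | inl _, inr _ => True
    | inr _, inl _ => False
    | inr b, inr b' => olt b b'
    end).

Definition osums (s : seq ordered_set) : ordered_set := foldr osum oempty s.

Definition has_order_type (X : Type) (A : set X) (prec : X -> X -> Prop)
    (theta : ordered_set) : Prop :=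
  exists2 f : theta -> X, set_bij [set: theta] A f &
    forall s t : theta, olt s t <-> prec (f s) (f t).

(* Words: the letter 0 is false and the letter 1 is true. *)
Definition extended_dyck (n : nat) (w : seq bool) : Prop :=
  [/\ count_mem false w = n, count_mem true w = n &
      forall i, (0 < i < size w)%N ->
        (count_mem true (take i w) < count_mem false (take i w))%N].

(* trimming u w: w is obtained from u by shortening some disjoint contiguous
   constant blocks of u to shorter nonempty ones, the other letters of u being
   kept. *)
Inductive trimming : seq bool -> seq bool -> Prop :=
| trimming_nil : trimming [::] [::]
| trimming_keep (e : bool) u w : trimming u w -> trimming (e :: u) (e :: w)
| trimming_block (e : bool) (k k' : nat) u w :
    (2 <= k)%N -> (0 < k' < k)%N -> trimming u w ->
    trimming (nseq k e ++ u) (nseq k' e ++ w).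

Definition trimmed_dyck (n : nat) (w : seq bool) : Prop :=
  exists2 u, extended_dyck n u & trimming u w.

(* Positions are counted from 0; the value of ns at a position carrying the
   letter 0 is irrelevant. *)
Definition letter_type (e : bool) (m : nat) : ordered_set :=
  if e then osum (ofin m) omega_star else omega.

Definition word_type (w : seq bool) (ns : nat -> nat) : ordered_set :=
  osums [seq letter_type (nth false w i) (ns i) | i <- iota 0 (size w)].

(* Rule (a): if every letter before a letter 1 is 0 and every letter after it
   is 1, then the integer attached to it has to be 0. *)
Definition admissible (w : seq bool) (ns : nat -> nat) : Prop :=
  forall i, (i < size w)%N -> nth false w i = true ->
    (forall j, (j < i)%N -> nth false w j = false) ->
    (forall l, (i <= l < size w)%N -> nth false w l = true) ->
    ns i = 0%N.

(* Main.v *)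
(** Write [a_m] for the affine root [a + m delta].

    In a reflection order, comparing [a_m] with [-a_k] shows that for each pair
    of opposite finite roots one affine chain is increasing, the other is
    decreasing, and the first precedes the second.  The finite roots with
    increasing chain form a positive system, with simple roots [s_1 .. s_n].
    Writing [a_m = (a + b)_(m-k) + (-b)_k] one sees that the limit of the
    chain of a positive root is the minimum of the limits of the simple roots
    in its support, and dually for the decreasing chains of the negative roots,
    with a maximum.  So each letter 0 is the limit of the chain of some [s_i]
    (the birth of [i]) and each letter 1 the limit of the chain of some [-s_i]
    (the death of [i]), which comes after its birth.  At any cut, a dead
    simple root is distinct from and orthogonal to one that is not yet born, so
    there are at most [n] of them, and fewer than [n] if both kinds occur,
    because the Dynkin diagram is connected.  These inequalities characterise
    trimmed Dyck words.

    Conversely births and deaths have to be assigned to the simple roots in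
    such a way that adjacent simple roots are alive simultaneously at some
    time.  For an arbitrary Dyck word this is possible because Dynkin diagrams
    are caterpillars (trees that do not contain the affine diagram of type E6).
    The affine root [a_m] then goes in the piece of the first birth in the
    support of [a] if [a] is positive, of the last death if [a] is negative;
    inside a piece one compares the vectors [x / scale x] lexicographically.
    Finally, finitely many elements can be moved across the boundary of a
    piece, since a decreasing piece commutes with a later increasing one. *)

(* A finite set is absorbed by an [omega] after it and by an [omega_star] before it, so it is
   visible only in front of an [omega_star]; this is where the integers [n_i] sit. An extra element
   there lies on the chain of a root that dies earlier or is born later. Rule (a) singles out the
   letters 1 for which neither kind of root exists.

   Births and deaths are assigned to the simple roots in two orders that depend on the diagram but
   not on the word. In the word 0 01 01 ... 01 1 the zero of index b precedes the one of index d
   exactly when b <= d + 1 (counting from 0), so this is the inequality to be imposed on equal or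
   adjacent simple roots; strictness of the prefix condition makes it sufficient for every extended
   Dyck word. A caterpillar attains it by listing each spine vertex before its leaves for births and
   after them for deaths.

   Statements about decreasing chains follow from those about increasing chains by reversing the
   order, since the reverse of a reflection order is again one. *)
Require Import Defs.
From HB Require Import structures.
From mathcomp Require Import classical_sets functions reals boolp.
From mathcomp Require Import all_boot all_order all_algebra.
From mathcomp Require Import lra ring zify.

Set Implicit Arguments.
Unset Strict Implicit.
Unset Printing Implicit Defensive.

Import Order.TTheory GRing.Theory Num.Theory.

(** * Order types *)

Section OrderTypes.
Variable X : eqType.
Implicit Types (A B : set X) (prec : X -> X -> Prop).

Lemma strict_total_asym A prec x y : strict_total_on A prec ->
  A x -> A y -> prec x y -> ~ prec y x.
Proof.
move=> [irr tr _] Ax Ay xy yx; apply: (irr x Ax); exact: tr xy yx.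
Qed.

Lemma strict_total_sub A B prec : (forall x, B x -> A x) ->
  strict_total_on A prec -> strict_total_on B prec.
Proof.
move=> BA [irr tr tot]; split=> [x /BA|x y z /BA Ax /BA Ay /BA Az|x y /BA Ax /BA Ay].
- exact: irr.
- exact: tr.
- exact: tot.
Qed.

Lemma strict_total_flip A prec : strict_total_on A prec ->
  strict_total_on A (fun x y => prec y x).
Proof.
move=> [irr tr tot]; split=> [//|x y z Ax Ay Az xy yz|x y Ax Ay].
  exact: (tr z y x).
by case: (tot x y Ax Ay) => ?; [apply: Or33|apply: Or32|apply: Or31].
Qed.

Lemma order_type_of_map A prec (theta : ordered_set) (g : X -> theta) :
  (forall x y, A x -> A y -> (prec x y <-> olt (g x) (g y))) ->
  (forall x y, A x -> A y -> g x = g y -> x = y) ->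
  (forall t, exists2 x, A x & g x = t) ->
  has_order_type A prec theta.
Proof.
move=> gm gi gs.
have /choice[f fP] : forall t, exists x, A x /\ g x = t.
  by move=> t; have [x Ax gx] := gs t; exists x.
exists f; last first.
  by move=> s t; have [As Es] := fP s; have [At Et] := fP t; rewrite gm // Es Et.
split.
- by move=> t _; have [] := fP t.
- move=> s t _ _ st; have [_ <-] := fP s; have [_ <-] := fP t.
  by rewrite st.
- move=> x Ax; exists (g x) => //.
  by have [Ag Eg] := fP (g x); apply: gi.
Qed.

(** The rank stays in [nat]: for [n = 0] and inhabited [X] there is no map to ['I_n] to which
    [order_type_of_map] could apply. *)
Lemma order_type_of_rank_fin A prec n (rk : X -> nat) :
  (forall x y, A x -> A y -> (prec x y <-> (rk x < rk y)%N)) ->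
  (forall x y, A x -> A y -> rk x = rk y -> x = y) ->
  (forall x, A x -> (rk x < n)%N) ->
  (forall m, (m < n)%N -> exists2 x, A x & rk x = m) ->
  has_order_type A prec (ofin n).
Proof.
move=> rm ri rn rs.
have /choice[f fP] : forall i : 'I_n, exists x, A x /\ rk x = i.
  by move=> i; have [x Ax rx] := rs i (ltn_ord i); exists x.
exists f; last first.
  by move=> s t; have [As Es] := fP s; have [At Et] := fP t; rewrite rm // Es Et.
split.
- by move=> t _; have [] := fP t.
- move=> s t _ _ st; have [_ Es] := fP s; have [_ Et] := fP t.
  by apply: val_inj; rewrite /= -Es -Et st.
- move=> x Ax; exists (Ordinal (rn x Ax)) => //.
  by have [Ag Eg] := fP (Ordinal (rn x Ax)); apply: ri.
Qed.

Lemma order_type_flip_omega A prec :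
  has_order_type A (fun x y => prec y x) omega -> has_order_type A prec omega_star.
Proof. by move=> [f bf of_]; exists f => // s t; rewrite -of_. Qed.

Lemma order_type_flip_fin A prec n :
  has_order_type A (fun x y => prec y x) (ofin n) -> has_order_type A prec (ofin n).
Proof.
move=> [f [fA fi fs] of_]; exists (f \o @rev_ord n).
  split.
  - by move=> t _; apply: fA.
  - move=> s t _ _ /= st; apply: rev_ord_inj; apply: fi; rewrite ?in_setE //.
  - move=> x /fs[t _ <-]; exists (rev_ord t) => //=.
    by rewrite rev_ordK.
move=> s t; rewrite /= -of_ /=; have := ltn_ord s; have := ltn_ord t.
by rewrite ltn_sub2lE //; case: n s t {f fA fi fs of_} => [[]|n] //= s t _ _.
Qed.

Definition finite_below A prec :=
  forall x, A x -> exists s : seq X, forall y, A y -> prec y x -> y \in s.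

Definition infinite A := forall s : seq X, exists2 x, A x & x \notin s.

Lemma infinite_of_inj A (f : nat -> X) :
  injective f -> (forall m, A (f m)) -> infinite A.
Proof.
move=> fi fA s; apply: contrapT => hn.
have sub : {subset [seq f m | m <- iota 0 (size s).+1] <= s}.
  move=> x /mapP[m _ ->]; apply: contrapT => /negP hs; apply: hn.
  by exists (f m).
have u : uniq [seq f m | m <- iota 0 (size s).+1] by rewrite map_inj_uniq ?iota_uniq.
by have := uniq_leq_size u sub; rewrite size_map size_iota ltnn.
Qed.

Lemma rank_exists A prec : strict_total_on A prec -> finite_below A prec ->
  exists rk : X -> nat,
   [/\ forall x y, A x -> A y -> (prec x y <-> (rk x < rk y)%N),
       forall x y, A x -> A y -> rk x = rk y -> x = y &
       forall x m, A x -> (m <= rk x)%N -> exists2 y, A y & rk y = m].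
Proof.
move=> ho hf; have [irr tr tot] := ho.
(* [s x] lists the predecessors of [x]; its size will be the rank. *)
have /choice[s sP] : forall x, exists s : seq X, A x ->
    uniq s /\ forall y, y \in s <-> A y /\ prec y x.
  move=> x; case: (pselect (A x)) => [Ax|nA]; last by exists [::].
  have [s hs] := hf x Ax.
  exists (undup [seq y <- s | `[< A y /\ prec y x >]]) => _; split.
    exact: undup_uniq.
  move=> y; rewrite mem_undup mem_filter; split.
    by case/andP => /asboolP.
  by move=> h; rewrite (asboolT h) /=; case: h => ? ?; apply: hs.
have mono x y : A x -> A y -> prec x y -> (size (s x) < size (s y))%N.
  move=> Ax Ay xy.
  have [ux mx] := sP x Ax; have [uy my] := sP y Ay.
  apply: (@uniq_leq_size _ (x :: s x)).
    by rewrite /= ux andbT; apply/negP => /mx[_]; apply: irr.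
  move=> z; rewrite inE => /orP[/eqP->|/mx[Az zx]]; apply/my => //.
  by split=> //; apply: tr zx xy.
have inj x y : A x -> A y -> size (s x) = size (s y) -> x = y.
  move=> Ax Ay e; case: (tot x y Ax Ay) => // h.
    by have := mono _ _ Ax Ay h; rewrite e ltnn.
  by have := mono _ _ Ay Ax h; rewrite e ltnn.
have monoE x y : A x -> A y -> (prec x y <-> (size (s x) < size (s y))%N).
  move=> Ax Ay; split; first exact: mono.
  case: (tot x y Ax Ay) => [//|->|yx]; first by rewrite ltnn.
  by have := mono y x Ay Ax yx => h1 h2; have := ltn_trans h1 h2; rewrite ltnn.
exists (fun x => size (s x)); split=> // x m Ax.
rewrite leq_eqVlt => /orP[/eqP->|hm]; first by exists x.
have [ux mx] := sP x Ax.
(* The predecessors of [x] have [size (s x)] distinct ranks below [size (s x)], so every smaller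
   number is a rank. *)
have sub : {subset [seq size (s y) | y <- s x] <= iota 0 (size (s x))}.
  move=> k /mapP[y /mx[Ay yx] ->]; rewrite mem_iota add0n /=; exact: mono.
have [||_ E] := uniq_min_size _ sub.
- rewrite map_inj_in_uniq // => y z /mx[Ay _] /mx[Az _]; exact: inj.
- by rewrite size_iota size_map.
have : m \in iota 0 (size (s x)) by rewrite mem_iota.
by rewrite -E => /mapP[y /mx[Ay _] ->]; exists y.
Qed.

Lemma rank_unbounded A prec (rk : X -> nat) : strict_total_on A prec ->
  finite_below A prec -> infinite A ->
  (forall x y, A x -> A y -> (prec x y <-> (rk x < rk y)%N)) ->
  forall m, exists2 x, A x & (m <= rk x)%N.
Proof.
move=> ho hf hi hr; elim=> [|m [x Ax hm]]; first by have [x Ax _] := hi [::]; exists x.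
have [s hs] := hf x Ax; have [y Ay] := hi (x :: s).
rewrite inE negb_or => /andP[/eqP yx ys]; exists y => //.
apply: leq_ltn_trans hm _; apply/hr => //.
have [_ _ tot] := ho; case: (tot x y Ax Ay) => // [/esym //|h].
by rewrite (hs y Ay h) in ys.
Qed.

Lemma omega_rank A prec : strict_total_on A prec -> finite_below A prec ->
  infinite A -> exists rk : X -> nat,
   [/\ forall x y, A x -> A y -> (prec x y <-> (rk x < rk y)%N),
       forall x y, A x -> A y -> rk x = rk y -> x = y &
       forall m, exists2 y, A y & rk y = m].
Proof.
move=> ho hf hi; have [rk [h1 h2 h3]] := rank_exists ho hf.
exists rk; split=> // m.
have [x Ax mx] := rank_unbounded ho hf hi h1 m.
exact: h3 mx.
Qed.

Lemma order_type_omega A prec : strict_total_on A prec -> finite_below A prec ->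
  infinite A -> has_order_type A prec omega.
Proof.
move=> ho hf hi; have [rk [h1 h2 h3]] := omega_rank ho hf hi.
exact: (@order_type_of_map A prec omega rk).
Qed.

Lemma order_type_omega_star A prec : strict_total_on A prec ->
  finite_below A (fun x y => prec y x) -> infinite A ->
  has_order_type A prec omega_star.
Proof.
move=> ho hf hi; apply: order_type_flip_omega.
exact: order_type_omega (strict_total_flip ho) hf hi.
Qed.

Lemma order_type_finite A prec (s : seq X) : strict_total_on A prec ->
  (forall x, A x -> x \in s) -> exists n, has_order_type A prec (ofin n).
Proof.
move=> ho hs.
have hf : finite_below A prec by move=> x _; exists s => y /hs.
have [rk [h1 h2 h3]] := rank_exists ho hf.
(* Ranks form an initial segment, so the cardinality is the first number that is not a rank. *)
have ex : exists m, ~~ `[< exists2 x, A x & rk x = m >].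
  exists (\max_(x <- s) rk x).+1; apply/asboolP => -[x Ax e].
  by have := @leq_bigmax_seq _ s xpredT rk x (hs x Ax) isT; rewrite e ltnn.
case: (ex_minnP ex) => n /asboolP hn nmin; exists n.
apply: (@order_type_of_rank_fin A prec n rk) => //.
  by move=> x Ax; rewrite ltnNge; apply/negP => /(h3 x n Ax).
move=> m; rewrite ltnNge => /negP hm; apply: contrapT => nm.
by apply: hm; apply: nmin; apply/asboolP.
Qed.

(** The negative half is included because [prec] need not be an order in [order_type_osum]. *)
Definition before A prec B := forall x y, A x -> B y -> prec x y /\ ~ prec y x.

Lemma order_type_osum A B prec (S T : ordered_set) : before A prec B ->
  has_order_type A prec S -> has_order_type B prec T ->
  has_order_type [set x | A x \/ B x]%classic prec (osum S T).
Proof.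
move=> AB [f [fA fi fs] of_] [g [gB gi gs] og].
exists (fun x : osum S T => match x with inl a => f a | inr b => g b end).
  split.
  - by move=> [a|b] _ /=; [left; apply: fA|right; apply: gB].
  - move=> [a|b] [a'|b'] _ _ e.
    + by congr inl; apply: fi; rewrite ?in_setE.
    + have [] := AB (f a) (g b') (fA a I) (gB b' I).
      by rewrite e => h /(_ h).
    + have [] := AB (f a') (g b) (fA a' I) (gB b I).
      by rewrite e => h /(_ h).
    + by congr inr; apply: gi; rewrite ?in_setE.
  - move=> x [/fs[a _ <-]|/gs[b _ <-]]; first by exists (inl a).
    by exists (inr b).
move=> [a|b] [a'|b'] /=; rewrite -?of_ -?og //.
  by split=> // _; have [] := AB (f a) (g b') (fA a I) (gB b' I).
by split=> //; have [_ h /h] := AB (f a') (g b) (fA a' I) (gB b I).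
Qed.

Lemma order_type_ext A B prec (T : ordered_set) : (forall x, A x <-> B x) ->
  has_order_type A prec T -> has_order_type B prec T.
Proof.
move=> AB [f [fA fi fs] of_]; exists f => //; split=> //.
  by move=> t _; apply/AB; apply: fA.
by move=> x /AB; apply: fs.
Qed.

Lemma order_type_osums (T : seq ordered_set) A prec (rho : X -> nat) :
  (forall x, A x -> (rho x < size T)%N) ->
  (forall x y, A x -> A y -> (rho x < rho y)%N -> prec x y /\ ~ prec y x) ->
  (forall i, (i < size T)%N ->
     has_order_type [set x | A x /\ rho x = i]%classic prec (nth oempty T i)) ->
  has_order_type A prec (osums T).
Proof.
elim: T A rho => [|S T IH] A rho hb hm hf.
  exists (fun x : void => match x with end); last by case.
  by split=> [[]|[]|x /hb].
have hB := IH [set x | A x /\ (0 < rho x)%N]%classic (fun x => (rho x).-1).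
apply: (@order_type_ext [set x | (A x /\ rho x = 0%N) \/ (A x /\ (0 < rho x)%N)]%classic).
  move=> x; split=> [[[]|[]]//|Ax] /=.
  by case: (posnP (rho x)) => h; [left|right].
apply: (@order_type_osum [set x | A x /\ rho x = 0%N]%classic).
- by move=> x y [Ax x0] [Ay y0]; apply: hm => //; rewrite x0.
- exact: (hf 0%N).
apply: hB.
- by move=> x [/hb + h]; rewrite /=; case: (rho x) h.
- move=> x y [Ax hx] [Ay hy] h; apply: hm => //.
  by case: (rho x) (rho y) h hx hy => [|a] [|b].
move=> i hi; apply: order_type_ext (hf i.+1 hi) => x /=; split.
  by move=> [Ax ->].
by move=> [[Ax h] <-]; rewrite prednK.
Qed.

Lemma word_type_fibers A prec (w : seq bool) (ns : nat -> nat) (rho : X -> nat) :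
  strict_total_on A prec ->
  (forall x, A x -> (rho x < size w)%N) ->
  (forall x y, A x -> A y -> prec x y -> (rho x <= rho y)%N) ->
  (forall i, (i < size w)%N ->
     has_order_type [set x | A x /\ rho x = i]%classic prec
       (letter_type (nth false w i) (ns i))) ->
  has_order_type A prec (word_type w ns).
Proof.
move=> ho hb hm hf; apply: (@order_type_osums _ _ _ rho).
- by move=> x /hb; rewrite size_map size_iota.
- move=> x y Ax Ay h; have [_ _ tot] := ho.
  have nyx : ~ prec y x by move=> /(hm _ _ Ay Ax); rewrite leqNgt h.
  by case: (tot x y Ax Ay) => // e; rewrite e ltnn in h.
move=> i; rewrite size_map size_iota => hi.
by rewrite (nth_map 0%N) ?size_iota // nth_iota // add0n; apply: hf.
Qed.

End OrderTypes.

(** * Unions of finitely many monotone chains *)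

Section Decomposition.
Variables (X : eqType) (prec : X -> X -> Prop) (A0 : set X).
Variables (I : finType) (dec : I -> bool) (c : I -> nat -> X).
Hypothesis ho : strict_total_on A0 prec.
Hypothesis cA : forall i m, A0 (c i m).
Hypothesis cI : forall i m k, ~~ dec i -> (m < k)%N -> prec (c i m) (c i k).
Hypothesis cD : forall i m k, dec i -> (m < k)%N -> prec (c i k) (c i m).

(* The lower set cut out by the limit of the chain [c i]. *)
Definition below_end i x :=
  if dec i then forall m, prec x (c i m) else exists m, prec x (c i m).

Definition tail_in (B : set X) i := exists m0, forall m, (m0 <= m)%N -> B (c i m).

Lemma chain_inj i m k : c i m = c i k -> m = k.
Proof.
have [irr _ _] := ho; move=> e; case: (ltngtP m k) => // h; exfalso;
  (have [d|d] := boolP (dec i); [have := cD d h|have := cI d h]);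
  by rewrite e => /irr; apply.
Qed.

Lemma below_lower i x y : A0 x -> A0 y -> below_end i x -> prec y x -> below_end i y.
Proof.
have [_ tr _] := ho; move=> Ax Ay; rewrite /below_end; case: ifP => _.
  by move=> h yx m; apply: tr yx (h m).
by move=> [m h] yx; exists m; apply: tr yx h.
Qed.

Lemma below_inc i m : ~~ dec i -> below_end i (c i m).
Proof. by move=> d; rewrite /below_end (negbTE d); exists m.+1; apply: cI. Qed.

Lemma below_dec i m : dec i -> ~ below_end i (c i m).
Proof.
move=> d; rewrite /below_end d => /(_ m); have [irr _ _] := ho; exact: irr.
Qed.

Lemma below_dec_prec i x m : dec i -> below_end i x -> prec x (c i m).
Proof. by move=> d; rewrite /below_end d. Qed.

Lemma not_below_dec i x : dec i -> A0 x -> ~ below_end i x ->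
  exists m, forall k, (m <= k)%N -> ~ prec x (c i k).
Proof.
have [_ tr _] := ho; move=> d Ax; rewrite /below_end d => /existsNP[m nm].
exists m => k; rewrite leq_eqVlt => /orP[/eqP <- //|mk] xk; apply: nm.
exact: tr xk (cD d mk).
Qed.

Lemma below_inc_prec i x : ~~ dec i -> A0 x -> below_end i x ->
  exists m, forall k, (m <= k)%N -> prec x (c i k).
Proof.
have [_ tr _] := ho; move=> d Ax; rewrite /below_end (negbTE d) => -[m xm].
exists m => k; rewrite leq_eqVlt => /orP[/eqP <- //|mk].
exact: tr xm (cI d mk).
Qed.

Section Below.
Variable A : set X.
Hypothesis AA0 : forall x, A x -> A0 x.

Definition le_end i j := forall x, A x -> below_end i x -> below_end j x.

Lemma le_end_total i j : ~ le_end i j -> le_end j i.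
Proof.
move/existsNP => [x /not_implyP[Ax /not_implyP[ix njx]]] y Ay jy.
have [_ _ tot] := ho; case: (tot x y (AA0 Ax) (AA0 Ay)) => h.
- by case: njx; apply: below_lower jy h; apply: AA0.
- by case: njx; rewrite h.
- by apply: below_lower ix h; apply: AA0.
Qed.

Lemma min_end (S : {set I}) i0 : i0 \in S ->
  exists2 i, i \in S & forall j, j \in S -> le_end i j.
Proof.
move=> Si0; pose f i := #|[set j in S | `[< le_end j i >]]|.
case: (arg_minnP f Si0) => i Si0' imin; have Si : i \in S := Si0'; exists i => // j Sj; apply: contrapT => nij.
have ji := le_end_total nij.
have := imin j Sj; rewrite leqNgt => /negP; apply; apply: proper_card.
apply/properP; split.
  apply/subsetP => k; rewrite !inE => /andP[-> /asboolP kj] /=.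
  by apply/asboolP => x Ax /(kj x Ax); apply: ji.
exists i; rewrite !inE Si /=; first by apply/asboolP => x.
by apply/asboolP.
Qed.

End Below.

(** The value [size w] of [rho] marks elements left over once every chain is exhausted. They are
    allowed only if [w] is empty or ends with 0, because a final [omega_star] can take in all that
    remains; hence a word ending with 1 accounts for the whole of [A]. *)
Definition decomposed (S : {set I}) (A : set X) :=
  exists (w : seq bool) (ns : nat -> nat) (rho : X -> nat),
    [/\ [/\ forall x, A x -> (rho x <= size w)%N,
        forall x y, A x -> A y -> prec x y -> (rho x <= rho y)%N &
        forall x, A x -> rho x = size w -> last false w = false],
        forall j, (j < size w)%N ->
          has_order_type [set x | A x /\ rho x = j]%classic prec
            (letter_type (nth false w j) (ns j)),
        forall j, (j < size w)%N -> exists i, [/\ i \in S, dec i = nth false w j &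
          tail_in [set x | A x /\ rho x = j]%classic i] &
        forall i, i \in S -> exists j, [/\ (j < size w)%N, nth false w j = dec i &
          tail_in [set x | A x /\ rho x = j]%classic i]].

(** Splits off the initial segment [B] as a first piece. The premise about [S' = set0] keeps
    leftovers from following a final letter 1. *)
Lemma decomposed_cons (S S' : {set I}) (A B : set X) (e : bool) (n : nat) :
  S' \subset S ->
  (forall x, B x -> A x) ->
  (forall x y, A x -> B y -> ~ B x -> ~ prec x y) ->
  has_order_type B prec (letter_type e n) ->
  (exists i, [/\ i \in S, dec i = e & tail_in B i]) ->
  (forall i, i \in S -> i \notin S' -> dec i = e /\ tail_in B i) ->
  (e = true -> S' = set0 -> forall x, A x -> B x) ->
  decomposed S' [set x | A x /\ ~ B x]%classic ->
  decomposed S A.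
Proof.
move=> S'S BA Blow Btype Btail Brest Bend [w [ns [rho [[rb rm rl] rt rj rS]]]].
pose sg x := if `[< B x >] then 0%N else (rho x).+1.
have sB x : B x -> sg x = 0%N by move=> /asboolT Bx; rewrite /sg Bx.
have sN x : ~ B x -> sg x = (rho x).+1 by move=> /asboolF Bx; rewrite /sg Bx.
exists (e :: w), (fun k => if k is k'.+1 then ns k' else n), sg; split.
- split.
  + move=> x Ax; case: (pselect (B x)) => Bx; first by rewrite sB.
    by rewrite sN //= ltnS; apply: rb.
  + move=> x y Ax Ay xy; case: (pselect (B x)) => Bx; first by rewrite sB.
    case: (pselect (B y)) => By; first by case: (Blow _ _ Ax By Bx).
    by rewrite !sN // ltnS; apply: rm.
  + move=> x Ax; case: (pselect (B x)) => Bx; first by rewrite sB.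
    rewrite sN // => -[h]; have := rl x (conj Ax Bx) h; rewrite /=.
    case: w {rb rm rl rt rj h} rS => [|b w] //= rS _.
    case: e Bend {Btype Btail Brest} => // Bend; case: Bx; apply: Bend => //.
    apply/setP => i; rewrite inE; apply/negP => /rS[j [] //].
- case=> [|j] /= hj.
    apply: order_type_ext Btype => x; split=> [Bx|[Ax]].
      by split; [apply: BA|apply: sB].
    by apply: contraPP => /sN ->.
  apply: order_type_ext (rt j hj) => x /=; split.
    by move=> [[Ax Bx] <-]; rewrite sN.
  move=> [Ax]; case: (pselect (B x)) => Bx; first by rewrite sB.
  by rewrite sN // => -[].
- case=> [|j] /= hj.
    have [i [Si di [m0 ti]]] := Btail; exists i; split=> //.
    by exists m0 => m /ti Bm; split; [apply: BA|apply: sB].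
  have [i [Si di [m0 ti]]] := rj j hj; exists i; split=> //.
    exact: (subsetP S'S).
  by exists m0 => m /ti[[Am nBm] <-]; split=> //; apply: sN.
- move=> i Si; have [S'i|nS'i] := boolP (i \in S').
    have [j [hj wj [m0 ti]]] := rS i S'i; exists j.+1; split=> //.
    by exists m0 => m /ti[[Am nBm] <-]; split=> //; apply: sN.
  have [di [m0 ti]] := Brest i Si nS'i; exists 0%N; split=> //.
  by exists m0 => m /ti Bm; split; [apply: BA|apply: sB].
Qed.

Lemma tail_infinite (B : set X) i : tail_in B i -> infinite B.
Proof.
move=> [m0 h]; apply: (@infinite_of_inj _ _ (fun m => c i (m0 + m))) => [m k|m].
  by move=> /chain_inj/addnI.
by apply: h; apply: leq_addr.
Qed.

Lemma finite_chains (F : seq X) (S : {set I}) (B P : set X) :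
  (forall x, B x -> x \in F \/ exists i m, i \in S /\ x = c i m) ->
  (forall i, i \in S -> exists m0, forall m, B (c i m) -> P (c i m) -> (m < m0)%N) ->
  exists s : seq X, forall y, B y -> P y -> y \in s.
Proof.
move=> cov fin.
have /choice[b bP] : forall i, exists m0, i \in S ->
    forall m, B (c i m) -> P (c i m) -> (m < m0)%N.
  move=> i; have [/fin[m0 h]|nS] := boolP (i \in S); first by exists m0.
  by exists 0%N.
exists (F ++ [seq c i m | i <- enum I, m <- iota 0 (b i)]) => y By Py.
rewrite mem_cat; case: (cov y By) => [-> //|[i [m [Si e]]]].
apply/orP; right; apply/allpairsPdep; exists i, m; split=> //.
  by rewrite mem_enum.
by rewrite mem_iota add0n /= bP -?e.
Qed.

(** Induction on the number of chains, removing those whose end is least. If an increasing chain has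
    a least end, the elements below that end form an [omega]; decreasing chains with the same end
    are kept, since they lie after it. Otherwise the least end is reached only by decreasing chains,
    and the piece is [[n] + omega_star]. [F] takes up the finitely many elements that removed chains
    leave behind. *)
Lemma decomposition N (S : {set I}) (A : set X) (F : seq X) :
  (#|S| <= N)%N -> (forall x, A x -> A0 x) -> (forall i, i \in S -> tail_in A i) ->
  (forall x, A x -> x \in F \/ exists i m, i \in S /\ x = c i m) ->
  decomposed S A.
Proof.
have [irr tr tot] := ho.
elim: N S A F => [|N IH] S A F.
  rewrite leqn0 cards_eq0 => /eqP -> AA0 _ _.
  exists [::], (fun _ => 0%N), (fun _ => 0%N); split=> // i; rewrite inE //.
move=> hS AA0 tS cov.
have [S0|[i0 Si0]] := set_0Vmem S.
  by apply: (IH S A F) => //; rewrite S0 cards0.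
have [i1 Si1 min1] := min_end AA0 Si0.
have noprec x y : A0 x -> A0 y -> ~ prec x y -> prec y x \/ x = y.
  by move=> Ax Ay; case: (tot x y Ax Ay) => // ? _; [right|left].
case: (pselect (exists i, [/\ i \in S, ~~ dec i & forall j, j \in S -> le_end A i j])).
- move=> [i [Si di imin]].
  pose B := [set x | A x /\ below_end i x]%classic.
  pose S' := [set j in S | dec j || ~~ `[< le_end A j i >]].
  have decB j m : j \in S -> dec j -> ~ B (c j m).
    by move=> Sj dj [Am /(imin j Sj _ Am)]; apply: below_dec.
  have incB j : j \in S -> ~~ dec j -> le_end A j i -> forall m, A (c j m) -> B (c j m).
    by move=> Sj dj ji m Am; split=> //; apply: ji => //; apply: below_inc.
  have S'P j : j \in S -> j \notin S' -> ~~ dec j /\ le_end A j i.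
    by move=> Sj; rewrite inE Sj /= negb_or negbK => /andP[-> /asboolP].
  have Btail : tail_in B i.
    by have [m0 h] := tS i Si; exists m0 => m /h Am; apply: incB.
  apply: (@decomposed_cons S S' A B false 0).
  + by apply/subsetP => j; rewrite inE => /andP[].
  + by move=> x [].
  + move=> x y Ax [Ay iy] nBx xy; apply: nBx; split=> //.
    by apply: below_lower iy xy; apply: AA0.
  + apply: order_type_omega.
    * by apply: strict_total_sub ho => x [/AA0].
    * move=> x [Ax ix].
      apply: (@finite_chains F S B (fun y => prec y x)).
        by move=> y [/cov].
      move=> j Sj; have [dj|dj] := boolP (dec j).
        by exists 0%N => m /(decB _ _ Sj dj).
      have [m0 h] := below_inc_prec dj (AA0 _ Ax) (imin j Sj x Ax ix).
      exists m0 => m _ mx; rewrite ltnNge; apply/negP => /h xm.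
      by apply: (irr x (AA0 _ Ax)); apply: tr xm mx => //; apply: AA0.
    * exact: tail_infinite Btail.
  + by exists i; split=> //; apply: negbTE.
  + move=> j Sj /(S'P j Sj)[dj ji]; split; first exact: negbTE.
    by have [m0 h] := tS j Sj; exists m0 => m /h Am; apply: incB.
  + by [].
  + apply: (IH S' _ F).
    * rewrite -ltnS; apply: leq_trans hS; apply: proper_card; apply/properP; split.
        by apply/subsetP => j; rewrite inE => /andP[].
      exists i => //; rewrite inE Si (negbTE di) /= negbK; exact/asboolP.
    * by move=> x [/AA0].
    * move=> j; rewrite inE => /andP[Sj]; have [dj _|dj /= /asboolP] := boolP (dec j).
        have [m0 h] := tS j Sj; exists m0 => m /h Am; split=> //; exact: decB.
      move/existsNP => [x /not_implyP[Ax /not_implyP[jx nix]]].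
      have [m0 h] := below_inc_prec dj (AA0 _ Ax) jx.
      have [m1 h1] := tS j Sj; exists (maxn m0 m1) => m.
      rewrite geq_max => /andP[/h xm /h1 Am]; split=> // -[_ im]; apply: nix.
      by apply: below_lower im xm => //; apply: AA0.
    * move=> x [Ax nB]; case: (cov x Ax) => [|[j [m [Sj e]]]]; first by left.
      right; exists j, m; split=> //; apply: contrapT => /negP /(S'P j Sj)[dj ji].
      by apply: nB; rewrite e; apply: incB; rewrite -?e.
- move=> noinc.
  have di1 : dec i1.
    by apply: contrapT => /negP d; apply: noinc; exists i1.
  (* [T] consists of the chains that end strictly later; by [noinc] it contains every increasing
     chain. *)
  pose T := [set j in S | ~~ `[< le_end A j i1 >]].
  have TP j : j \in S -> j \notin T -> le_end A j i1.
    by move=> Sj; rewrite inE Sj /= negbK => /asboolP.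
  have incT j : j \in S -> ~~ dec j -> j \in T.
    move=> Sj dj; rewrite inE Sj /=; apply/asboolP => ji; apply: noinc.
    exists j; split=> // k Sk x Ax jx; apply: min1 => //; exact: ji.
  (* Where the [omega_star] stops is a choice: each [j] in [T] gets a threshold, an element of the
     chain of [i1] before the end of [j], and the piece consists of the elements past no
     threshold. *)
  have /choice[th thP] : forall j, exists m, j \in T ->
      A (c i1 m) /\ below_end j (c i1 m).
    move=> j; have [|nT] := boolP (j \in T); last by exists 0%N.
    rewrite inE => /andP[Sj /asboolP].
    move/existsNP => [x /not_implyP[Ax /not_implyP[jx nix]]].
    have [m h] := not_below_dec di1 (AA0 _ Ax) nix.
    have [m0 h0] := tS i1 Si1; exists (maxn m m0) => _.
    have Am : A (c i1 (maxn m m0)) by apply: h0; rewrite leq_maxr.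
    split=> //; case: (noprec _ _ (AA0 _ Ax) (AA0 _ Am)).
    + by apply: h; rewrite leq_maxl.
    + by apply: below_lower jx; apply: AA0.
    + by move=> <-.
  pose B := [set x | A x /\ forall j, j \in T -> ~ prec (c i1 (th j)) x]%classic.
  pose B0 := [set x | A x /\ below_end i1 x]%classic.
  pose M := [set x | B x /\ ~ below_end i1 x]%classic.
  have B0B x : B0 x -> B x.
    move=> [Ax ix]; split=> // j /thP[Ac jc] cx; apply: (irr x (AA0 _ Ax)).
    by apply: tr (below_dec_prec _ di1 ix) cx => //; apply: AA0.
  have smallT j k : j \in S -> j \notin T -> k \in T ->
      exists m0, forall m, (m0 <= m)%N -> ~ prec (c i1 (th k)) (c j m).
    move=> Sj Tj /thP[Ac kc].
    have dj : dec j by apply: contrapT => /negP dj; rewrite (incT j Sj dj) in Tj.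
    apply: not_below_dec => //.
    by move=> /(TP j Sj Tj _ Ac); apply: below_dec.
  have smallTA j : j \in S -> j \notin T ->
      exists m0, forall m k, (m0 <= m)%N -> k \in T -> ~ prec (c i1 (th k)) (c j m).
    move=> Sj Tj.
    have /choice[b bP] : forall k, exists m0, k \in T ->
        forall m, (m0 <= m)%N -> ~ prec (c i1 (th k)) (c j m).
      move=> k; have [Tk|nTk] := boolP (k \in T); last by exists 0%N.
      by have [m0 h] := smallT j k Sj Tj Tk; exists m0.
    exists (\max_k b k) => m k hm Tk; apply: bP => //.
    exact: leq_trans (leq_bigmax k) hm.
  have tailB j : j \in S -> j \notin T -> tail_in B j.
    move=> Sj Tj; have [m0 h] := smallTA j Sj Tj; have [m1 h1] := tS j Sj.
    exists (maxn m0 m1) => m; rewrite geq_max => /andP[hm hm1]; split; first exact: h1.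
    by move=> k; apply: h.
  have Ti1 : i1 \notin T.
    by rewrite inE Si1 /= negbK; apply/asboolP => x.
  have Mtail : tail_in M i1.
    have [m0 h] := tailB i1 Si1 Ti1; exists m0 => m /h Bm; split=> //.
    exact: below_dec.
  (* Decreasing chains never go below the least end, and an increasing chain passes its threshold,
     which lies above that end, after finitely many terms. *)
  have [n B0n] : exists n, has_order_type B0 prec (ofin n).
    have [s hs] : exists s : seq X, forall y, B0 y -> True -> y \in s.
      apply: (@finite_chains F S B0 (fun _ => True)).
        by move=> x [/cov].
      move=> j Sj; have [dj|dj] := boolP (dec j).
        exists 0%N => m [Am im]; case: (@below_dec j m dj); exact: min1.
      have Tj := incT j Sj dj; have [Ac jc] := thP j Tj.
      have [m0 h] := below_inc_prec dj (AA0 _ Ac) jc.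
      exists m0 => m [Am im] _; rewrite ltnNge; apply/negP => /h cm.
      apply: (@below_dec i1 (th j) di1); apply: below_lower im cm => //; exact: AA0.
    apply: (@order_type_finite _ _ _ s).
      by apply: strict_total_sub ho => x [/AA0].
    by move=> x /hs; apply.
  apply: (@decomposed_cons S T A B true n).
  + by apply/subsetP => j; rewrite inE => /andP[].
  + by move=> x [].
  + move=> x y Ax [Ay hy] nBx xy; apply: nBx; split=> // j Tj cx; apply: (hy j Tj).
    by apply: tr cx xy; [apply: cA|apply: AA0|apply: AA0].
  + apply: (@order_type_ext _ [set x | B0 x \/ M x]%classic).
      move=> x; split=> [[/B0B //|[]//]|Bx].
      case: (pselect (below_end i1 x)) => h; [left|right] => //.
      by case: Bx.
    apply: order_type_osum => //.
      move=> x y [Ax ix] [[Ay _] niy].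
      have nyx : ~ prec y x.
        by move=> yx; apply: niy; apply: below_lower ix yx; apply: AA0.
      split=> //; case: (noprec _ _ (AA0 _ Ay) (AA0 _ Ax) nyx) => // e.
      by rewrite e in niy.
    apply: order_type_omega_star.
    * by apply: strict_total_sub ho => x [[/AA0]].
    * move=> x [[Ax hx] nix].
      apply: (@finite_chains F S M (fun y => prec x y)).
        by move=> y [[/cov]].
      move=> j Sj; have [Tj|nTj] := boolP (j \in T).
        have [Ac jc] := thP j Tj.
        have [dj|dj] := boolP (dec j).
          by exists 0%N => m [[Am /(_ j Tj) hm] _]; case: hm; apply: below_dec_prec.
        have [m0 h] := below_inc_prec dj (AA0 _ Ac) jc.
        exists m0 => m [[Am /(_ j Tj) hm] _] _; rewrite ltnNge; apply/negP => /h.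
        exact: hm.
      have dj : dec j by apply: contrapT => /negP dj; rewrite (incT j Sj dj) in nTj.
      have njx : ~ below_end j x by move=> /(TP j Sj nTj x Ax).
      have [m0 h] := not_below_dec dj (AA0 _ Ax) njx.
      exists m0 => m _ xm; rewrite ltnNge; apply/negP => /h; exact.
    * exact: tail_infinite Mtail.
  + by exists i1; split=> //; apply: tailB.
  + move=> j Sj Tj; split; last exact: tailB.
    by apply: contrapT => /negP dj; rewrite (incT j Sj dj) in Tj.
  + by move=> _ T0 x Ax; split=> // j; rewrite T0 inE.
  (* Only finitely many elements past a threshold come from [F] or from removed chains; they form
     the exceptional list of the recursive call. *)
  + pose P x := x \in F \/ exists i m, i \in S :\: T /\ x = c i m.
    have [s hs] : exists s : seq X, forall y, (A y /\ ~ B y) /\ P y -> True -> y \in s.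
      apply: (@finite_chains F (S :\: T) [set x | (A x /\ ~ B x) /\ P x]%classic
        (fun _ => True)) => [y []//|j].
      rewrite in_setD => /andP[Tj Sj]; have [m0 h] := smallTA j Sj Tj.
      exists m0 => m [[Am nBm] _] _; rewrite ltnNge; apply/negP => hm.
      by apply: nBm; split=> // k; apply: h.
    apply: (IH T _ s).
    * rewrite -ltnS; apply: leq_trans hS; apply: proper_card; apply/properP; split.
        by apply/subsetP => j; rewrite inE => /andP[].
      by exists i1.
    * by move=> x [/AA0].
    * move=> j Tj; have [Ac jc] := thP j Tj.
      have Sj : j \in S by move: Tj; rewrite inE => /andP[].
      have [m1 h1] := tS j Sj.
      have [dj|dj] := boolP (dec j).
        exists m1 => m /h1 Am; split=> // -[_ /(_ j Tj)]; apply.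
        exact: below_dec_prec.
      have [m0 h] := below_inc_prec dj (AA0 _ Ac) jc.
      exists (maxn m0 m1) => m; rewrite geq_max => /andP[/h cm /h1 Am].
      by split=> // -[_ /(_ j Tj)].
    * move=> x [Ax nB]; have [Fx|[j [m [Sj e]]]] := cov x Ax.
        by left; apply: hs => //; split=> //; left.
      have [Tj|nTj] := boolP (j \in T); first by right; exists j, m.
      left; apply: hs => //; split=> //; right; exists j, m.
      by rewrite in_setD nTj.
Qed.

End Decomposition.

(** * Words *)

Section Words.
Implicit Types (u w : seq bool).

(** A trimming is used only through this surjection of positions, along which births and deaths
    chosen in the Dyck word are transported. *)
Lemma trimming_map u w : trimming u w -> exists h : nat -> nat,
  [/\ forall i, (i < size u)%N -> (h i < size w)%N /\ nth false w (h i) = nth false u i,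
      forall i j, (i <= j < size u)%N -> (h i <= h j)%N &
      forall k, (k < size w)%N -> exists2 i, (i < size u)%N & h i = k].
Proof.
elim=> [|e {}u {}w _ [h [h1 h2 h3]]|e k k' {}u {}w hk hk' _ [h [h1 h2 h3]]].
- by exists id; split=> [i|i j|k] //=; rewrite ltn0 andbF.
- exists (fun i => if i is i'.+1 then (h i').+1 else 0%N); split.
  + by case=> [|i] //= /h1[].
  + by case=> [|i] [|j] //= hij; rewrite ltnS; apply: h2; lia.
  + by case=> [|m] /=; [exists 0%N|case/h3 => i hi <-; exists i.+1].
(* Truncation at [k'.-1] maps the [k] positions of the block onto the [k'] that remain. *)
- exists (fun i => if (i < k)%N then minn i k'.-1 else (k' + h (i - k))%N); split.
  + move=> i; rewrite !size_cat !size_nseq !nth_cat !size_nseq => hi.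
    case: ifP => ik.
      have hm : (minn i k'.-1 < k')%N by lia.
      by rewrite hm !nth_nseq hm ik; split=> //; lia.
    have [] := h1 (i - k)%N; first by lia.
    move=> a b; have -> : (k' + h (i - k) < k')%N = false by lia.
    by rewrite addKn b; split=> //; lia.
  + move=> i j; rewrite size_cat size_nseq => hij.
    case: ifP => ik; case: ifP => jk; try lia.
    by rewrite leq_add2l; apply: h2; lia.
  + move=> m; rewrite !size_cat !size_nseq => hm.
    have [mk|mk] := ltnP m k'.
      by exists m; [lia|rewrite ifT; lia].
    have [|i hi e'] := h3 (m - k')%N; first by lia.
    exists (k + i)%N; first by lia.
    by rewrite ifF; [rewrite addKn e'; lia|lia].
Qed.

Lemma trimming_refl w : trimming w w.
Proof. by elim: w => [|e w IH]; constructor. Qed.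

Lemma trimming_cat u w u' w' : trimming u w -> trimming u' w' ->
  trimming (u ++ u') (w ++ w').
Proof.
elim=> [//|e {}u {}w _ IH|e k k' {}u {}w hk hk' _ IH] /IH h.
  exact: trimming_keep.
by rewrite -!catA; apply: trimming_block.
Qed.

Lemma trimming_nseq (e : bool) A : trimming (nseq A.+1 e) [:: e].
Proof.
case: A => [|A]; first exact: trimming_refl.
by have := @trimming_block e A.+2 1 [::] [::] isT isT trimming_nil; rewrite !cats0.
Qed.

(** Pad [w] with zeros in front and ones behind until there are [n] of each. A prefix ending inside
    [w] then has [n] zeros minus those still to come, so the Dyck condition is the strict cut
    inequality. Where no 1 has been seen or no 0 is to come, strictness is supplied by the first
    letter 0 and the last letter 1. *)
Lemma trimmed_dyckI n w :
  head true w = false -> last false w = true ->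
  (forall i, (i <= size w)%N ->
     (count_mem true (take i w) + count_mem false (drop i w) <= n)%N) ->
  (forall i, (0 < count_mem true (take i w))%N -> (0 < count_mem false (drop i w))%N ->
     (count_mem true (take i w) + count_mem false (drop i w) < n)%N) ->
  trimmed_dyck n w.
Proof.
move=> hw lw hle hlt.
have c0 : (count_mem false w <= n)%N by have := hle 0%N isT; rewrite take0 drop0.
have c1 : (count_mem true w <= n)%N.
  by have := hle (size w) (leqnn _); rewrite take_size drop_size addn0.
have [A hA] : exists A, A = (n - count_mem false w)%N by eexists.
have [B hB] : exists B, B = (n - count_mem true w)%N by eexists.
exists (nseq A false ++ w ++ nseq B true); last first.
  move: A B {hle hlt c0 c1 hA hB} => A B.
  have nseqE a e (s : seq bool) : nseq a e ++ e :: s = nseq a.+1 e ++ s.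
    by elim: a => //= a ->.
  case: w hw lw => [//|b w] /= ->; case/lastP: w => [//|w b']; rewrite last_rcons => ->.
  rewrite nseqE cat_rcons -[true :: nseq B true]/(nseq B.+1 true).
  have -> : false :: rcons w true = [:: false] ++ w ++ [:: true] by rewrite -cats1.
  apply: trimming_cat (trimming_nseq _ _) _.
  exact: trimming_cat (trimming_refl _) (trimming_nseq _ _).
have cn k : (count_mem true (nseq k true) = k) * (count_mem false (nseq k false) = k) *
    (count_mem true (nseq k false) = 0) * (count_mem false (nseq k true) = 0).
  by rewrite !count_nseq /= !mul1n !mul0n.
have cs (e : bool) i : count_mem e (take i w) + count_mem e (drop i w) = count_mem e w.
  by rewrite -count_cat cat_take_drop.
split.
- by rewrite !count_cat !cn; lia.
- by rewrite !count_cat !cn; lia.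
move=> i; rewrite !size_cat !size_nseq => hi.
rewrite take_cat size_nseq; case: (ltnP i A) => iA.
  by rewrite (take_nseq _ (ltnW iA)) !cn; lia.
rewrite take_cat; case: (ltnP (i - A) (size w)) => iw; rewrite !count_cat !cn; last first.
  rewrite take_nseq; last by lia.
  by rewrite !cn; lia.
have [j hj] : exists j, j = (i - A)%N by eexists.
rewrite -hj in iw *.
have [j0|jp] := posnP j; first by rewrite j0 take0 /=; lia.
have t0 : (0 < count_mem false (take j w))%N.
  by clear -hw jp; case: w hw => [|b w] //= ->; case: j jp.
have d1 : (0 < count_mem true (drop j w))%N.
  have l : last false (drop j w) = true.
    move: lw; rewrite -{1}(cat_take_drop j w) last_cat.
    by case: (drop j w) (size_drop j w) => //=; lia.
  rewrite -has_count has_pred1; case: (drop j w) (size_drop j w) l => [|b s] /= h l; first by lia.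
  by rewrite -[X in X \in _]l mem_last.
have := cs true j; have := cs false j; have := hlt j; have := hle j; lia.
Qed.

Lemma count_mem_pos e u k : (k < count_mem e u)%N -> exists p,
  [/\ (p < size u)%N, nth false u p = e & count_mem e (take p u) = k].
Proof.
elim: u k => [//|b u IH] k /=; case: eqP => [->|be] /=.
  case: k => [|k] h; first by exists 0%N.
  by have [p [h1 h2 h3]] := IH k h; exists p.+1; rewrite /= eqxx h3.
by move=> /IH[p [h1 h2 h3]]; exists p.+1; rewrite /=; case: eqP.
Qed.

Lemma count_take_le (e : bool) u p q : (p <= q)%N ->
  (count_mem e (take p u) <= count_mem e (take q u))%N.
Proof.
move=> pq; rewrite -(cat_take_drop p (take q u)) count_cat take_takel //.
exact: leq_addr.
Qed.

Lemma count_take_lt e u p q : (p < q)%N -> (p < size u)%N -> nth false u p = e ->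
  (count_mem e (take p u) < count_mem e (take q u))%N.
Proof.
move=> pq pu ue; apply: leq_trans (count_take_le e u pq).
by rewrite (take_nth false) // -cats1 count_cat /= ue eqxx addn1.
Qed.

Lemma count_take_inj e u p q : (p < size u)%N -> (q < size u)%N ->
  nth false u p = e -> nth false u q = e ->
  count_mem e (take p u) = count_mem e (take q u) -> p = q.
Proof.
move=> pu qu pe qe h; case: (ltngtP p q) => // pq.
  by have := count_take_lt pq pu pe; rewrite h ltnn.
by have := count_take_lt pq qu qe; rewrite h ltnn.
Qed.

(** If the 1 at [q] preceded the 0 at [p], the prefix ending with that 1 would have no more zeros
    than ones. Strictness of the prefix condition is what affords the [.+1]. *)
Lemma dyck_cross n u p q : extended_dyck n u -> (p < size u)%N -> (q < size u)%N ->
  nth false u p = false -> nth false u q = true ->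
  (count_mem false (take p u) <= (count_mem true (take q u)).+1)%N -> (p < q)%N.
Proof.
move=> [_ _ hd] pu qu pe qe h; rewrite ltnNge leq_eqVlt; apply/negP => /orP[/eqP e|qp].
  by rewrite e pe in qe.
have h1 := count_take_lt (ltnSn q) qu qe.
have h2 : (q.+1 < size u)%N by apply: leq_trans pu.
by have := hd q.+1 h2; have := count_take_le false u qp; lia.
Qed.

End Words.

(** * Moving finitely many elements between pieces *)

Section Relabel.
Variables (X : eqType) (A : set X) (prec : X -> X -> Prop).
Variables (w : seq bool) (ns : nat -> nat) (rho rk : X -> nat).
Hypothesis ho : strict_total_on A prec.
Hypothesis rho_lt : forall x, A x -> (rho x < size w)%N.
Hypothesis rho_mono : forall x y, A x -> A y -> prec x y -> (rho x <= rho y)%N.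
Hypothesis rk_prec : forall x y, A x -> A y -> rho x = rho y ->
  prec x y <-> if nth false w (rho x) then (rk y < rk x)%N else (rk x < rk y)%N.
Hypothesis rk_inj : forall x y, A x -> A y -> rho x = rho y -> rk x = rk y -> x = y.
Hypothesis rk_surj : forall j m, (j < size w)%N -> exists x, [/\ A x, rho x = j & rk x = m].
Hypothesis adm : admissible w ns.

Notation ltr := (nth false w).

(* The piece of index [l] gives up its [ns i] extremal elements, which are put
   in front of the letter 1 of index [i]: its last ones if [l] is the previous
   letter 1, its first ones if [i] is the first letter 1 and [l] the first
   letter 0 after it. *)
Definition source l i :=
  [/\ ltr l = true, (l < i < size w)%N & forall k, (l < k < i)%N -> ltr k = false] \/
  [/\ ltr l = false, (i < l < size w)%N, forall k, (k < i)%N -> ltr k = false &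
      forall k, (i < k < l)%N -> ltr k = true].

Definition fsource l i := ltr i = true /\ source l i.

Lemma source_fun l i i' : fsource l i -> fsource l i' -> i = i'.
Proof.
move=> [wi [[wl li h]|[wl il h1 h2]]] [wi' [[wl' li' h']|[wl' il' h1' h2']]].
- case: (ltngtP i i') => // c.
    by have h0 := h' i ltac:(lia); rewrite wi in h0.
  by have h0 := h i' ltac:(lia); rewrite wi' in h0.
- by rewrite wl in wl'.
- by rewrite wl in wl'.
- case: (ltngtP i i') => // c.
    by have := h1' i c; rewrite wi.
  by have := h1 i' c; rewrite wi'.
Qed.

Lemma source_inj l l' i : fsource l i -> fsource l' i -> l = l'.
Proof.
move=> [wi [[wl li h]|[wl il h1 h2]]] [_ [[wl' li' h']|[wl' il' h1' h2']]].
- case: (ltngtP l l') => // c.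
    by have h0 := h l' ltac:(lia); rewrite wl' in h0.
  by have h0 := h' l ltac:(lia); rewrite wl in h0.
- by have h0 := h1' l ltac:(lia); rewrite wl in h0.
- by have h0 := h1 l' ltac:(lia); rewrite wl' in h0.
- case: (ltngtP l l') => // c.
    by have h0 := h2' l ltac:(lia); rewrite wl in h0.
  by have h0 := h2 l' ltac:(lia); rewrite wl' in h0.
Qed.

(** Rule (a) covers exactly the absence of a source: no 1 before [i] and no 0 after it. *)
Lemma source_exists i : (i < size w)%N -> ltr i = true -> (0 < ns i)%N ->
  exists l, fsource l i.
Proof.
move=> iw wi n0; case: (pselect (exists l, (l < i)%N && ltr l)) => [ex|none].
  have [l /andP[li wl] lmax] := ex_maxnP ex (fun k (h : (k < i)%N && ltr k) => ltnW (andP h).1).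
  exists l; split=> //; left; split=> //; first by rewrite li.
  move=> k /andP[lk ki]; apply/negP => wk.
  by have := lmax k; rewrite ki wk leqNgt lk => /(_ isT).
have b k : (k < i)%N -> ltr k = false.
  by move=> ki; apply/negP => wk; apply: none; exists k; rewrite ki.
case: (pselect (exists l, (i < l < size w)%N && ~~ ltr l)) => [ex|none'].
  have [l /andP[il wl] lmin] := ex_minnP ex.
  exists l; split=> //; right; split=> //; first exact: negbTE.
  move=> k /andP[ik kl]; apply/negPn/negP => wk.
  have kw : (k < size w)%N by lia.
  by have := lmin k; rewrite ik kw wk => /(_ isT); rewrite leqNgt kl.
have := adm iw wi b; move=> h; rewrite h // in n0.
move=> l /andP[il lw]; apply/negPn/negP => wl; apply: none'; exists l.
rewrite wl lw andbT ltn_neqAle il !andbT; apply: contraNneq wl => <-.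
by rewrite wi.
Qed.

Definition moved x := exists i, fsource (rho x) i /\ (rk x < ns i)%N.

(* Among the elements put in the letter [i], those that were moved get the
   smaller label. *)
Definition is_label x m :=
  (exists i, [/\ fsource (rho x) i, (rk x < ns i)%N & m = i.*2]) \/
  (~ moved x /\ m = (rho x).*2.+1).

Lemma moved_rank l : exists n, forall x, A x -> rho x = l -> (moved x <-> (rk x < n)%N).
Proof.
case: (pselect (exists i, fsource l i)) => [[i li]|none].
  exists (ns i) => x Ax xl; rewrite /moved xl; split; last by exists i.
  by move=> [i' [li' h]]; rewrite (source_fun li li').
exists 0%N => x Ax xl; split=> // -[i]; rewrite xl => -[li _].
by case: none; exists i.
Qed.

(** Removing the elements of small [rk] leaves an [omega] or an [omega_star] of the same type, so
    pieces lose nothing by serving as sources. An element is carried only across letters opposite to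
    its own, whence the last conclusion, which will keep the new order a reflection order. *)
Lemma relabel : exists prec' : X -> X -> Prop,
  [/\ strict_total_on A prec', has_order_type A prec' (word_type w ns) &
    forall x y, A x -> A y -> prec' x y -> prec y x ->
      [/\ (rho y < rho x)%N, ltr (rho y) = true & ltr (rho x) = false]].
Proof.
have [irr tr tot] := ho.
have /choice[lab labP] : forall x, exists m, is_label x m.
  move=> x; case: (pselect (moved x)) => [[i [h1 h2]]|h].
    by exists i.*2; left; exists i.
  by exists (rho x).*2.+1; right.
have lab_rho x y : lab x = lab y -> rho x = rho y.
  move=> e; have [[i [h1 _ E1]]|[_ E1]] := labP x; have [[i' [h1' _ E1']]|[_ E1']] := labP y.
  - have ii' : i = i' by lia.
    by rewrite ii' in h1; apply: source_inj h1 h1'.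
  - lia.
  - lia.
  - lia.
pose prec' x y := (lab x < lab y)%N \/ (lab x = lab y /\ prec x y).
have ho' : strict_total_on A prec'.
  split.
  - by move=> x Ax [|[_]]; [rewrite ltnn|apply: irr].
  - move=> x y z Ax Ay Az [h1|[h1 h2]] [h3|[h3 h4]].
    + by left; apply: ltn_trans h1 h3.
    + by left; rewrite -h3.
    + by left; rewrite h1.
    + by right; split; [rewrite h1|apply: tr h2 h4].
  - move=> x y Ax Ay; case: (ltngtP (lab x) (lab y)) => h.
    + by constructor 1; left.
    + by constructor 3; left.
    + by case: (tot x y Ax Ay) => h'; [constructor 1; right|constructor 2|constructor 3; right].
exists prec'; split=> //.
- have unm i x : A x -> lab x = i.*2.+1 <-> rho x = i /\ ~ moved x.
    move=> Ax; have [[i' [h1 h2 E]]|[h E]] := labP x; rewrite E; split.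
    + lia.
    + by move=> [_]; case; exists i'.
    + by move=> e; split=> //; lia.
    + by move=> [-> _].
  have mvd i x : A x -> lab x = i.*2 <-> fsource (rho x) i /\ (rk x < ns i)%N.
    move=> Ax; have [[i' [h1 h2 E]]|[h E]] := labP x; rewrite E; split.
    + by move=> e; have <- : i' = i by lia.
    + by move=> [h3 h4]; rewrite (source_fun h1 h3).
    + lia.
    + by move=> [h3 h4]; case: h; exists i.
  have sameprec i x y : lab x = i -> lab y = i -> prec' x y <-> prec x y.
    move=> xi yi; rewrite /prec' xi yi; split=> [[|[]]//|h]; last by right.
    by rewrite ltnn.
  (* The elements kept in a piece are those of rank at least [n]; subtracting [n] reindexes them by
     [nat]. *)
  have rest i n : (i < size w)%N ->
      (forall x, A x -> rho x = i -> (moved x <-> (rk x < n)%N)) ->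
      has_order_type [set x | A x /\ lab x = i.*2.+1]%classic prec'
        (if ltr i then omega_star else omega).
    move=> iw hn.
    have memP x : A x -> lab x = i.*2.+1 -> rho x = i /\ (n <= rk x)%N.
      move=> Ax /(unm i x Ax)[xi nm]; split=> //; rewrite leqNgt; apply/negP => h.
      by apply: nm; apply/hn.
    have key : has_order_type [set x | A x /\ lab x = i.*2.+1]%classic
        (if ltr i then (fun x y => prec' y x) else prec') omega.
      apply: (@order_type_of_map _ _ _ omega (fun x => rk x - n)%N).
      + move=> x y [Ax lx] [Ay ly]; have [xi xn] := memP x Ax lx; have [yi yn] := memP y Ay ly.
        have exy : rho x = rho y by rewrite xi yi.
        have := rk_prec Ax Ay exy; have := rk_prec Ay Ax (esym exy); rewrite xi yi.
        by case: ifP => _ h1 h2 /=;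
          [rewrite (sameprec _ _ _ ly lx) h1|rewrite (sameprec _ _ _ lx ly) h2]; split; lia.
      + move=> x y [Ax lx] [Ay ly]; have [xi xn] := memP x Ax lx; have [yi yn] := memP y Ay ly.
        by move=> e; apply: rk_inj => //; [rewrite xi yi|lia].
      + move=> m; have [x [Ax xi xm]] := rk_surj (n + m) iw.
        exists x; last by rewrite xm addKn.
        by split=> //; apply/(unm i x Ax); split=> //; rewrite hn // xm; lia.
    by move: key; case: ifP => // _ /order_type_flip_omega.
  apply: (@word_type_fibers _ A prec' w ns (fun x => (lab x)./2)) => //.
  + move=> x Ax; have [[i [[_ h1] _ ->]]|[_ ->]] := labP x.
      by rewrite doubleK; case: h1 => [[]|[]]; lia.
    by rewrite -[_./2]/(uphalf _) uphalf_double rho_lt.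
  + by move=> x y Ax Ay [h|[-> //]]; apply: half_leq; apply: ltnW.
  move=> i iw; have [n hn] := moved_rank i.
  have half x : (lab x)./2 = i <-> lab x = i.*2 \/ lab x = i.*2.+1.
    by split; lia.
  case wi: (ltr i); last first.
    have := rest i n iw hn; rewrite wi; apply: order_type_ext => x /=.
    split=> [[Ax h]|[Ax /half[h|//]]]; first by split=> //; apply/half; right.
    by have [[]] := (mvd i x Ax).1 h; rewrite wi.
  apply: (@order_type_ext _ [set x | (A x /\ lab x = i.*2) \/ (A x /\ lab x = i.*2.+1)]%classic).
    move=> x /=; split; first by case=> -[Ax h]; split=> //; apply/half; [left|right].
    by move=> [Ax /half[h|h]]; [left|right].
  apply: order_type_osum.
  + move=> x y [Ax lx] [Ay ly]; rewrite /prec' lx ly; split; first by left.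
    by case=> [|[]]; lia.
  + case: (posnP (ns i)) => [n0|npos].
      rewrite n0; apply: (@order_type_of_rank_fin _ _ _ _ rk) => //.
      * by move=> x y [Ax /(mvd i x Ax)[_]]; rewrite n0.
      * by move=> x y [Ax /(mvd i x Ax)[_]]; rewrite n0.
      * by move=> x [Ax /(mvd i x Ax)[_]]; rewrite n0.
    have [l li] := source_exists iw wi npos.
    have lw : (l < size w)%N by case: li => _ [[]|[]]; lia.
    have memP x : A x -> lab x = i.*2 -> rho x = l /\ (rk x < ns i)%N.
      by move=> Ax /(mvd i x Ax)[h1 h2]; split=> //; apply: source_inj h1 li.
    have key : has_order_type [set x | A x /\ lab x = i.*2]%classic
        (if ltr l then (fun x y => prec' y x) else prec') (ofin (ns i)).
      apply: (@order_type_of_rank_fin _ _ _ _ rk).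
      * move=> x y [Ax lx] [Ay ly]; have [xi xn] := memP x Ax lx; have [yi yn] := memP y Ay ly.
        have exy : rho x = rho y by rewrite xi yi.
        have := rk_prec Ax Ay exy; have := rk_prec Ay Ax (esym exy); rewrite xi yi.
        by case: ifP => _ h1 h2 /=;
          [rewrite (sameprec _ _ _ ly lx) h1|rewrite (sameprec _ _ _ lx ly) h2].
      * move=> x y [Ax lx] [Ay ly]; have [xi xn] := memP x Ax lx; have [yi yn] := memP y Ay ly.
        by move=> e; apply: rk_inj => //; rewrite xi yi.
      * by move=> x [Ax lx]; have [] := memP x Ax lx.
      * move=> m mn; have [x [Ax xi xm]] := rk_surj m lw.
        by exists x => //; split=> //; apply/(mvd i x Ax); rewrite xi xm.
    by move: key; case: ifP => // _ /order_type_flip_fin.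
  + by have := rest i n iw hn; rewrite wi.
- move=> x y Ax Ay [h|[_ h]] yx; last by case: (strict_total_asym ho Ax Ay h).
  have le := rho_mono Ay Ax yx.
  have piece : rho y = rho x -> if ltr (rho y) then (rk x < rk y)%N else (rk y < rk x)%N.
    by move=> e; apply/(rk_prec Ay Ax e).
  have [[i [[wi sx] nx Ex]]|[mx Ex]] := labP x; have [[i' [[wi' sy] ny Ey]]|[my Ey]] := labP y;
    rewrite Ex Ey in h.
  + case: sx => [[a1 a2 a3]|[a1 a2 a3 a4]]; case: sy => [[b1 b2 b3]|[b1 b2 b3 b4]].
    * have [e|ne] := eqVneq (rho y) (rho x).
        by have h0 := b3 i ltac:(lia); rewrite wi in h0.
      by have h0 := b3 (rho x) ltac:(lia); rewrite a1 in h0.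
    * by have h0 := b3 i ltac:(lia); rewrite wi in h0.
    * split=> //; rewrite ltn_neqAle le andbT; apply/eqP => e.
      by rewrite e a1 in b1.
    * by have h0 := b3 i ltac:(lia); rewrite wi in h0.
  + case: sx => [[a1 a2 a3]|[a1 a2 a3 a4]]; first lia.
    have ne : rho y <> rho x.
      move=> e; have := piece e; rewrite e a1 => h'; apply: my; exists i; rewrite e.
      by split; [split=> //; right|apply: ltn_trans h' nx].
    split=> //; first by lia.
    have [<- //|ne'] := eqVneq i (rho y).
    by apply: a4; lia.
  + case: sy => [[b1 b2 b3]|[b1 b2 b3 b4]]; last lia.
    have ne : rho y <> rho x.
      move=> e; have := piece e; rewrite b1 => h'; apply: mx; exists i'; rewrite -e.
      by split; [split=> //; left|apply: ltn_trans h' ny].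
    split=> //; first by lia.
    by apply: b3; lia.
  + lia.
Qed.

End Relabel.

Local Open Scope ring_scope.

(** * Root systems *)

Lemma seq_argmin (R : realDomainType) (T : eqType) (f : T -> R) (s : seq T)
    (P : T -> Prop) : (exists2 x, x \in s & P x) ->
  exists x, [/\ x \in s, P x & forall y, y \in s -> P y -> f x <= f y].
Proof.
elim: s => [[]//|a s IH] [x xs Px].
case: (pselect (exists2 x, x \in s & P x)) => [/IH[m [ms Pm mmin]]|none].
  case: (pselect (P a /\ f a < f m)) => [[Pa am]|na].
    exists a; rewrite inE eqxx; split=> // y; rewrite inE => /orP[/eqP -> //|ys Py].
    exact: le_trans (ltW am) (mmin y ys Py).
  exists m; rewrite inE ms orbT; split=> // y; rewrite inE => /orP[/eqP -> Pa|]; last exact: mmin.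
  by rewrite leNgt; apply/negP => h; apply: na.
have e : x = a.
  by move: xs; rewrite inE => /orP[/eqP //|xs]; case: none; exists x.
exists x; rewrite e inE eqxx -e; split=> // y; rewrite inE e => /orP[/eqP -> //|ys Py].
by case: none; exists y.
Qed.

Section Roots.
Variables (R : realType) (V : vectType R) (ip : {dot V for idfun}).
Implicit Types (a b c v : V).

Lemma ipC a b : ip a b = ip b a.
Proof. by rewrite hermC /= expr0 mul1r. Qed.
Lemma ipDl a b c : ip (a + b) c = ip a c + ip b c. Proof. exact: linearDl. Qed.
Lemma ipDr a b c : ip c (a + b) = ip c a + ip c b. Proof. exact: linearDr. Qed.
Lemma ipNl a c : ip (- a) c = - ip a c. Proof. exact: linearNl. Qed.
Lemma ipNr a c : ip c (- a) = - ip c a. Proof. exact: linearNr. Qed.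
Lemma ipZl (k : R) a c : ip (k *: a) c = k * ip a c. Proof. exact: linearZl_LR. Qed.
Lemma ipZr (k : R) a c : ip c (k *: a) = k * ip c a. Proof. exact: linearZr. Qed.
Lemma ip0l c : ip 0 c = 0. Proof. exact: linear0l. Qed.
Lemma ip0r c : ip c 0 = 0. Proof. exact: linear0r. Qed.
Lemma ip_suml I (r : seq I) (P : pred I) (F : I -> V) c :
  ip (\sum_(i <- r | P i) F i) c = \sum_(i <- r | P i) ip (F i) c.
Proof. exact: linear_sumlz. Qed.
Lemma ip_sumr I (r : seq I) (P : pred I) (F : I -> V) c :
  ip c (\sum_(i <- r | P i) F i) = \sum_(i <- r | P i) ip c (F i).
Proof. exact: linear_sumr. Qed.

Definition ipE := (ipDl, ipDr, ipNl, ipNr, ipZl, ipZr, ip0l, ip0r).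

Lemma ip_gt0 a : a != 0 -> 0 < ip a a. Proof. exact: neq0_dnorm_gt0. Qed.

Lemma ip_le0 a : ip a a <= 0 -> a = 0.
Proof. by move=> h; apply: contraTeq h => /ip_gt0; rewrite ltNge. Qed.

Variable Phi : seq V.
Hypothesis hPhi : root_system ip Phi.

Lemma root_neq0 a : a \in Phi -> a != 0.
Proof. by have [h _ _ _ _] := hPhi; apply: contraTneq => ->. Qed.

Lemma root_gt0 a : a \in Phi -> 0 < ip a a.
Proof. by move=> /root_neq0/ip_gt0. Qed.

Lemma root_reflect a b : a \in Phi -> b \in Phi -> reflect_root ip a b \in Phi.
Proof. by have [_ _ h _ _] := hPhi; apply: h. Qed.

Lemma root_opp a : a \in Phi -> - a \in Phi.
Proof.
move=> Pa; have := root_reflect Pa Pa; rewrite /reflect_root.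
have h := lt0r_neq0 (root_gt0 Pa).
by rewrite mulfK // scaler_nat mulr2n opprD addrA subrr sub0r.
Qed.

Lemma root_oppE a : (- a \in Phi) = (a \in Phi).
Proof. by apply/idP/idP => /root_opp //; rewrite opprK. Qed.

Lemma root_scale a (k : R) : a \in Phi -> k *: a \in Phi -> k = 1 \/ k = -1.
Proof. by have [_ _ _ _ h] := hPhi; apply: h. Qed.

(* A negative Cartan integer is either [-1], in which case the reflection gives
   the sum, or at most [-2]. *)
Lemma cartan_le a b : a \in Phi -> b \in Phi -> ip b a < 0 ->
  2 * ip b a <= - ip a a /\ (a + b \in Phi \/ ip b a <= - ip a a).
Proof.
move=> Pa Pb h; have a0 := root_gt0 Pa.
have [_ _ _ /(_ a b Pa Pb)/Num.Theory.intrP[m em] _] := hPhi.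
have e : 2 * ip b a = m%:~R * ip a a by rewrite -em divfK // lt0r_neq0.
have m0 : (m < 0)%R.
  rewrite -(ltrz0 R) -em pmulr_llt0 ?invr_gt0 //; lra.
have [m1|m1] := eqVneq m (-1).
  split; first by rewrite e m1 mulrNz mulr1z mulN1r.
  left; have := root_reflect Pa Pb; rewrite /reflect_root em m1.
  by rewrite mulrNz mulr1z scaleN1r opprK addrC.
have m2 : (m <= -2)%R by lia.
have h2 : m%:~R <= -2 :> R by have := m2; rewrite -(ler_int R) mulrNz.
have h3 : 2 * ip b a <= -2 * ip a a by rewrite e ler_pM2r.
by split; [lra|right; lra].
Qed.

(** If neither reflection yields the sum, [ip a b] is at most minus each of the two squared lengths,
    so [a + b] is isotropic. *)
Lemma root_add a b : a \in Phi -> b \in Phi -> ip a b < 0 -> b != - a -> a + b \in Phi.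
Proof.
move=> Pa Pb h ne; have hb : ip b a < 0 by rewrite ipC.
have [_ [//|h1]] := cartan_le Pa Pb hb.
have [_ [|h2]] := cartan_le Pb Pa h; first by rewrite addrC.
have : a + b = 0 by apply: ip_le0; rewrite !ipE (ipC b a) in h1 *; lra.
by move/eqP; rewrite addrC addr_eq0 (negbTE ne).
Qed.

Lemma root_sub a b : a \in Phi -> b \in Phi -> 0 < ip a b -> a != b -> a - b \in Phi.
Proof.
move=> Pa Pb h ne; apply: root_add => //; first exact: root_opp.
  by rewrite ipNr oppr_lt0.
by rewrite eqr_opp eq_sym.
Qed.

Section SimpleSystem.
Variable Delta : seq V.
Hypothesis hD : simple_system Phi Delta.
Notation n := (size Delta).
Notation X := (in_tuple Delta).

Definition simple_root (i : 'I_n) : V := Delta`_i.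
Definition cf (i : 'I_n) : V -> R := coord X i.
Notation s := simple_root.

Lemma cfD i a b : cf i (a + b) = cf i a + cf i b. Proof. exact: linearD. Qed.
Lemma cfN i a : cf i (- a) = - cf i a. Proof. exact: linearN. Qed.
Lemma cfB i a b : cf i (a - b) = cf i a - cf i b. Proof. exact: linearB. Qed.
Lemma cfZ i (k : R) a : cf i (k *: a) = k * cf i a. Proof. exact: linearZ. Qed.
Lemma cf0 i : cf i 0 = 0. Proof. exact: linear0. Qed.

Lemma simple_free : free X.
Proof. by have [/andP[]] := hD. Qed.

Lemma cf_sum v : v = \sum_i cf i v *: s i.
Proof. by have [h _ _] := hD; exact: (@coord_basis _ _ {:V}%VS n X v h (memvf v)). Qed.

Lemma cf_simple i j : cf i (s j) = (i == j)%:R.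
Proof. by rewrite /cf coord_free ?simple_free // eq_sym. Qed.

Lemma cf_sumE (k : 'I_n -> R) i : cf i (\sum_j k j *: s j) = k i.
Proof. exact: coord_sum_free simple_free. Qed.

Lemma cf_psum (P : pred 'I_n) (k : 'I_n -> R) i :
  cf i (\sum_(j | P j) k j *: s j) = if P i then k i else 0.
Proof.
have -> : \sum_(j | P j) k j *: s j = \sum_j (if P j then k j else 0) *: s j.
  by rewrite big_mkcond; apply: eq_bigr => j _; case: (P j); rewrite ?scale0r.
exact: cf_sumE.
Qed.

Lemma cf_eq0 v : (forall i, cf i v = 0) -> v = 0.
Proof. by move=> h; rewrite (cf_sum v) big1 // => i _; rewrite h scale0r. Qed.

Lemma simple_in_roots i : s i \in Phi.
Proof. by have [_ h _] := hD; apply/h/mem_nth. Qed.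

Lemma nonneg_combP v : nonneg_comb Delta v <-> forall i, 0 <= cf i v.
Proof.
split.
  move=> [c hc -> i].
  rewrite (big_nth 0) big_mkord (cf_sumE (fun j : 'I_n => c (s j))).
  exact/hc/mem_nth.
move=> h; exists (fun v' => \sum_(i | s i == v') cf i v).
  by move=> d _; apply: sumr_ge0.
rewrite (big_nth 0) big_mkord {1}(cf_sum v); apply: eq_bigr => i _; congr (_ *: _).
rewrite (big_pred1 i) // => j; apply/eqP/eqP => [/eqP|-> //].
rewrite /s nth_uniq // ?(free_uniq simple_free) // => /eqP; exact: val_inj.
Qed.

Lemma root_sign a : a \in Phi -> (forall i, 0 <= cf i a) \/ (forall i, cf i a <= 0).
Proof.
have [_ _ h] := hD; move=> /h[/nonneg_combP|/nonneg_combP]; first by left.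
by move=> h'; right=> i; have := h' i; rewrite cfN oppr_ge0.
Qed.

Lemma root_cf_neq0 a : a \in Phi -> exists i, cf i a != 0.
Proof.
move=> Pa; apply: contrapT => /forallNP h; have /eqP := root_neq0 Pa; apply.
by apply: cf_eq0 => i; apply/eqP/negPn/negP/h.
Qed.

Lemma root_pos a i : a \in Phi -> 0 < cf i a -> forall j, 0 <= cf j a.
Proof. by move=> /root_sign[//|h] h'; have := h i; rewrite leNgt h'. Qed.

Lemma simple_neq i j : i != j -> s i != s j.
Proof.
by move=> ij; rewrite /s nth_uniq // ?(free_uniq simple_free) //; apply: contra ij.
Qed.

(** A positive product would make [s i - s j] a root with coefficients of both signs. *)
Lemma simple_ip i j : i != j -> ip (s i) (s j) <= 0.
Proof.
move=> ij; rewrite leNgt; apply/negP => h.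
have Pd := root_sub (simple_in_roots i) (simple_in_roots j) h (simple_neq ij).
have hi : 0 < cf i (s i - s j) by rewrite cfB !cf_simple eqxx (negbTE ij) subr0 ltr01.
by have := root_pos Pd hi j; rewrite cfB !cf_simple eqxx eq_sym (negbTE ij) sub0r oppr_ge0 ler10.
Qed.

Lemma simple_ip_le i j : i != j -> ip (s i) (s j) != 0 ->
  2 * ip (s i) (s j) <= - ip (s i) (s i).
Proof.
move=> ij h; have lt0 : ip (s j) (s i) < 0.
  by rewrite ipC lt_neqAle h simple_ip.
by have [] := cartan_le (simple_in_roots i) (simple_in_roots j) lt0; rewrite (ipC (s j)).
Qed.

(* Among the roots with the same part off [S] and a nonzero part on [S], one of
   minimal height would still be lowered by a simple reflection. *)
Lemma support_connected (S : {set 'I_n}) p : p \in Phi ->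
  (forall i j, i \in S -> j \notin S -> cf j p != 0 -> ip (s i) (s j) = 0) ->
  (forall i, i \in S -> cf i p = 0) \/ (forall j, j \notin S -> cf j p = 0).
Proof.
wlog ppos : p / forall i, 0 <= cf i p.
  move=> H Pp orth; have [/H|neg] := root_sign Pp; first exact.
  case: (H (- p)).
  - by move=> i; rewrite cfN oppr_ge0.
  - exact: root_opp.
  - by move=> i j iS jS; rewrite cfN oppr_eq0; apply: orth.
  - by move=> h; left=> i /h/eqP; rewrite cfN oppr_eq0 => /eqP.
  - by move=> h; right=> i /h/eqP; rewrite cfN oppr_eq0 => /eqP.
move=> Pp orth; apply: contrapT => /not_orP[/existsNP[i0 /not_implyP[Si0 /eqP pi0]]].
move=> /existsNP[j0 /not_implyP[Sj0 /eqP pj0]].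
pose ht v := \sum_i cf i v.
pose Q q := [/\ forall j, j \notin S -> cf j q = cf j p, forall i, 0 <= cf i q &
  exists2 i, i \in S & cf i q != 0].
have [|q [Pq [qS qpos [i1 Si1 qi1]] qmin]] := @seq_argmin _ _ ht Phi Q.
  by exists p => //; split=> //; exists i0.
pose qs := \sum_(i in S) cf i q *: s i.
have qs0 : 0 < ip qs qs.
  apply: ip_gt0; apply: contraNneq qi1 => h.
  by have := cf_psum (fun j => j \in S) (cf^~ q) i1; rewrite Si1 -/qs h cf0 => <-.
have [i Si hi] : exists2 i, i \in S & 0 < cf i q * ip (s i) qs.
  apply: contrapT => /forall2NP h; move: qs0; rewrite {1}/qs ip_suml ltNge => /negP; apply.
  apply: sumr_le0 => i Si; rewrite ipZl leNgt; apply/negP => hi.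
  by case: (h i).
have qi : 0 < cf i q.
  by rewrite lt_neqAle qpos andbT; apply: contraTneq hi => <-; rewrite mul0r ltxx.
have siqs : 0 < ip (s i) qs by rewrite pmulr_rgt0 in hi.
have siq : ip q (s i) = ip (s i) qs.
  rewrite ipC {1}(cf_sum q) (bigID (fun j => j \in S)) /= ipDr [X in _ + X]ip_sumr.
  rewrite [X in _ + X]big1 ?addr0 // => j Sj; rewrite ipZr.
  have [->|h] := eqVneq (cf j q) 0; first by rewrite mul0r.
  by rewrite orth ?mulr0 // -qS.
have ss0 := root_gt0 (simple_in_roots i).
pose k := 2 * ip q (s i) / ip (s i) (s i).
have k0 : 0 < k by rewrite /k siq divr_gt0 // mulr_gt0.
pose q' := reflect_root ip (s i) q.
have Pq' : q' \in Phi by apply: root_reflect => //; apply: simple_in_roots.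
have cq' j : cf j q' = cf j q - k * (j == i)%:R.
  by rewrite /q' /reflect_root cfB cfZ cf_simple.
have ij0 : (j0 == i) = false by apply: contraNF Sj0 => /eqP ->.
have pos' : forall j, 0 <= cf j q'.
  apply: (@root_pos _ j0) => //; rewrite cq' ij0 mulr0 subr0 qS //.
  by rewrite lt_neqAle eq_sym pj0 ppos.
have lt_ht : ht q' < ht q.
  rewrite /ht [X in X < _](eq_bigr _ (fun j _ => cq' j)) big_split /= -[X in _ < X]addr0.
  rewrite ltrD2l (bigD1 i) //= eqxx mulr1 big1 ?addr0 ?oppr_lt0 // => j /negbTE ->.
  by rewrite mulr0 oppr0.
have all0 j : j \in S -> cf j q' = 0.
  move=> Sj; apply/eqP/negPn/negP => nz; have := qmin q' Pq'; rewrite leNgt lt_ht.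
  move=> H; suff : Q q' by move/H.
  split=> //; last by exists j.
  move=> l Sl; rewrite cq' qS //; have -> : (l == i) = false.
    by apply: contraNF Sl => /eqP ->.
  by rewrite mulr0 subr0.
(* Lowering [q] destroyed its part on [S], so this part is a multiple of [s i]. Its product with
   [s i], which is positive, will turn out to be twice itself. *)
have qsE : qs = k *: s i.
  rewrite /qs (bigD1 i) //= big1 ?addr0 => [|j /andP[Sj /negbTE ji]].
    by have /eqP := all0 i Si; rewrite cq' eqxx mulr1 subr_eq0 => /eqP ->.
  by have /eqP := all0 j Sj; rewrite cq' ji mulr0 subr0 => /eqP ->; rewrite scale0r.
have : ip (s i) qs = 2 * ip q (s i).
  by rewrite qsE ipZr /k divfK // lt0r_neq0.
rewrite siq; lra.
Qed.

(** If no edge left [S], every root would be supported in [S] or off [S] by [support_connected], and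
    these two classes of roots would be orthogonal. *)
Lemma simple_connected (S : {set 'I_n}) i0 j0 : irreducible_roots ip Phi ->
  i0 \in S -> j0 \notin S -> exists i j, [/\ i \in S, j \notin S & ip (s i) (s j) != 0].
Proof.
move=> [_ hirr] Si0 Sj0; apply: contrapT => none.
have orth i j : i \in S -> j \notin S -> ip (s i) (s j) = 0.
  by move=> Si Sj; apply/eqP/negPn/negP => h; apply: none; exists i, j.
pose P v := [forall j, (j \notin S) ==> (cf j v == 0)].
have PP v : P v -> forall j, j \notin S -> cf j v = 0.
  by move=> /forallP h j Sj; have := h j; rewrite Sj => /eqP.
have cond : {in Phi &, forall a b, P a -> ~~ P b -> ip a b = 0}.
  move=> a b Pa Pb ha hb.
  have b0 i : i \in S -> cf i b = 0.
    have [H|h] := @support_connected S b Pb (fun i j Si Sj _ => orth i j Si Sj); first exact: H.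
    by case/negP: hb; apply/forallP => j; apply/implyP => /h ->.
  rewrite (cf_sum a) (cf_sum b) ip_suml big1 // => i _; rewrite ip_sumr big1 // => j _.
  rewrite ipZl ipZr; have [Si|Si] := boolP (i \in S); last by rewrite (PP a ha i Si) mul0r.
  have [Sj|Sj] := boolP (j \in S); first by rewrite (b0 j Sj) mul0r mulr0.
  by rewrite orth // !mulr0.
case: (hirr P cond) => h.
- have := PP _ (h _ (simple_in_roots j0)) j0 Sj0; rewrite cf_simple eqxx.
  by move/eqP; rewrite oner_eq0.
- have /negP := h _ (simple_in_roots i0); apply; apply/forallP => j.
  apply/implyP => Sj; rewrite cf_simple; have -> // : (j == i0) = false.
  by apply: contraNF Sj => /eqP ->.
Qed.

End SimpleSystem.
End Roots.

(** * The simple system of a closed half of the roots *)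

Lemma count_lt (T : eqType) (p q : pred T) (s : seq T) x :
  (forall y, p y -> q y) -> x \in s -> q x -> ~~ p x -> (count p s < count q s)%N.
Proof.
move=> pq xs qx px; rewrite (seq.permP (perm_to_rem xs) p) (seq.permP (perm_to_rem xs) q).
by rewrite /= qx (negbTE px) add0n add1n ltnS; apply: sub_count.
Qed.

Section ClosedHalf.
Variables (R : realType) (V : vectType R) (ip : {dot V for idfun}) (Phi : seq V).
Hypothesis hPhi : root_system ip Phi.
Variable Psi : V -> Prop.
Hypothesis psiR : forall a, Psi a -> a \in Phi.
Hypothesis psiX : forall a, a \in Phi -> Psi a \/ Psi (- a).
Hypothesis psiN : forall a, Psi a -> ~ Psi (- a).
Hypothesis psiD : forall a b, Psi a -> Psi b -> a + b \in Phi -> Psi (a + b).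

Lemma half_add a b : Psi a -> Psi b -> ip a b < 0 -> Psi (a + b).
Proof.
move=> Pa Pb h; apply: psiD => //.
by apply: (root_add hPhi) => //; try exact: psiR; apply/eqP => e; case: (psiN Pa); rewrite -e.
Qed.

(** In a vanishing sum the first term has a negative product with another one; merging the two gives
    a shorter vanishing sum in [Psi]. *)
Lemma half_sum_neq0 (s : seq V) : s != [::] -> (forall x, x \in s -> Psi x) ->
  \sum_(x <- s) x != 0.
Proof.
have [N] := ubnP (size s); elim: N s => // N IH [//|x s] /= hN _ hs.
have Px : Psi x by apply: hs; rewrite mem_head.
have x0 := root_gt0 hPhi (psiR Px).
rewrite big_cons; apply/eqP => e.
have neg : ip x (\sum_(y <- s) y) < 0.
  have -> : \sum_(y <- s) y = - x by apply/eqP; rewrite -addr_eq0 addrC e.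
  by rewrite ipNr oppr_lt0.
have [y ys hy] : exists2 y, y \in s & ip x y < 0.
  apply: contrapT => /forall2NP h; move: neg; rewrite ip_sumr ltNge => /negP; apply.
  rewrite big_seq; apply: sumr_ge0 => y ys; rewrite leNgt; apply/negP => hy.
  by case: (h y).
have Py : Psi y by apply: hs; rewrite inE ys orbT.
suff /eqP : \sum_(z <- x + y :: rem y s) z != 0.
  by apply; rewrite big_cons -[RHS]e (big_rem y ys) /= addrA.
apply: IH => //.
- rewrite /= size_rem //; case: s ys hN {e hs neg} => [//|z s] /= _; lia.
- move=> z; rewrite inE => /orP[/eqP ->|/mem_rem zs]; first exact: half_add.
  by apply: hs; rewrite inE zs orbT.
Qed.

(** A strict partial order by [half_sum_neq0]. Counting the roots below a given one provides a
    height although no linear functional positive on [Psi] is known yet. *)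
Definition half_lt a b :=
  exists s : seq V, [/\ s != [::], forall x, x \in s -> Psi x & b = a + \sum_(x <- s) x].

Lemma half_lt_irr a : ~ half_lt a a.
Proof.
move=> [s [s0 hs /eqP]]; rewrite -[X in X == _]addr0 (inj_eq (addrI a)) eq_sym.
exact/negP/half_sum_neq0.
Qed.

Lemma half_lt_trans a b c : half_lt a b -> half_lt b c -> half_lt a c.
Proof.
move=> [s [s0 hs ->]] [t [t0 ht ->]]; exists (s ++ t); split.
- by case: s s0 {hs}.
- by move=> x; rewrite mem_cat => /orP[/hs|/ht].
- by rewrite big_cat /= addrA.
Qed.

Lemma half_lt_addr a b : Psi b -> half_lt a (a + b).
Proof.
move=> Pb; exists [:: b]; split=> //; last by rewrite big_seq1.
by move=> x; rewrite inE => /eqP ->.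
Qed.

Definition half_height b := count (fun a => `[< half_lt a b >]) Phi.

Lemma half_height_lt a b : a \in Phi -> half_lt a b -> (half_height a < half_height b)%N.
Proof.
move=> Pa ab; apply: (@count_lt _ _ _ _ a) => //.
- by move=> c /asboolP ca; apply/asboolP; apply: half_lt_trans ab.
- exact/asboolP.
- apply/asboolP; exact: half_lt_irr.
Qed.

Definition indecomposable a := Psi a /\ ~ exists b c, [/\ Psi b, Psi c & a = b + c].

Lemma half_ind (P : V -> Prop) :
  (forall a, indecomposable a -> P a) ->
  (forall a b, Psi a -> Psi b -> Psi (a + b) -> P a -> P b -> P (a + b)) ->
  forall a, Psi a -> P a.
Proof.
move=> hi hs a; have [N] := ubnP (half_height a); elim: N a => // N IH a hN Pa.
case: (pselect (indecomposable a)) => [/hi //|]; move/not_andP => [//|/contrapT].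
move=> [b [c [Pb Pc e]]]; rewrite e in hN Pa *.
have hb := half_height_lt (psiR Pb) (half_lt_addr b Pc).
have := half_height_lt (psiR Pc) (half_lt_addr c Pb); rewrite (addrC c b) => hc.
by apply: hs => //; apply: IH => //; rewrite -ltnS; [apply: leq_ltn_trans hb hN|apply: leq_ltn_trans hc hN].
Qed.

Lemma indecomposable_ip a b : indecomposable a -> indecomposable b -> a != b -> ip a b <= 0.
Proof.
move=> [Pa na] [Pb nb] ab; rewrite leNgt; apply/negP => h.
have [P|P] := psiX (root_sub hPhi (psiR Pa) (psiR Pb) h ab).
  by apply: na; exists (a - b), b; split=> //; rewrite subrK.
by apply: nb; exists (- (a - b)), a; split=> //; rewrite opprB subrK.
Qed.

Definition half_base := undup [seq a <- Phi | `[< indecomposable a >]].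

Lemma mem_half_base a : a \in half_base <-> indecomposable a.
Proof.
rewrite mem_undup mem_filter; split; first by case/andP => /asboolP.
by move=> h; rewrite asboolT //=; case: h => /psiR.
Qed.

Notation n := (size half_base).
Notation X := (in_tuple half_base).
Notation e i := (half_base`_i).

Lemma half_base_indec (i : 'I_n) : indecomposable (e i).
Proof. exact/mem_half_base/mem_nth. Qed.

(* A root of maximal height in the cone of the [e i] with [0 < k i] has
   nonnegative products with them, hence zero products by the relation, so it
   would be isotropic. *)
Lemma half_base_nonneg (k : 'I_n -> R) : (forall i, 0 <= k i) ->
  \sum_i k i *: e i = 0 -> forall i, k i = 0.
Proof.
move=> k0 ke i; apply/eqP/negPn/negP => ki.
have {}ki : 0 < k i by rewrite lt_neqAle eq_sym ki k0.
pose P g := Psi g /\ exists c : 'I_n -> R, g = \sum_(j | 0 < k j) c j *: e j.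
have Pe j : 0 < k j -> P (e j).
  move=> kj; split; first by case: (half_base_indec j).
  exists (fun l => (l == j)%:R); rewrite (bigD1 j) //= eqxx scale1r big1 ?addr0 //.
  by move=> l /andP[_ /negbTE ->]; rewrite scale0r.
have [|g [Pg [Psig [c gE]] gmax]] := @seq_argmin _ _ (fun g => - (half_height g)%:R : R) Phi P.
  by exists (e i); [apply: psiR; case: (half_base_indec i)|apply: Pe].
have ge0 j : 0 < k j -> 0 <= ip g (e j).
  move=> kj; rewrite leNgt; apply/negP => h.
  have [Pej _] := Pe j kj; have Pgj := half_add Psig Pej h.
  have := half_height_lt Pg (half_lt_addr g Pej).
  have := gmax _ (psiR Pgj); rewrite lerN2 ler_nat => H; rewrite ltnNge H //.
  split=> //; exists (fun l => c l + (l == j)%:R).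
  have [_ [c' cE]] := Pe j kj.
  rewrite [in LHS]gE; under [RHS]eq_bigr do rewrite scalerDl.
  rewrite big_split /=; congr (_ + _).
  rewrite (bigD1 j) //= eqxx scale1r big1 ?addr0 // => l /andP[_ /negbTE ->].
  by rewrite scale0r.
have eq0 j : 0 < k j -> ip g (e j) = 0.
  move=> kj; have sum0 : \sum_j k j * ip g (e j) = 0.
    transitivity (ip g (\sum_j k j *: e j)); last by rewrite ke ip0r.
    by rewrite ip_sumr; apply: eq_bigr => l _; rewrite ipZr.
  have nn l : true -> 0 <= k l * ip g (e l).
    move=> _; have := k0 l; rewrite le_eqVlt => /orP[/eqP <-|kl]; first by rewrite mul0r.
    by rewrite mulr_ge0 // ge0.
  have /eqP : k j * ip g (e j) = 0 := psumr_eq0P nn sum0 isT; rewrite mulf_eq0 => /orP[/eqP h|/eqP //].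
  by rewrite h ltxx in kj.
have := root_gt0 hPhi Pg; rewrite {2}gE ip_sumr big1 ?ltxx // => j kj.
by rewrite ipZr eq0 // mulr0.
Qed.

(** Separate a relation into its positive and negative parts. Both equal one vector, whose squared
    norm is a sum of nonpositive terms because distinct indecomposables are obtuse; so it vanishes
    and [half_base_nonneg] applies to each part. *)
Lemma half_base_free : free half_base.
Proof.
apply/(@freeP _ _ _ X) => k ke.
pose kp i := Num.max (k i) 0; pose km i := Num.max (- k i) 0.
have kE i : k i = kp i - km i by rewrite /kp /km; case: lerP => h1; case: lerP => h2; lra.
have kp0 i : 0 <= kp i by rewrite le_max lexx orbT.
have km0 i : 0 <= km i by rewrite le_max lexx orbT.
have kpm i : kp i * km i = 0.
  by rewrite /kp /km; case: lerP => h1; case: lerP => h2; rewrite ?mulr0 ?mul0r //; lra.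
pose v := \sum_i kp i *: e i.
have vE : v = \sum_i km i *: e i.
  apply/eqP; rewrite -subr_eq0 -sumrB -[X in _ == X]ke; apply/eqP.
  by apply: eq_bigr => i _; rewrite kE scalerBl.
have v0 : v = 0.
  apply: (ip_le0 (ip := ip)); rewrite {1}/v vE ip_suml; apply: sumr_le0 => i _.
  rewrite ip_sumr; apply: sumr_le0 => j _; rewrite ipZl ipZr mulrA.
  have [->|ij] := eqVneq i j; first by rewrite kpm mul0r.
  rewrite mulr_ge0_le0 ?mulr_ge0 //; apply: indecomposable_ip.
  - exact: half_base_indec.
  - exact: half_base_indec.
  - by rewrite nth_uniq ?undup_uniq.
move=> i; rewrite kE (half_base_nonneg kp0 v0) (half_base_nonneg km0) ?subrr //.
by rewrite -vE.
Qed.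

Lemma half_base_nonneg_comb a : Psi a -> nonneg_comb half_base a.
Proof.
move: a; apply: half_ind => [a|a b _ _ _ [c c0 ->] [d d0 ->]].
  move/mem_half_base => ha; exists (fun d => (d == a)%:R); first by move=> d _; apply: ler0n.
  rewrite (bigD1_seq a) ?undup_uniq //= eqxx scale1r big1 ?addr0 // => d /negbTE ->.
  by rewrite scale0r.
exists (fun x => c x + d x); first by move=> x xb; rewrite addr_ge0 ?c0 ?d0.
by rewrite -big_split; apply: eq_bigr => x _; rewrite scalerDl.
Qed.

Lemma half_base_simple : simple_system Phi half_base.
Proof.
have [_ sp _ _ _] := hPhi; split.
- rewrite basisEfree half_base_free subvf /= -sp; apply: (@leq_trans (\dim <<half_base>>)); last exact: dim_span.
  apply: dimvS; apply/span_subvP => a Pa.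
  suff mem g : Psi g -> g \in <<half_base>>%VS.
    by have [/mem //|/mem] := psiX Pa; rewrite memvN.
  move=> /half_base_nonneg_comb[c _ ->]; rewrite big_seq; apply: memv_suml => d hd.
  exact/memvZ/memv_span.
- by move=> a /mem_half_base[/psiR].
- by move=> a /psiX[|] /half_base_nonneg_comb; [left|right].
Qed.

End ClosedHalf.

(** * Dynkin diagrams are caterpillars *)

Section Caterpillar.
Variables (R : realType) (V : vectType R) (ip : {dot V for idfun}).
Variables (T : finType) (e : rel T) (u : T -> V) (ht : V -> R).
Hypothesis eC : symmetric e.
Hypothesis hD : forall a b, ht (a + b) = ht a + ht b.
Hypothesis hZ : forall (k : R) a, ht (k *: a) = k * ht a.
Hypothesis hu : forall i, 0 < ht (u i).
Hypothesis u1 : forall i, ip (u i) (u i) = 1.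
Hypothesis u0 : forall i j, i != j -> ip (u i) (u j) <= 0.
Hypothesis ue : forall i j, e i j -> ip (u i) (u j) <= - (1 / 2).
Hypothesis conn : forall (S : {set T}) i j, i \in S -> j \notin S ->
  exists i' j', [/\ i' \in S, j' \notin S & e i' j'].

(** [ht] certifies that a positive combination of the [u i] is nonzero, so configurations that would
    make one isotropic are excluded. *)
Lemma positive_norm v : 0 < ht v -> 0 < ip v v.
Proof.
move=> hv; apply: ip_gt0; apply: contraTneq hv => ->.
by have := hZ 0 0; rewrite scale0r mul0r => ->; rewrite ltxx.
Qed.

Lemma edge_neq i j : e i j -> i != j.
Proof. by move=> /ue eij; apply: contraTneq eij => ->; rewrite u1; lra. Qed.

Notation psum p := (\sum_(i <- p) u i).

Lemma ip_psum_le0 i p : i \notin p -> ip (u i) (psum p) <= 0.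
Proof.
move=> ip'; rewrite ip_sumr big_seq; apply: sumr_le0 => j jp; apply: u0.
by apply: contraNneq ip' => ->.
Qed.

Lemma ip_psum_edge i j p : i \notin p -> uniq p -> j \in p -> e i j ->
  ip (u i) (psum p) <= - (1 / 2).
Proof.
move=> ni up jp eij; rewrite (big_rem j) //= ipDr.
have := ue eij; have : ip (u i) (psum (rem j p)) <= 0; last lra.
by apply: ip_psum_le0; apply: contraNN ni => /mem_rem.
Qed.

(** A further vertex adds its norm 1 and twice a product that is at most -1/2. *)
Lemma psum_path_le p : uniq p -> sorted e p -> ip (psum p) (psum p) <= 1.
Proof.
elim: p => [|x [|y p] IH] /=; first by rewrite big_nil ip0l.
  by rewrite big_seq1 u1.
move=> /andP[nx up] /andP[exy sp]; rewrite big_cons !ipE u1 (ipC ip (psum _)).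
have := ip_psum_edge nx up (mem_head y p) exy; have := IH up sp; lra.
Qed.

(* The sum of the unit vectors along the cycle would be isotropic. *)
Lemma no_cycle v p a b : uniq p -> sorted e p -> v \notin p -> a \in p -> b \in p ->
  a != b -> e v a -> e v b -> False.
Proof.
move=> up sp nv ap bp ab eva evb.
have H : ip (u v) (psum p) <= -1.
  have nv' : v \notin rem a p by apply: contraNN nv => /mem_rem.
  have b' : b \in rem a p by rewrite mem_rem_uniq // inE eq_sym ab.
  rewrite (big_rem a) //= ipDr.
  by have := ip_psum_edge nv' (rem_uniq a up) b' evb; have := ue eva; lra.
have hp : 0 <= ht (psum p).
  elim: (p) => [|x q IH]; first by have := hZ 0 0; rewrite scale0r mul0r big_nil => ->.
  by rewrite big_cons hD addr_ge0 // ltW.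
have : 0 < ht (u v + psum p) by rewrite hD ltr_pwDl.
move=> /positive_norm; rewrite !ipE u1 (ipC ip (psum p)).
have := psum_path_le up sp; lra.
Qed.

(* The affine diagram of type E6, with its null vector [3; 2, 2, 2; 1, 1, 1]. *)
Lemma no_spider w a1 a2 b1 b2 c1 c2 : uniq [:: w; a1; a2; b1; b2; c1; c2] ->
  e w a1 -> e a1 a2 -> e w b1 -> e b1 b2 -> e w c1 -> e c1 c2 -> False.
Proof.
rewrite /= !inE !negb_or -!andbA => /and5P[n1 n2 n3 n4 /and5P[n5 n6 n7 n8]].
move=> /and5P[n9 n10 n11 n12 /and5P[n13 n14 n15 n16 /and5P[n17 n18 n19 n20 _]]].
move=> ew1 ea ew2 eb ew3 ec.
(* Each arm has norm at most 3 and product at most -1 with [u w], so with weight 3 at the centre the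
   total is at most 9 + 3 * 3 - 2 * 3 * 3 = 0. *)
pose arm i j := 2 *: u i + u j.
have arm_le i j : e i j -> ip (arm i j) (arm i j) <= 3.
  by move=> /ue h1; rewrite /arm !ipE !u1 (ipC ip (u j)); lra.
have arm_w i j : e w i -> w != j -> ip (u w) (arm i j) <= -1.
  by move=> /ue h1 /u0 h2; rewrite /arm !ipE; lra.
have arm_arm i j i' j' : i != i' -> i != j' -> j != i' -> j != j' ->
    ip (arm i j) (arm i' j') <= 0.
  by move=> /u0 h1 /u0 h2 /u0 h3 /u0 h4; rewrite /arm !ipE; lra.
have harm i j : 0 < ht (arm i j).
  by rewrite /arm hD hZ; have := hu i; have := hu j; lra.
have [A AE] : exists A, A = arm a1 a2 by eexists.
have [B BE] : exists B, B = arm b1 b2 by eexists.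
have [C CE] : exists C, C = arm c1 c2 by eexists.
have : 0 < ht (3 *: u w + A + B + C).
  rewrite !hD hZ AE BE CE; have := hu w; have := harm a1 a2; have := harm b1 b2.
  by have := harm c1 c2; lra.
move=> /positive_norm; rewrite !ipE u1 (ipC ip B A) (ipC ip C A) (ipC ip C B).
rewrite !(ipC ip _ (u w)).
have := arm_le _ _ ea; have := arm_le _ _ eb; have := arm_le _ _ ec.
have := arm_w _ _ ew1 n2; have := arm_w _ _ ew2 n4; have := arm_w _ _ ew3 n6.
have := arm_arm _ _ _ _ n8 n9 n12 n13; have := arm_arm _ _ _ _ n10 n11 n14 n15.
have := arm_arm _ _ _ _ n17 n18 n19 n20.
rewrite -AE -BE -CE; lra.
Qed.

Section LongestPath.
Variable p : seq T.
Hypothesis up : uniq p.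
Hypothesis sp : sorted e p.
Hypothesis pmax : forall q, uniq q -> sorted e q -> (size q <= size p)%N.
Hypothesis p0 : p != [::].

(** Otherwise some edge joins a neighbour [x'] of a path vertex [w] to a vertex [v] not adjacent to
    the path. Replacing one side of the path by [x'] and [v] cannot lengthen it, so [w] has at least
    two path vertices on each side and is the centre of a forbidden spider. *)
Lemma spine_cover i : i \in p \/ exists2 x, x \in p & e i x.
Proof.
pose S := [set i | (i \in p) || has (e i) p].
have SP j : j \in S <-> (j \in p \/ exists2 x, x \in p & e j x).
  rewrite inE; split; first by case/orP => [|/hasP]; [left|right].
  by case=> [->//|ex]; apply/orP; right; apply/hasP.
apply/SP/negPn/negP => nS.
have [x xp] : exists x, x \in p by case: (p) p0 => // x q _; exists x; rewrite mem_head.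
have [|x' [v [/SP Sx' nv exv]]] := @conn S x i _ nS; first by apply/SP; left.
case: Sx' => [x'p|[w wp exw]].
  by case/negP: nv; apply/SP; right; exists x' => //; rewrite eC.
have nvp : v \notin p by apply: contraNN nv => vp; apply/SP; left.
have nwv : ~~ e v w by apply: contraNN nv => evw; apply/SP; right; exists w.
have [x'p|nx'p] := boolP (x' \in p).
  by case/negP: nv; apply/SP; right; exists x' => //; rewrite eC.
move: up sp pmax nvp nx'p; case/splitPr: wp => p1 p2.
rewrite cat_uniq /= => /and4P[up1 np12 nw2 up2].
move=> sp12 pm; rewrite !mem_cat !inE !negb_or => /and3P[nv1 nvw nv2] /and3P[nx1 nxw nx2].
have ne : x' != v := edge_neq exv.
have swp2 : path e w p2 by move: sp12; rewrite sorted_cat_cons => /andP[].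
have sp1w : sorted e (rcons p1 w) by move: sp12; rewrite sorted_cat_cons => /andP[].
have nw1 : w \notin p1 by move: np12; rewrite negb_or => /andP[].
have l1 : (2 <= size p1)%N.
  have := pm (v :: x' :: w :: p2); rewrite /= size_cat /= !inE !negb_or.
  rewrite (eq_sym v x') ne nvw nv2 nxw nx2 nw2 up2 (eC v) exv exw swp2 /=.
  by move=> /(_ isT isT) H; clear -H; lia.
have l2 : (2 <= size p2)%N.
  have := pm (rcons (rcons (rcons p1 w) x') v).
  rewrite !rcons_uniq !(mem_rcons, inE, negb_or) !size_rcons size_cat /=.
  rewrite (eq_sym v x') ne nvw nv1 nxw nx1 nw1 up1 /=.
  have -> : sorted e (rcons (rcons (rcons p1 w) x') v).
    rewrite -(cats1 _ v) -(cats1 _ x') -catA /=.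
    by rewrite cat_rcons sorted_cat_cons sp1w /= (eC w) exw exv.
  by move=> /(_ isT isT) H; clear -H; lia.
have [q1 [a1 [a2 E1]]] : exists q1 a1 a2, p1 = rcons (rcons q1 a2) a1.
  case/lastP: (p1) l1 => [//|r a1]; case/lastP: r => [|r a2]; first by rewrite size_rcons.
  by move=> _; exists r, a1, a2.
have [q2 [b1 [b2 E2]]] : exists q2 b1 b2, p2 = b1 :: b2 :: q2.
  by case: (p2) l2 => [|b1 [|b2 r]] // _; exists r, b1, b2.
move: swp2 sp1w; rewrite E1 E2 /= => /and3P[ewb1 eb _] sq.
have eaw : e a1 w /\ e a2 a1.
  move: sq. rewrite -!cats1 -!catA /= sorted_cat_cons /= => /andP[_ /and3P[]//].
have [ea1 ea2] := eaw.
apply: (@no_spider w a1 a2 b1 b2 x' v) => //; rewrite 1?eC //.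
move: np12 nw1 nw2 up1 up2 nx1 nx2 nv1 nv2 nxw nvw ne.
rewrite E1 E2 /= !(mem_rcons, rcons_uniq, inE, negb_or) -!andbA /=.
repeat first [case/andP; intro | intro].
do ![apply/andP; split] => //; by rewrite eq_sym.
Qed.


Definition leaves x := [seq v <- enum T | (v \notin p) && e v x].

(** The leaves of a spine vertex come between its birth and its death. The next spine vertex then
    has a birth index one more than the death index of [x], the largest delay that [dyck_cross]
    tolerates. *)
Fixpoint birth_order q := if q is x :: q' then x :: leaves x ++ birth_order q' else [::].
Fixpoint death_order q := if q is x :: q' then leaves x ++ x :: death_order q' else [::].

Lemma mem_leaves v x : (v \in leaves x) = (v \notin p) && e v x.
Proof. by rewrite mem_filter mem_enum andbT. Qed.

Lemma mem_birth q v : v \in birth_order q <-> v \in q \/ exists2 x, x \in q & v \in leaves x.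
Proof.
elim: q => [|x q IH] /=; first by split=> // -[//|[]].
rewrite inE mem_cat; split.
  case/or3P => [/eqP ->|h|/IH[h|[y yq h]]].
  - by left; rewrite mem_head.
  - by right; exists x; rewrite ?mem_head.
  - by left; rewrite inE h orbT.
  - by right; exists y; rewrite // inE yq orbT.
case=> [|[y]]; rewrite inE => /orP[/eqP ->|h].
- by rewrite eqxx.
- by apply/or3P/Or33/IH; left.
- by move=> ->; rewrite orbT.
- by move=> vy; apply/or3P/Or33/IH; right; exists y.
Qed.

Lemma mem_death q v : (v \in death_order q) = (v \in birth_order q).
Proof.
elim: q => [//|x q IH] /=; rewrite mem_cat !inE mem_cat IH.
by case: (v == x); case: (v \in leaves x).
Qed.

Lemma leaf_unique v x y : x \in p -> y \in p -> v \in leaves x -> e v y -> x = y.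
Proof.
move=> xp yp; rewrite mem_leaves => /andP[vp evx] evy; apply/eqP/negPn/negP => xy.
exact: (@no_cycle v p x y).
Qed.

Lemma leaf_leaf_aux x y i j p1 p2 : p = p1 ++ x :: p2 -> y \in p2 ->
  i \in leaves x -> j \in leaves y -> ~~ e i j.
Proof.
move=> pE yp2; rewrite !mem_leaves => /andP[ip' eix] /andP[jp ejy]; apply/negP => eij.
move: up sp ip' jp; rewrite pE; case/splitPr: yp2 => r1 r2.
rewrite -[r1 ++ y :: r2]cat_rcons -cat_cons => uu ss iN jN.
pose q := x :: rcons r1 y.
have uq : uniq q by move: uu; rewrite !cat_uniq => /and3P[_ _ /andP[]].
have sq : sorted e q.
  move: ss; rewrite /q /= sorted_cat_cons => /andP[_].
  by rewrite cat_path => /andP[].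
have jq : j \notin q by apply: contra jN => h; rewrite mem_cat mem_cat h orbT.
have iq : i \notin q by apply: contra iN => h; rewrite mem_cat mem_cat h orbT.
apply: (@no_cycle i (rcons q j) x j) => //.
- by rewrite rcons_uniq jq.
- by rewrite /q /= rcons_path last_rcons (eC y) ejy; move: sq => /= ->.
- rewrite mem_rcons inE negb_or iq andbT; exact: edge_neq.
- by rewrite mem_rcons inE mem_head orbT.
- by rewrite mem_rcons mem_head.
- by apply: contraNneq jq => <-; rewrite mem_head.
Qed.

Lemma leaf_leaf x y i j : x \in p -> y \in p ->
  i \in leaves x -> j \in leaves y -> ~~ e i j.
Proof.
move=> xp yp ix jy; have [E|xy] := eqVneq x y.
  apply/negP => eij; move: ix jy; rewrite -E !mem_leaves => /andP[ip' eix] /andP[jp ejx].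
  have xj : x != j by rewrite eq_sym edge_neq.
  apply: (@no_cycle i [:: x; j] x j) => //=.
  - by rewrite inE xj.
  - by rewrite eC ejx.
  - by rewrite !inE negb_or !edge_neq.
  - by rewrite mem_head.
  - by rewrite !inE eqxx orbT.
have [p1 [p2 pE]] : exists p1 p2, p = p1 ++ x :: p2.
  by case/splitPr: xp => p1 p2; exists p1, p2.
move: yp; rewrite pE mem_cat inE => /or3P[y1|/eqP e'|y2].
- have [q1 [q2 qE]] : exists q1 q2, p1 = q1 ++ y :: q2.
    by case/splitPr: y1 => q1 q2; exists q1, q2.
  rewrite eC; apply: (@leaf_leaf_aux y x j i q1 (q2 ++ x :: p2)) => //.
    by rewrite pE qE -catA.
  by rewrite mem_cat mem_head orbT.
- by rewrite e' eqxx in xy.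
- exact: leaf_leaf_aux pE y2 ix jy.
Qed.

Lemma orders_uniq q : uniq q -> {subset q <= p} ->
  uniq (birth_order q) /\ uniq (death_order q).
Proof.
elim: q => [//|x q IH] /= /andP[nx uq] sub.
have sq : {subset q <= p} by move=> z zq; apply: sub; rewrite inE zq orbT.
have xp : x \in p by apply: sub; rewrite mem_head.
have [ub ud] := IH uq sq.
have ul : uniq (leaves x) by rewrite filter_uniq ?enum_uniq.
have nl : x \notin leaves x by rewrite mem_leaves xp.
have nb : x \notin birth_order q.
  apply/negP => /mem_birth[|[y yq]]; first exact/negP.
  by rewrite mem_leaves xp.
have nlb v : v \in birth_order q -> v \notin leaves x.
  move=> /mem_birth[vq|[y yq vy]]; first by rewrite mem_leaves sq.
  apply/negP => vx; have exy : x = y.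
    by apply: leaf_unique vx _ => //; [apply: sq|move: vy; rewrite mem_leaves => /andP[]].
  by rewrite -exy (negbTE nx) in yq.
split.
  rewrite mem_cat negb_or nl nb cat_uniq ul ub /= andbT; apply/hasPn => v; exact: nlb.
rewrite cat_uniq ul /= ud negb_or nl mem_death nb !andbT.
by apply/hasPn => v; rewrite mem_death; apply: nlb.
Qed.

Lemma orders_overlap q i j : uniq q -> sorted e q -> {subset q <= p} ->
  i \in birth_order q -> j \in birth_order q -> i = j \/ e i j ->
  (index i (birth_order q) <= (index j (death_order q)).+1)%N.
Proof.
elim: q => [//|x q IH] /= /andP[nx uq] sxq sub iB jB ij.
have sq : {subset q <= p} by move=> z zq; apply: sub; rewrite inE zq orbT.
have xp : x \in p by apply: sub; rewrite mem_head.
case: eqP => [//|/eqP xi]; rewrite !index_cat /= ltnS.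
have iB' : i \in leaves x ++ birth_order q.
  by move: iB; rewrite inE eq_sym (negbTE xi).
have jD : [\/ j \in leaves x, j \notin leaves x /\ x = j |
    [/\ j \notin leaves x, x <> j & j \in birth_order q]].
  move: jB; rewrite inE mem_cat; have [|jl] := boolP (j \in leaves x); first by constructor 1.
  have [->|jx] := eqVneq x j; first by constructor 2.
  by move=> /= ?; constructor 3; split=> //; apply/eqP.
have [il|il] := boolP (i \in leaves x).
  case: jD => [jl|[jl /eqP xj]|[jl /eqP/negbTE jx jb]].
  - rewrite jl; case: ij => [-> //|eij].
    by have := leaf_leaf xp xp il jl; rewrite eij.
  - by rewrite (negbTE jl) xj addn0 ltnW // index_mem.
  - by rewrite (negbTE jl) jx ltnW // (leq_trans _ (leq_addr _ _)) // index_mem.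
have ib : i \in birth_order q by move: iB'; rewrite mem_cat (negbTE il).
have ssq : sorted e q by move: sxq; case: (q) => //= y r /andP[].
(* A neighbour of [x] further along must be the next spine vertex, which heads the remaining birth
   order; anything else would close a cycle. *)
have exi : e i x -> index i (birth_order q) = 0%N.
  move=> eix; case/mem_birth: ib => [iq|[y yq iy]]; last first.
    by have := leaf_unique (sq y yq) xp iy eix => yx; rewrite -yx yq in nx.
  move: sxq iq nx uq sq; case: (q) => [//|y r] /= /andP[exy sr]; rewrite inE.
  case/orP => [/eqP -> |ir]; first by rewrite eqxx.
  move=> nx /andP[ny ur] sq'; exfalso; apply: (@no_cycle x (y :: r) y i) => //.
  - by rewrite /= ny.
  - by rewrite mem_head.
  - by rewrite inE ir orbT.
  - by apply: contraNneq ny => ->.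
  - by rewrite eC.
case: jD => [jl|[jl xj]|[jl jx jb]].
- exfalso; have [jp ejx] : j \notin p /\ e j x.
    by move: jl; rewrite mem_leaves => /andP[].
  case: ij => [ijE|eij]; first by rewrite ijE jl in il.
  case/mem_birth: ib => [iq|[y yq iy]].
    have := leaf_unique xp (sq i iq) jl; rewrite eC => /(_ eij) xi'.
    by rewrite xi' eqxx in xi.
  by have := leaf_leaf (sq y yq) xp iy jl; rewrite eij.
- rewrite (negbTE jl) xj eqxx addn0; case: ij => [ijE|eij].
    by rewrite xj ijE eqxx in xi.
  by rewrite exi ?addn0 // xj.
- move/eqP/negbTE: jx => jx; rewrite (negbTE jl) jx leq_add2l.
  exact: IH.
Qed.

End LongestPath.

Lemma caterpillar_orders : (0 < #|T|)%N -> exists sg tu : seq T,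
  [/\ uniq sg /\ uniq tu, forall i, i \in sg, forall i, i \in tu &
   forall i j, i = j \/ e i j -> (index i sg <= (index j tu).+1)%N].
Proof.
move=> /card_gt0P[x0 _].
pose Q m := `[< exists q : seq T, [/\ uniq q, sorted e q & size q = m] >].
have exQ : exists m, Q m by exists 1%N; apply/asboolP; exists [:: x0].
have bQ m : Q m -> (m <= #|T|)%N.
  by move=> /asboolP[q [uq _ <-]]; rewrite -(card_uniqP uq); apply: max_card.
case: (ex_maxnP exQ bQ) => m /asboolP[p [up sp pm]] mmax.
have pmax q : uniq q -> sorted e q -> (size q <= size p)%N.
  by move=> uq sq; rewrite pm; apply: mmax; apply/asboolP; exists q.
have p0 : p != [::].
  by have := pmax [:: x0] isT isT; case: (p).
have all i : i \in birth_order p p.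
  apply/mem_birth; have [ip'|[x xp eix]] := spine_cover up sp pmax p0 i; first by left.
  have [ip'|ip'] := boolP (i \in p); first by left.
  by right; exists x => //; rewrite mem_leaves ip'.
exists (birth_order p p), (death_order p p); split=> //.
- exact: orders_uniq.
- by move=> i; rewrite mem_death.
- by move=> i j ij; apply: orders_overlap.
Qed.

End Caterpillar.

(** * Birth and death orders on the simple roots *)

Section SimpleOrders.
Variables (R : realType) (V : vectType R) (ip : {dot V for idfun}) (Phi Delta : seq V).
Hypotheses (hPhi : root_system ip Phi) (hirr : irreducible_roots ip Phi).
Hypothesis hD : simple_system Phi Delta.
Notation n := (size Delta).
Notation s := (@simple_root R V Delta).

Lemma simple_orders : (0 < n)%N -> exists sg tu : seq 'I_n,
  [/\ uniq sg /\ uniq tu, forall i, i \in sg, forall i, i \in tu &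
   forall i j, i = j \/ ip (s i) (s j) != 0 -> (index i sg <= (index j tu).+1)%N].
Proof.
move=> n0; pose e : rel 'I_n := fun i j => (i != j) && (ip (s i) (s j) != 0).
pose len i := Num.sqrt (ip (s i) (s i)).
pose u i := (len i)^-1 *: s i.
pose ht v := \sum_i cf (i : 'I_n) v.
have s0 i : 0 < ip (s i) (s i) by apply: (root_gt0 hPhi); apply: simple_in_roots hD i.
have len0 i : 0 < len i by rewrite sqrtr_gt0.
have lenE i : len i * len i = ip (s i) (s i) by rewrite -expr2 sqr_sqrtr // ltW.
have li0 i : 0 < (len i)^-1 by rewrite invr_gt0.
have uu i j : ip (u i) (u j) = (len i)^-1 * (len j)^-1 * ip (s i) (s j).
  by rewrite /u ipZl ipZr mulrA.
have [|||||||||sg [tu H]] := @caterpillar_orders R V ip 'I_n e u ht.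
- by move=> i j; rewrite /e eq_sym (ipC ip).
- by move=> a b; rewrite -big_split; apply: eq_bigr => i _; rewrite cfD.
- by move=> k a; rewrite mulr_sumr; apply: eq_bigr => i _; rewrite cfZ.
- move=> i; rewrite /ht (bigD1 i) //= big1 => [|j ji].
    by rewrite cfZ (cf_simple hD) eqxx mulr1 addr0.
  by rewrite cfZ (cf_simple hD) (negbTE ji) mulr0.
- by move=> i; rewrite uu -lenE -invfM mulVf // mulf_neq0 // lt0r_neq0.
- by move=> i j ij; rewrite uu pmulr_rle0 ?mulr_gt0 //; apply: (simple_ip hPhi hD).
(* Twice the product is at most minus the larger squared length, hence at most minus the product of
   the lengths. *)
- move=> i j /andP[ij eij]; rewrite uu -invfM mulrC ler_pdivrMr ?mulr_gt0 //.
  have := simple_ip_le hPhi hD ij eij.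
  have : 2 * ip (s i) (s j) <= - ip (s j) (s j).
    have ji : j != i by rewrite eq_sym.
    have eji : ip (s j) (s i) != 0 by rewrite (ipC ip).
    by rewrite (ipC ip (s i)); apply: (simple_ip_le hPhi hD ji eji).
  rewrite -!lenE; have := len0 i; have := len0 j; move: (len i) (len j) => a b.
  by move=> b0 a0 h1 h2; have [ab|ab] := leP a b; nra.
- move=> S i j Si Sj; have [i' [j' [Si' Sj' nz]]] := simple_connected hPhi hD hirr Si Sj.
  exists i', j'; split=> //; rewrite /e nz andbT.
  by apply: contraNneq Sj' => <-.
- by rewrite card_ord.
exists sg, tu; case: H => h1 h2 h3 h4; split=> // i j [->|nz]; apply: h4; first by left.
by have [->|ij] := eqVneq i j; [left|right; rewrite /e ij].
Qed.

End SimpleOrders.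

(** * The order type of a reflection order *)

Section AffineRootFacts.
Variables (R : realType) (V : vectType R) (ip : {dot V for idfun}) (Phi Pos : seq V).
Hypothesis hPhi : root_system ip Phi.
Hypothesis hPos : positive_system Phi Pos.

Lemma pos_root a : a \in Pos -> a \in Phi.
Proof. by have [D _ h] := hPos; move=> /h[]. Qed.

Lemma pos_or_neg a : a \in Phi -> a \in Pos \/ - a \in Pos.
Proof.
have [D [_ _ hD] h] := hPos; move=> Pa; have [c|c] := hD a Pa; [left|right]; apply/h.
  by [].
by split=> //; apply: (root_opp hPhi).
Qed.

Lemma pos_not_neg a : a \in Pos -> - a \notin Pos.
Proof.
have [D sD h] := hPos; move=> /h[Pa /(nonneg_combP sD) a0].
apply/negP => /h[_ /(nonneg_combP sD) b0]; have [i] := root_cf_neq0 hPhi sD Pa.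
by move/eqP; apply; apply/le_anti; rewrite a0 andbT -oppr_ge0 -cfN b0.
Qed.

Lemma pos_add a b : a \in Pos -> b \in Pos -> a + b \in Phi -> a + b \in Pos.
Proof.
have [D sD h] := hPos; move=> /h[Pa /(nonneg_combP sD) a0] /h[Pb /(nonneg_combP sD) b0] Pab.
by apply/h; split=> //; apply/(nonneg_combP sD) => i; rewrite cfD addr_ge0.
Qed.

(* The smallest level at which [a + m delta] is positive. *)
Definition first_level (a : V) : nat := ((a \notin Pos) : bool).

Lemma first_level_le1 a : (first_level a <= 1)%N. Proof. exact: leq_b1. Qed.

Lemma first_level_opp a : a \in Phi -> (first_level a + first_level (- a)%R = 1)%N.
Proof.
rewrite /first_level => /pos_or_neg[h|h]; have := pos_not_neg h; rewrite h ?opprK => -> //.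
Qed.

Lemma first_level_add a b : a + b \in Phi ->
  (first_level (a + b)%R <= first_level a + first_level b)%N.
Proof.
move=> Pab; rewrite /first_level.
have [Pa|_] := boolP (a \in Pos); last exact: leq_trans (leq_b1 _) (leq_addr _ _).
have [Pb|_] := boolP (b \in Pos); last exact: leq_trans (leq_b1 _) (leq_addl _ _).
by rewrite pos_add.
Qed.

Lemma affine_posP (x : V * R^o) : affine_pos_roots Pos x <->
  exists a m, [/\ a \in Phi, (first_level a <= m)%N & x = affine_root a m].
Proof.
rewrite /first_level; split.
  case=> [[a [m [Pa ->]]]|[a [m [Pa m0 ->]]]].
    by exists a, m; rewrite Pa; split=> //; apply: pos_root.
  exists a, m; split=> //; last exact: leq_trans (leq_b1 _) m0.
  by rewrite -(root_oppE hPhi); apply: pos_root.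
move=> [a [m [Pa + ->]]]; have [h _|h m0] := boolP (a \in Pos); [left|right].
  by exists a, m.
by exists a, m; split=> //; have [ha|//] := pos_or_neg Pa; rewrite ha in h.
Qed.

Lemma affine_pos a m : a \in Phi -> (first_level a <= m)%N ->
  affine_pos_roots Pos (affine_root (R := R) a m).
Proof. by move=> Pa am; apply/affine_posP; exists a, m. Qed.

Lemma affine_root_inj (a b : V) i j : affine_root (R := R) a i = affine_root b j -> a = b /\ i = j.
Proof. by case=> -> /eqP; rewrite eqr_nat => /eqP ->. Qed.

Lemma root_neq_opp a : a \in Phi -> a != - a.
Proof.
move=> Pa; apply/eqP => e; have /eqP := root_neq0 hPhi Pa; apply.
have : (2 : R) *: a = 0 by rewrite scaler_nat mulr2n {2}e subrr.
by move/eqP; rewrite scaler_eq0 pnatr_eq0 => /eqP.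
Qed.

End AffineRootFacts.

Section ReflectionOrder.
Variables (R : realType) (V : vectType R) (ip : {dot V for idfun}) (Phi Pos : seq V).
Hypothesis hPhi : root_system ip Phi.
Hypothesis hPos : positive_system Phi Pos.
Variable prec : V * R^o -> V * R^o -> Prop.
Hypothesis hR : reflection_order Pos prec.

Notation aff := (@affine_root R V).
Notation lev := (first_level Pos).
Notation A := (affine_pos_roots Pos).

Lemma prec_trans x y z : A x -> A y -> A z -> prec x y -> prec y z -> prec x z.
Proof. by have [[_ tr _] _] := hR; apply: tr. Qed.

Lemma prec_asym x y : A x -> A y -> prec x y -> ~ prec y x.
Proof. by have [ho _] := hR; apply: strict_total_asym ho. Qed.

Lemma prec_total a b i j : a \in Phi -> b \in Phi -> (lev a <= i)%N -> (lev b <= j)%N ->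
  a != b -> prec (aff a i) (aff b j) \/ prec (aff b j) (aff a i).
Proof.
move=> Pa Pb ai bj /eqP ab; have [[_ _ tot] _] := hR.
case: (tot _ _ (affine_pos hPhi hPos Pa ai) (affine_pos hPhi hPos Pb bj)); [by left| |by right].
by move=> /affine_root_inj[].
Qed.

Lemma between a b c i j m (k1 k2 : R) : a \in Phi -> b \in Phi -> c \in Phi ->
  (lev a <= i)%N -> (lev b <= j)%N -> (lev c <= m)%N -> 0 < k1 -> 0 < k2 ->
  c = k1 *: a + k2 *: b -> m%:R = k1 * i%:R + k2 * j%:R ->
  prec (aff a i) (aff b j) ->
  prec (aff a i) (aff c m) /\ prec (aff c m) (aff b j).
Proof.
move=> Pa Pb Pc ai bj cm k10 k20 cE mE h; have [_ hb] := hR.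
have E : aff c m = k1 *: aff a i + k2 *: aff b j.
  by rewrite /affine_root cE mE.
rewrite E; apply: hb => //; rewrite -?E; exact: (affine_pos hPhi hPos).
Qed.

Lemma between_add a b i j : a \in Phi -> b \in Phi -> a + b \in Phi ->
  (lev a <= i)%N -> (lev b <= j)%N -> prec (aff a i) (aff b j) ->
  prec (aff a i) (aff (a + b) (i + j)) /\ prec (aff (a + b) (i + j)) (aff b j).
Proof.
move=> Pa Pb Pab ai bj; apply: (@between _ _ _ _ _ _ 1 1) => //.
- exact: leq_trans (first_level_add hPos Pab) (leq_add ai bj).
- by rewrite !scale1r.
- by rewrite !mul1r natrD.
Qed.

(** The sum of [aff a i] and [aff (- a) j] is a positive multiple of delta, so adding [k] times it
    to [aff a i] reaches every higher level of [a]. *)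
Lemma between_opp a i j m : a \in Phi -> (lev a <= i)%N -> (lev (- a)%R <= j)%N ->
  prec (aff a i) (aff (- a) j) -> (i < m)%N ->
  prec (aff a i) (aff a m) /\ prec (aff a m) (aff (- a) j).
Proof.
move=> Pa ai aj h im.
have ij : (0 < i + j)%N by have := first_level_opp hPhi hPos Pa; lia.
pose k : R := (m - i)%:R / (i + j)%:R.
have k0 : 0 < k by rewrite divr_gt0 ?ltr0n // subn_gt0.
have kE : k * (i + j)%:R = m%:R - i%:R.
  by rewrite /k divfK ?natrB ?(ltnW im) // pnatr_eq0 -lt0n.
apply: (@between a (- a) a i j m (1 + k) k) => //.
- exact: (root_opp hPhi).
- by rewrite (leq_trans ai) // ltnW.
- by rewrite addr_gt0.
- by rewrite scalerN scalerDl scale1r addrK.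
- by move: kE; rewrite natrD; lra.
Qed.

Lemma between_opp' a i j m : a \in Phi -> (lev a <= i)%N -> (lev (- a)%R <= j)%N ->
  prec (aff a i) (aff (- a) j) -> (j < m)%N ->
  prec (aff a i) (aff (- a) m) /\ prec (aff (- a) m) (aff (- a) j).
Proof.
move=> Pa ai aj h jm.
have ij : (0 < i + j)%N by have := first_level_opp hPhi hPos Pa; lia.
pose k : R := (m - j)%:R / (i + j)%:R.
have k0 : 0 < k by rewrite divr_gt0 ?ltr0n // subn_gt0.
have kE : k * (i + j)%:R = m%:R - j%:R.
  by rewrite /k divfK ?natrB ?(ltnW jm) // pnatr_eq0 -lt0n.
apply: (@between a (- a) (- a) i j m k (1 + k)) => //.
- exact: (root_opp hPhi).
- exact: (root_opp hPhi).
- by rewrite (leq_trans aj) // ltnW.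
- by rewrite addr_gt0.
- by rewrite scalerN scalerDl scale1r opprD addrCA subrr addr0.
- by move: kE; rewrite natrD; lra.
Qed.

(* Comparing at level 1 decides the monotonicity of the whole chain of [a]. *)
Definition increasing a := a \in Phi /\ prec (aff a 1) (aff (- a) 1).

Lemma increasing_root a : increasing a -> a \in Phi. Proof. by case. Qed.

(** If the comparison were reversed at some pair of levels, betweenness would carry both comparisons
    to a common high level [M], where they contradict each other. *)
Lemma increasing_opp a i j : increasing a -> (lev a <= i)%N -> (lev (- a)%R <= j)%N ->
  prec (aff a i) (aff (- a) j).
Proof.
move=> [Pa h] ai aj; have Pna := root_opp hPhi Pa.
have [//|h'] := prec_total Pa Pna ai aj (root_neq_opp hPhi Pa).
have l1 := first_level_le1 Pos.
pose M := (maxn i j).+2.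
have lM x : (lev x <= M)%N by apply: leq_trans (l1 x) _.
have [_ h1] := @between_opp a 1 1 M Pa (l1 _) (l1 _) h isT.
have [h2 _] := @between_opp' a M 1 M Pa (lM _) (l1 _) h1 isT.
have jM : (j < M)%N by rewrite /M; lia.
have iM : (i < M)%N by rewrite /M; lia.
have [_ h3] : prec (aff (- a) j) (aff (- a) M) /\ prec (aff (- a) M) (aff (- - a) i).
  by apply: between_opp; rewrite ?opprK.
have [h4 _] : prec (aff (- a) M) (aff (- - a) M) /\ prec (aff (- - a) M) (aff (- - a) i).
  by rewrite opprK in h3; apply: between_opp'; rewrite ?opprK.
rewrite opprK in h4.
by case: (prec_asym _ _ h2 h4); apply: (affine_pos hPhi hPos).
Qed.

Lemma increasing_chain a i m : increasing a -> (lev a <= i)%N -> (i < m)%N ->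
  prec (aff a i) (aff a m).
Proof.
move=> ha ai im; have l1 := first_level_le1 Pos.
have [] := @between_opp a i 1 m (increasing_root ha) ai (l1 _) _ im => //.
exact: increasing_opp.
Qed.

Lemma increasing_opp_chain a i m : increasing a -> (lev (- a)%R <= i)%N -> (i < m)%N ->
  prec (aff (- a) m) (aff (- a) i).
Proof.
move=> ha ai im; have l1 := first_level_le1 Pos.
have [] := @between_opp' a 1 i m (increasing_root ha) (l1 _) ai _ im => //.
exact: increasing_opp.
Qed.

Lemma increasing_or a : a \in Phi -> increasing a \/ increasing (- a).
Proof.
move=> Pa; have l1 := first_level_le1 Pos; have Pna := root_opp hPhi Pa.
have [h|h] := prec_total Pa Pna (l1 _) (l1 _) (root_neq_opp hPhi Pa); [left|right] => //.
by split; rewrite ?opprK.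
Qed.

Lemma increasing_not a : increasing a -> ~ increasing (- a).
Proof.
move=> [Pa h] [Pna]; rewrite opprK; have l1 := first_level_le1 Pos.
by apply: prec_asym h; apply: (affine_pos hPhi hPos).
Qed.

(** By reducedness: [b = c] would give [a = -2 b]. *)
Lemma root_sum0_neq a b c : a \in Phi -> b \in Phi -> a + b + c = 0 -> b != c.
Proof.
move=> Pa Pb abc; apply/eqP => bc; have : (-2) *: b \in Phi.
  have -> // : (-2) *: b = a.
  by apply/eqP; rewrite scaleNr scaler_nat eq_sym -addr_eq0 mulr2n addrA {2}bc abc.
by move=> /(root_scale hPhi Pb)[]; lra.
Qed.

(** At level 2, [- c = a + b] lies between [a] and [b] of level 1, hence before [aff c 1]; but [c]
    is increasing, so its chain precedes that of [- c]. *)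
Lemma increasing_no_max a b c : increasing a -> increasing b -> increasing c ->
  a + b + c = 0 -> prec (aff a 1) (aff c 1) -> prec (aff b 1) (aff c 1) -> False.
Proof.
move=> ha hb hc abc ac bc; have l1 := first_level_le1 Pos.
have cE : - c = a + b by apply/eqP; rewrite eq_sym -addr_eq0 abc.
have [Pa Pb Pc] := And3 (increasing_root ha) (increasing_root hb) (increasing_root hc).
have Pab : a + b \in Phi by rewrite -cE; apply: (root_opp hPhi).
have h : prec (aff c 1) (aff (a + b) 2).
  by rewrite -cE; apply: increasing_opp => //; apply: leq_trans (l1 _) _.
have A1 d : d \in Phi -> A (aff d 1) by move=> Pd; apply: (affine_pos hPhi hPos).
have A2 : A (aff (a + b) 2).
  by apply: (affine_pos hPhi hPos) => //; apply: leq_trans (l1 _) _.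
have ab : a != b by apply: (@root_sum0_neq c) => //; rewrite -addrA addrC.
have [h'|h'] := prec_total Pa Pb (l1 _) (l1 _) ab.
  have [_ h2] := between_add Pa Pb Pab (l1 _) (l1 _) h'.
  exact: (prec_asym (A1 _ Pc) (A1 _ Pb) (prec_trans (A1 _ Pc) A2 (A1 _ Pb) h h2) bc).
have Pba : b + a \in Phi by rewrite addrC.
have [_ h2] := between_add Pb Pa Pba (l1 _) (l1 _) h'.
rewrite addrC in h2.
exact: (prec_asym (A1 _ Pc) (A1 _ Pa) (prec_trans (A1 _ Pc) A2 (A1 _ Pa) h h2) ac).
Qed.

Lemma increasing_sum0 a b c : increasing a -> increasing b -> increasing c ->
  a + b + c = 0 -> False.
Proof.
move=> ha hb hc abc; have l1 := first_level_le1 Pos.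
have [Pa Pb Pc] := And3 (increasing_root ha) (increasing_root hb) (increasing_root hc).
have bca : b + c + a = 0 by rewrite addrC addrA.
have cab : c + a + b = 0 by rewrite addrC addrA.
have bc := root_sum0_neq Pa Pb abc.
have ca := root_sum0_neq Pb Pc bca.
have ab := root_sum0_neq Pc Pa cab.
have A1 d : d \in Phi -> A (aff d 1) by move=> Pd; apply: (affine_pos hPhi hPos).
have tr x y z : x \in Phi -> y \in Phi -> z \in Phi ->
    prec (aff x 1) (aff y 1) -> prec (aff y 1) (aff z 1) -> prec (aff x 1) (aff z 1).
  by move=> Px Py Pz; apply: prec_trans; apply: A1.
have [h1|h1] := prec_total Pa Pb (l1 _) (l1 _) ab.
  have [h2|h2] := prec_total Pb Pc (l1 _) (l1 _) bc.
    exact: (increasing_no_max ha hb hc abc (tr _ _ _ Pa Pb Pc h1 h2) h2).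
  exact: (increasing_no_max hc ha hb cab h2 h1).
have [h3|h3] := prec_total Pc Pa (l1 _) (l1 _) ca.
  exact: (increasing_no_max hb hc ha bca h1 h3).
exact: (increasing_no_max ha hb hc abc h3 (tr _ _ _ Pb Pa Pc h1 h3)).
Qed.

Lemma increasing_add a b : increasing a -> increasing b -> a + b \in Phi ->
  increasing (a + b).
Proof.
move=> ha hb Pab; have [//|h] := increasing_or Pab.
by case: (increasing_sum0 ha hb h); rewrite subrr.
Qed.

(** For increasing chains this says that the limit for [a] is at most the limit for [b]; for the
    reversed order it compares limits of decreasing chains. *)
Definition dominated a b := forall i, (lev a <= i)%N ->
  exists2 j, (lev b <= j)%N & prec (aff a i) (aff b j).

Lemma dominated_trans a b c : a \in Phi -> b \in Phi -> c \in Phi ->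
  dominated a b -> dominated b c -> dominated a c.
Proof.
move=> Pa Pb Pc ab bc i ai; have [j bj h] := ab i ai; have [k ck h'] := bc j bj.
by exists k => //; apply: prec_trans h h'; apply: (affine_pos hPhi hPos).
Qed.

Lemma dominated_refl a : increasing a -> dominated a a.
Proof. by move=> ha i ai; exists i.+1; [lia|apply: increasing_chain]. Qed.

Lemma dominated_total a b : increasing a -> increasing b ->
  dominated a b \/ dominated b a.
Proof.
move=> ha hb; have [Pa Pb] := conj (increasing_root ha) (increasing_root hb).
have [->|ab] := eqVneq a b; first by left; apply: dominated_refl.
case: (pselect (dominated a b)) => [|/existsNP[i /not_implyP[ai /forall2NP h]]]; first by left.
right=> j bj; exists i => //.
have [h'|//] := prec_total Pa Pb ai bj ab.
by case: (h j).
Qed.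

(** [aff (a + b) (i + j)] lies after [aff a i] as soon as [aff b j] does. Conversely [aff a (q + 1)]
    is the sum of [aff (a + b) q] and [aff (- b) 1]. Were the latter the earlier of the two, it
    would precede [aff a (q + 1)], which lies before some [aff b j] and so before [aff (- b) 1]. *)
Lemma dominated_add a b : increasing a -> increasing b -> a + b \in Phi ->
  dominated a b -> dominated a (a + b) /\ dominated (a + b) a.
Proof.
move=> ha hb Pab ab; have [Pa Pb] := conj (increasing_root ha) (increasing_root hb).
have l1 := first_level_le1 Pos; have Pnb := root_opp hPhi Pb.
split.
  move=> i ai; have [j bj h] := ab i ai; exists (i + j)%N.
    exact: leq_trans (first_level_add hPos Pab) (leq_add ai bj).
  by have [] := between_add Pa Pb Pab ai bj h.
move=> q abq.
have aE : a = a + b - b by rewrite addrK.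
have aq : (lev a <= q + 1)%N by apply: leq_trans (l1 _) _; rewrite addn1.
have Paux : a + b - b \in Phi by rewrite -aE.
exists (q + 1)%N => //.
have neq : a + b != - b.
  rewrite eq_sym; apply: (@root_sum0_neq (- a)); rewrite ?(root_oppE hPhi) //.
  by rewrite -opprD addNr.
have [h|h] := prec_total Pab Pnb abq (l1 (- b)) neq.
  by have [] := between_add Pab Pnb Paux abq (l1 _) h; rewrite -aE.
have Paux' : - b + (a + b) \in Phi by rewrite addrC.
have [h1 _] := between_add Pnb Pab Paux' (l1 _) abq h.
rewrite (addrC (- b)) -aE addnC in h1.
have [j bj h2] := ab _ aq.
have h3 := increasing_opp hb bj (l1 _).
have Aa : A (aff a (q + 1)) by apply: (affine_pos hPhi hPos).
have Ab : A (aff b j) by apply: (affine_pos hPhi hPos).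
have An : A (aff (- b) 1) by apply: (affine_pos hPhi hPos).
by case: (prec_asym An Aa h1 (prec_trans Aa Ab An h2 h3)).
Qed.

End ReflectionOrder.

Lemma reflection_order_flip (R : realType) (V : vectType R) (Pos : seq V)
    (prec : V * R^o -> V * R^o -> Prop) :
  reflection_order Pos prec -> reflection_order Pos (fun x y => prec y x).
Proof.
move=> [ho hb]; split; first exact: strict_total_flip.
move=> x y k1 k2 Ax Ay yx k10 k20 Az; rewrite addrC in Az *.
by have [] := hb y x k2 k1 Ay Ax yx k20 k10 Az.
Qed.

(** * The word of a reflection order *)

Section Forward.
Variables (R : realType) (V : vectType R) (ip : {dot V for idfun}) (Phi Pos : seq V).
Hypothesis hPhi : root_system ip Phi.
Hypothesis hirr : irreducible_roots ip Phi.
Hypothesis hPos : positive_system Phi Pos.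
Variable prec : V * R^o -> V * R^o -> Prop.
Hypothesis hR : reflection_order Pos prec.

Notation aff := (@affine_root R V).
Notation lev := (first_level Pos).
Notation A := (affine_pos_roots Pos).
Notation inc := (increasing Phi prec).
Notation decP := (fun x y => prec y x).
Notation dom := (dominated Pos prec).
Notation domD := (dominated Pos decP).

Let hRD := reflection_order_flip hR.
Let incX := increasing_or hPhi hPos hR.
Let incN := increasing_not hPhi hPos hR.
Let incD := increasing_add hPhi hPos hR.
Let incR := @increasing_root R V Phi prec.

Lemma increasing_flip a : increasing Phi decP a <-> inc (- a).
Proof.
rewrite /increasing opprK; split=> [[Pa h]|[Pa h]]; split=> //.
  exact: (root_opp hPhi).
by rewrite -(root_oppE hPhi).
Qed.

Lemma cofinal_base a : inc a ->
  exists b, [/\ indecomposable inc b, dom a b & dom b a].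
Proof.
move: a; apply: (half_ind hPhi incR incN incD).
  by move=> a ia; exists a; split=> //; apply: (dominated_refl hPhi hPos hR); case: ia.
move=> a b ha hb hab [a' [ia aa' a'a]] [b' [ib bb' b'b]].
have [Pa Pb Pab] := And3 (incR ha) (incR hb) (incR hab).
have [Pa' Pb'] : a' \in Phi /\ b' \in Phi by split; apply: incR; [case: ia|case: ib].
have tr := dominated_trans hPhi hPos hR.
have [ab|ba] := dominated_total hPhi hPos hR ha hb.
  have [h1 h2] := dominated_add hPhi hPos hR ha hb Pab ab.
  by exists a'; split=> //; [apply: (tr _ a)|apply: (tr _ a)].
have Pba : b + a \in Phi by rewrite addrC.
have [h1 h2] := dominated_add hPhi hPos hR hb ha Pba ba.
by rewrite addrC; exists b'; split=> //; [apply: (tr _ b)|apply: (tr _ b)].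
Qed.

Lemma coinitial_base a : inc a ->
  exists b, [/\ indecomposable inc b, domD (- a) (- b) & domD (- b) (- a)].
Proof.
have opp x : inc x -> increasing Phi decP (- x).
  by move=> hx; apply/increasing_flip; rewrite opprK.
move: a; apply: (half_ind hPhi incR incN incD).
  move=> a ia; exists a; split=> //; apply: (dominated_refl hPhi hPos hRD);
    by apply: opp; case: ia.
move=> a b ha hb hab [a' [ia aa' a'a]] [b' [ib bb' b'b]].
have [Pa Pb Pab] := And3 (incR ha) (incR hb) (incR hab).
have [Pa' Pb'] : a' \in Phi /\ b' \in Phi by split; apply: incR; [case: ia|case: ib].
have Pm x : x \in Phi -> - x \in Phi by apply: (root_opp hPhi).
have tr := dominated_trans hPhi hPos hRD.
have [ab|ba] := dominated_total hPhi hPos hRD (opp _ ha) (opp _ hb).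
  have [|h1 h2] := dominated_add hPhi hPos hRD (opp _ ha) (opp _ hb) _ ab.
    by rewrite -opprD Pm.
  rewrite -opprD in h1 h2.
  by exists a'; split=> //; [apply: (tr _ (- a))|apply: (tr _ (- a))]; rewrite ?Pm.
have [|h1 h2] := dominated_add hPhi hPos hRD (opp _ hb) (opp _ ha) _ ba.
  by rewrite -opprD Pm // addrC.
rewrite -opprD in h1 h2; rewrite addrC in Pab *.
by exists b'; split=> //; [apply: (tr _ (- b))|apply: (tr _ (- b))]; rewrite ?Pm.
Qed.

Section Pieces.
Variables (w : seq bool) (ns : nat -> nat) (rho : V * R^o -> nat).
Hypothesis rho_mono : forall x y, A x -> A y -> prec x y -> (rho x <= rho y)%N.
Hypothesis rho_type : forall j, (j < size w)%N ->
  has_order_type [set x | A x /\ rho x = j]%classic prec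
    (letter_type (nth false w j) (ns j)).
(** The piece containing almost all of a chain: a birth for an increasing root, a death for its
    opposite. *)
Variable pc : V -> nat.
Hypothesis pc_lt : forall a, a \in Phi -> (pc a < size w)%N.
Hypothesis pc_letter : forall a, a \in Phi -> nth false w (pc a) = true <-> ~ inc a.
Hypothesis pc_tail : forall a, a \in Phi -> exists m0, forall m, (m0 <= m)%N -> rho (aff a m) = pc a.
Hypothesis pc_surj : forall j, (j < size w)%N -> exists2 a, a \in Phi & pc a = j.

Lemma pc_late a m0 : a \in Phi -> exists m, [/\ (m0 <= m)%N, (lev a <= m)%N & rho (aff a m) = pc a].
Proof.
move=> Pa; have [m1 h] := pc_tail Pa; exists (m0 + m1 + 1)%N; split; first by lia.
  by apply: leq_trans (first_level_le1 _ _) _; rewrite addn1.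
by apply: h; lia.
Qed.

Lemma letter_inc a : inc a -> nth false w (pc a) = false.
Proof. by move=> ha; apply/negP => /(pc_letter (incR ha)). Qed.

Lemma letter_dec a : inc a -> nth false w (pc (- a)) = true.
Proof.
move=> ha; apply/(pc_letter (root_opp hPhi (incR ha))) => h.
exact: incN ha h.
Qed.

Lemma rho_aff a m b k : a \in Phi -> b \in Phi -> (lev a <= m)%N -> (lev b <= k)%N ->
  prec (aff a m) (aff b k) -> (rho (aff a m) <= rho (aff b k))%N.
Proof. by move=> Pa Pb am bk; apply: rho_mono; apply: (affine_pos hPhi hPos). Qed.

Lemma rho_le_pc a m : inc a -> (lev a <= m)%N -> (rho (aff a m) <= pc a)%N.
Proof.
move=> ha am; have Pa := incR ha; have [k [mk ak <-]] := pc_late m.+1 Pa.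
by apply: rho_aff => //; apply: (increasing_chain hPhi hPos hR).
Qed.

Lemma pc_le_rho a m : inc a -> (lev (- a)%R <= m)%N -> (pc (- a) <= rho (aff (- a) m))%N.
Proof.
move=> ha am; have Pa := root_opp hPhi (incR ha); have [k [mk ak <-]] := pc_late m.+1 Pa.
by apply: rho_aff => //; apply: (increasing_opp_chain hPhi hPos hR).
Qed.

Lemma pc_opp a : inc a -> (pc a < pc (- a))%N.
Proof.
move=> ha; have Pa := incR ha; have Pna := root_opp hPhi Pa.
rewrite ltn_neqAle; apply/andP; split.
  by apply/eqP => e; have := letter_dec ha; rewrite -e letter_inc.
have [k [_ ak <-]] := pc_late 0 Pa; have [k' [_ ak' <-]] := pc_late 0 Pna.
by apply: rho_aff => //; apply: (increasing_opp hPhi hPos hR).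
Qed.

Lemma pc_dominated a b : inc a -> inc b -> dom a b -> (pc a <= pc b)%N.
Proof.
move=> ha hb ab; have [k [_ ak <-]] := pc_late 0 (incR ha).
have [j bj h] := ab k ak; apply: leq_trans (rho_le_pc hb bj).
by apply: rho_aff => //; apply: incR.
Qed.

Lemma pc_dominatedD a b : inc a -> inc b -> domD (- a) (- b) -> (pc (- b) <= pc (- a))%N.
Proof.
move=> ha hb ab; have [k [_ ak <-]] := pc_late 0 (root_opp hPhi (incR ha)).
have [j bj h] := ab k ak; apply: leq_trans (pc_le_rho hb bj) _.
by apply: rho_aff => //; apply: (root_opp hPhi); apply: incR.
Qed.

Lemma pc_lt_dominated a b : inc a -> inc b -> (pc a < pc b)%N -> dom a b.
Proof.
move=> ha hb ab; have [//|ba] := dominated_total hPhi hPos hR ha hb.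
by have := pc_dominated hb ha ba; rewrite leqNgt ab.
Qed.

(** Otherwise [b] is born before [a], so [a + b] has the limit of [b]. In high levels
    [a = (a + b) + (- b)] would then lie in a piece later than those of both summands. *)
Lemma pc_adjacent a b : inc a -> inc b -> a + b \in Phi -> (pc a <= pc (- b))%N.
Proof.
move=> ha hb Pab; rewrite leqNgt; apply/negP => lt.
have [Pa Pb] := conj (incR ha) (incR hb); have Pnb := root_opp hPhi Pb.
have hab := incD ha hb Pab.
have hba : (pc b < pc a)%N := ltn_trans (pc_opp hb) lt.
have Pba : b + a \in Phi by rewrite addrC.
have [_ h] := dominated_add hPhi hPos hR hb ha Pba (pc_lt_dominated hb ha hba).
have pab : (pc (a + b) < pc a)%N.
  by apply: leq_ltn_trans hba; rewrite addrC; apply: pc_dominated => //; rewrite addrC.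
have [m0 hm0] := pc_tail Pa.
have [q [q0 abq rq]] := pc_late m0 Pab.
have [k [_ bk rk]] := pc_late 0 Pnb.
have aE : a = a + b - b by rewrite addrK.
have Paux : a + b - b \in Phi by rewrite -aE.
have aqk : (lev a <= q + k)%N.
  by rewrite {1}aE; apply: leq_trans (first_level_add hPos Paux) (leq_add abq bk).
have ra : rho (aff a (q + k)) = pc a by apply: hm0; lia.
have neq : a + b != - b.
  rewrite eq_sym; apply: (@root_sum0_neq _ _ _ _ hPhi (- a)); rewrite ?(root_oppE hPhi) //.
  by rewrite -opprD addNr.
have [h'|h'] := prec_total hPhi hPos hR Pab Pnb abq bk neq.
  have [_ h2] := between_add hPhi hPos hR Pab Pnb Paux abq bk h'.
  rewrite -aE in h2; have := rho_aff Pa Pnb aqk bk h2.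
  by rewrite ra rk leqNgt lt.
have Paux' : - b + (a + b) \in Phi by rewrite addrC.
have [_ h2] := between_add hPhi hPos hR Pnb Pab Paux' bk abq h'.
rewrite (addrC (- b)) -aE addnC in h2; have := rho_aff Pa Pab aqk abq h2.
by rewrite ra rq leqNgt pab.
Qed.

Notation B := (half_base Phi inc).
Notation s := (@simple_root R V B).
Let sB : simple_system Phi B := half_base_simple hPhi incR incX incN incD.

Lemma simple_inc i : inc (s i).
Proof. by case: (half_base_indec incR i). Qed.

Lemma base_of_letter j : (j < size w)%N -> exists i : 'I_(size B),
  pc (if nth false w j then - s i else s i) = j.
Proof.
move=> hj; have [a Pa aj] := pc_surj hj.
have idx b : indecomposable inc b -> exists i : 'I_(size B), s i = b.
  move=> /(mem_half_base incR) bB.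
  have lt : (index b B < size B)%N by rewrite index_mem.
  by exists (Ordinal lt); rewrite /s nth_index.
have [ha|hna] := incX Pa.
  have [b [ib ab ba]] := cofinal_base ha; have [i iE] := idx b ib; exists i.
  have wj : nth false w j = false by rewrite -aj letter_inc.
  rewrite wj iE -aj; have hb : inc b by case: ib.
  by apply/eqP; rewrite eqn_leq !pc_dominated.
have [b [ib ab ba]] := coinitial_base hna; have [i iE] := idx b ib; exists i.
have wj : nth false w j = true by rewrite -aj -[a]opprK letter_dec.
rewrite wj iE -aj -[in RHS](opprK a); have hb : inc b by case: ib.
by apply/eqP; rewrite eqn_leq !pc_dominatedD.
Qed.

Lemma head_letter : w != [::] -> head true w = false.
Proof.
case E: w => [//|b w'] _ /=; have [|a Pa a0] := @pc_surj 0%N; first by rewrite E.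
have [ha|hna] := incX Pa; first by have := letter_inc ha; rewrite a0 E.
by have := pc_opp hna; rewrite opprK a0.
Qed.

Lemma last_letter : w != [::] -> last false w = true.
Proof.
move=> w0; rewrite -nth_last; have s0 : (0 < size w)%N by case: (w) w0.
have [|a Pa a0] := @pc_surj (size w).-1; first by rewrite prednK.
have [ha|hna] := incX Pa; last first.
  by have := letter_dec hna; rewrite opprK a0.
by have := pc_opp ha; have := pc_lt (root_opp hPhi Pa); rewrite a0; lia.
Qed.

Lemma letters_cut i : (i <= size w)%N ->
  (count_mem true (take i w) + count_mem false (drop i w) <= size B)%N /\
  ((0 < count_mem true (take i w))%N -> (0 < count_mem false (drop i w))%N ->
   (count_mem true (take i w) + count_mem false (drop i w) < size B)%N).
Proof.
move=> iw.
have wE : w = [seq nth false w j | j <- iota 0 (size w)] by rewrite -/(mkseq _ _) mkseq_nth.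
pose s1 := [seq j <- iota 0 i | nth false w j].
pose s0 := [seq j <- iota i (size w - i) | ~~ nth false w j].
have c1 : count_mem true (take i w) = size s1.
  rewrite {1}wE -map_take take_iota (minn_idPl iw) count_map size_filter.
  by apply: eq_count => j /=; case: nth.
have c0 : count_mem false (drop i w) = size s0.
  rewrite {1}wE -map_drop drop_iota add0n count_map size_filter.
  by apply: eq_count => j /=; case: nth.
(* Past the end of the word any simple root serves as a default; one exists because there are
   roots. *)
have /choice[d dP] : forall j, exists i : 'I_(size B), (j < size w)%N ->
    pc (if nth false w j then - s i else s i) = j.
  move=> j; have [hj|hj] := ltnP j (size w).
    by have [k hk] := base_of_letter hj; exists k.
  have [a Pa] := hirr.1; have [b0] := root_cf_neq0 hPhi sB Pa.
  by exists b0 => h; move: hj; rewrite leqNgt h.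
have m1 j : j \in s1 -> [/\ (j < i)%N, (j < size w)%N & pc (- s (d j)) = j].
  rewrite mem_filter mem_iota add0n /= => /andP[wj ji].
  have jw := leq_trans ji iw; split=> //; by have := dP j jw; rewrite wj.
have m0 j : j \in s0 -> [/\ (i <= j)%N, (j < size w)%N & pc (s (d j)) = j].
  rewrite mem_filter mem_iota => /andP[wj /andP[ij jw]].
  rewrite subnKC // in jw; split=> //; by have := dP j jw; rewrite (negbTE wj).
have ud : uniq [seq d j | j <- s1 ++ s0].
  rewrite map_inj_in_uniq.
    rewrite cat_uniq !filter_uniq ?iota_uniq // andbT /=; apply/hasPn => j /m0[ij _ _].
    by apply/negP => /m1[]; rewrite ltnNge ij.
  move=> j j'; rewrite !mem_cat => /orP[/m1[h1 h2 h3]|/m0[h1 h2 h3]] /orP[/m1[h4 h5 h6]|/m0[h4 h5 h6]] e.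
  - by rewrite -h3 -h6 e.
  - by have := pc_opp (simple_inc (d j)); rewrite h3 e h6; lia.
  - by have := pc_opp (simple_inc (d j)); rewrite h3 e h6; lia.
  - by rewrite -h3 -h6 e.
have sz : (size s1 + size s0)%N = size [seq d j | j <- s1 ++ s0].
  by rewrite size_map size_cat.
rewrite c1 c0 sz -[X in (_ <= X)%N]card_ord -(card_uniqP ud); split; first exact: max_card.
rewrite -!has_predT => /hasP[j1 sj1 _] /hasP[j0 sj0 _].
rewrite -[X in (_ < X)%N]card_ord ltn_neqAle max_card andbT; apply/negP => /eqP full.
have all k : k \in [seq d j | j <- s1 ++ s0].
  by have /subset_cardP/(_ (subset_predT _)) -> := full.
(* With equality every simple root is dead or unborn, and [S] is the set of dead ones. An edge
   leaving [S] contradicts [pc_adjacent]. *)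
pose S := [set k | k \in [seq d j | j <- s1]].
have Sd1 : d j1 \in S by rewrite inE map_f.
have Sd0 : d j0 \notin S.
  rewrite inE; apply/mapP => -[j /m1[ji _ hj] e].
  by have [ij _ hj0] := m0 _ sj0; have := pc_opp (simple_inc (d j)); rewrite hj -e hj0; lia.
have [k [l [Sk Sl kl]]] := simple_connected hPhi sB hirr Sd1 Sd0.
have [j hj kE] : exists2 j, j \in s1 & k = d j by move: Sk; rewrite inE => /mapP.
have [j' hj' lE] : exists2 j, j \in s0 & l = d j.
  have := all l; rewrite map_cat mem_cat => /orP[h|/mapP //].
  by rewrite inE h in Sl.
have kl' : k != l by apply: contraNneq Sl => <-.
have neg : ip (s l) (s k) < 0.
  by rewrite (ipC ip) lt_neqAle kl (simple_ip hPhi sB).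
have Plk : s l + s k \in Phi.
  apply: (root_add hPhi) neg _; try by apply: incR; apply: simple_inc.
  by apply/eqP => e; apply: (incN (simple_inc l)); rewrite -e; apply: simple_inc.
have [ji _ kj] := m1 _ hj; have [ij _ lj] := m0 _ hj'; rewrite -kE in kj; rewrite -lE in lj.
have := pc_adjacent (simple_inc l) (simple_inc k) Plk; rewrite kj lj => h.
by have := leq_trans ij h; rewrite leqNgt ji.
Qed.

(** A first element of the piece exists when [n_i > 0]. On an increasing chain it forces a letter 0
    at or after [i]; on a decreasing chain, not being preceded in its piece, it forces a letter 1
    before [i]. *)
Lemma forward_admissible : admissible w ns.
Proof.
move=> i iw wi before after; apply/eqP; rewrite -leqn0 leqNgt; apply/negP => n0.
have := rho_type iw; rewrite wi => -[f [fA _ fs] fo].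
pose x := f (inl (Ordinal n0)).
have [Ax rx] : A x /\ rho x = i by apply: (fA (inl (Ordinal n0))).
have xmin y : A y -> rho y = i -> ~ prec y x.
  move=> Ay ry; have [t _ <-] := fs y (conj Ay ry); rewrite /x -fo.
  case: t => [a|b] /=; first by rewrite ltn0.
  by [].
have [a [m [Pa am xE]]] := (affine_posP hPhi hPos x).1 Ax.
have [ha|hna] := incX Pa.
  have := rho_le_pc ha am; rewrite -xE rx => h.
  by have := after (pc a); rewrite h pc_lt // letter_inc // => /(_ isT).
have [m' [mm' am' rm']] := pc_late m.+1 Pa.
have pr : prec (aff a m') (aff a m).
  rewrite -[a]opprK; apply: (increasing_opp_chain hPhi hPos hR) => //.
  by rewrite opprK.
have Am' : A (aff a m') by apply: (affine_pos hPhi hPos).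
apply: (xmin (aff a m')) => //; last by rewrite xE.
have h1 := rho_aff Pa Pa am' am pr; rewrite -xE rx rm' in h1.
rewrite rm'; apply/eqP; rewrite eqn_leq h1 /= leqNgt; apply/negP => /before.
by have := letter_dec hna; rewrite opprK => ->.
Qed.

End Pieces.

Lemma forward n : \dim {:V}%VS = n -> exists (w : seq bool) (ns : nat -> nat),
  [/\ trimmed_dyck n w, admissible w ns &
      has_order_type A prec (word_type w ns)].
Proof.
move=> hn; have l1 := first_level_le1 Pos; have [ho _] := hR.
pose I := 'I_(size Phi); pose g (i : I) : V := Phi`_i.
have Pg i : g i \in Phi by apply: mem_nth.
pose dec i := ~~ `[< inc (g i) >].
pose c i m := aff (g i) (m + lev (g i)).
have idx a : a \in Phi -> exists i, g i = a.
  move=> Pa; have lt : (index a Phi < size Phi)%N by rewrite index_mem.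
  by exists (Ordinal lt); rewrite /g nth_index.
have cA i m : A (c i m) by apply: (affine_pos hPhi hPos) => //; apply: leq_addl.
have cI i m k : ~~ dec i -> (m < k)%N -> prec (c i m) (c i k).
  rewrite negbK => /asboolP hi mk; apply: (increasing_chain hPhi hPos hR) => //.
    exact: leq_addl.
  by rewrite ltn_add2r.
have cD i m k : dec i -> (m < k)%N -> prec (c i k) (c i m).
  move=> /asboolP hi mk; have [//|hn'] := incX (Pg i).
  have := @increasing_opp_chain _ _ _ _ _ hPhi hPos _ hR _ (m + lev (g i)) (k + lev (g i)) hn'.
  by rewrite opprK; apply; [apply: leq_addl|rewrite ltn_add2r].
have [||w [ns [rho [[rl rm re] rt rj rS]]]] :=
  @decomposition _ prec A I dec c ho cA cI cD _ setT A [::] (leqnn _) (fun x h => h).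
- by move=> i _; exists 0%N.
- move=> x /(affine_posP hPhi hPos)[a [m [Pa am ->]]]; right.
  have [i iE] := idx a Pa; exists i, (m - lev a)%N; split=> //.
  by rewrite /c iE subnK.
have tail a : a \in Phi -> exists j, [/\ (j < size w)%N, nth false w j = true <-> ~ inc a &
    exists m0, forall m, (m0 <= m)%N -> rho (aff a m) = j].
  move=> Pa; have [i iE] := idx a Pa; have [|j [jw wj [m0 h]]] := rS i; first by rewrite inE.
  exists j; split=> //.
    by rewrite wj /dec iE; split=> [/asboolP//|h']; apply/asboolP.
  exists (m0 + lev a)%N => m hm; have [|_] := h (m - lev a)%N; first by lia.
  by rewrite /c iE subnK //; lia.
have /choice[pc pcP] : forall a, exists j, a \in Phi ->
    [/\ (j < size w)%N, nth false w j = true <-> ~ inc a &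
    exists m0, forall m, (m0 <= m)%N -> rho (aff a m) = j].
  move=> a; have [Pa|nPa] := boolP (a \in Phi); last by exists 0%N.
  by have [j hj] := tail a Pa; exists j.
have pc1 a : a \in Phi -> (pc a < size w)%N by move=> /pcP[].
have pc2 a : a \in Phi -> nth false w (pc a) = true <-> ~ inc a by move=> /pcP[].
have pc3 a : a \in Phi -> exists m0, forall m, (m0 <= m)%N -> rho (aff a m) = pc a.
  by move=> /pcP[].
have pc4 j : (j < size w)%N -> exists2 a, a \in Phi & pc a = j.
  move=> /rj[i [_ _ [m0 h]]]; exists (g i) => //.
  have [m1 h1] := pc3 _ (Pg i).
  have [|_ <-] := h (m0 + m1)%N; first by lia.
  by rewrite /c h1 //; lia.
have w0 : w != [::].
  by have [a Pa] := hirr.1; have := pc1 a Pa; case: (w).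
have lw := last_letter rm pc1 pc2 pc3 pc4 w0.
(* The final letter 1 excludes the leftovers permitted by [decomposed]. *)
have rlt x : A x -> (rho x < size w)%N.
  move=> Ax; rewrite ltn_neqAle rl // andbT; apply/eqP => e.
  by have := re x Ax e; rewrite lw.
exists w, ns; split.
- have sBn : size (half_base Phi inc) = n.
    have [hB _ _] := half_base_simple hPhi incR incX incN incD.
    by rewrite -hn (size_basis (X := in_tuple (half_base Phi inc)) hB).
  apply: trimmed_dyckI => //.
  + exact: (head_letter rm pc2 pc3 pc4 w0).
  + by move=> i iw; rewrite -sBn; have [] := letters_cut rm pc2 pc3 pc4 iw.
  + move=> i; have [iw|iw] := leqP i (size w).
      by rewrite -sBn; have [_] := letters_cut rm pc2 pc3 pc4 iw.
    by rewrite drop_oversize ?(ltnW iw).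
- exact: (forward_admissible rm rt pc1 pc2 pc3).
- exact: (word_type_fibers ho rlt rm rt).
Qed.

End Forward.

(** * Construction of reflection orders *)

Section Lex.
Variable R : realFieldType.
Implicit Types f g h : nat -> R.

Definition lexlt f g := exists i, (forall j, (j < i)%N -> f j = g j) /\ f i < g i.

Lemma lexlt_irr f : ~ lexlt f f.
Proof. by move=> [i []]; rewrite ltxx. Qed.

Lemma lexlt_trans f g h : lexlt f g -> lexlt g h -> lexlt f h.
Proof.
move=> [i [hi li]] [j [hj lj]]; case: (ltngtP i j) => ij.
- by exists i; split=> [k ki|]; [rewrite hi // hj // (ltn_trans ki)|rewrite -hj].
- by exists j; split=> [k kj|]; [rewrite hi ?hj // (ltn_trans kj)|rewrite hi].
- exists i; split=> [k ki|]; first by rewrite hi // hj // -ij.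
  by rewrite -ij in lj; apply: lt_trans lj.
Qed.

Lemma lexlt_total f g : (forall i, f i = g i) \/ lexlt f g \/ lexlt g f.
Proof.
case: (pselect (exists i, f i != g i)) => [ex|none]; last first.
  by left=> i; apply/eqP/negPn/negP => h; apply: none; exists i.
right; have [i ne imin] := ex_minnP ex.
have eqi j : (j < i)%N -> f j = g j.
  by move=> ji; apply/eqP/negPn/negP => /imin; rewrite leqNgt ji.
case: (ltgtP (f i) (g i)) ne => // h _; [left|right]; exists i; split=> // j /eqi //.
Qed.

Lemma lexlt_mix f g h (t : R) : 0 < t -> t < 1 ->
  (forall i, h i = t * f i + (1 - t) * g i) -> lexlt f g -> lexlt f h /\ lexlt h g.
Proof.
move=> t0 t1 hE [i [eqi lti]]; split; exists i; split.
- by move=> j /eqi fg; rewrite hE -fg; ring.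
- by rewrite hE; nra.
- by move=> j /eqi fg; rewrite hE -fg; ring.
- by rewrite hE; nra.
Qed.

Lemma lexlt_le0 f g : lexlt f g -> f 0%N <= g 0%N.
Proof. by move=> [[|i] [h lt]]; [apply: ltW|rewrite h]. Qed.

End Lex.

(** * Assigning letters to the births and deaths of simple roots *)

Section Letters.
Variables (R : realType) (V : vectType R) (ip : {dot V for idfun}) (Phi Delta : seq V).
Hypotheses (hPhi : root_system ip Phi) (hirr : irreducible_roots ip Phi).
Hypothesis hD : simple_system Phi Delta.
Notation s := (@simple_root R V Delta).
Notation I := 'I_(size Delta).

Definition touching (i j : I) := i = j \/ ip (s i) (s j) != 0.

(** The root of index [k] in [sg] is born at the zero of index [k] of the extended Dyck word, and
    dies likewise according to [tu]. Trimming never merges a 0 with a 1, so the strict order of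
    births and deaths survives in [w]. *)
Lemma simple_letters n w : \dim {:V}%VS = n -> trimmed_dyck n w ->
  exists b d : I -> nat,
  [/\ forall i, (b i < size w)%N /\ nth false w (b i) = false,
      forall i, (d i < size w)%N /\ nth false w (d i) = true,
      forall j, (j < size w)%N -> nth false w j = false -> exists i, b i = j,
      forall j, (j < size w)%N -> nth false w j = true -> exists i, d i = j &
      forall i j, touching i j -> (b i < d j)%N].
Proof.
move=> hn [u hu /trimming_map[h [h1 h2 h3]]]; have [c0 c1 _] := hu.
have sn : size Delta = n.
  by have [hB _ _] := hD; rewrite -hn (size_basis (X := in_tuple Delta) hB).
have n0 : (0 < size Delta)%N.
  by have [a Pa] := hirr.1; have [[i lt] _] := root_cf_neq0 hPhi hD Pa; apply: leq_trans lt.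
have [sg [tu [[us ut] ms mt ov]]] := simple_orders hPhi hirr hD n0.
have ssz (q : seq I) : uniq q -> (forall i, i \in q) -> size q = n.
  move=> uq mq; rewrite -(card_uniqP uq) -sn -[RHS]card_ord.
  by apply: eq_card => i; rewrite mq.
have pos (e : bool) (q : seq I) : count_mem e u = n -> uniq q -> (forall i, i \in q) ->
    exists p : I -> nat,
    [/\ forall i, (p i < size u)%N, forall i, nth false u (p i) = e,
        forall i, count_mem e (take (p i) u) = index i q &
        forall k, (k < size u)%N -> nth false u k = e -> exists i, p i = k].
  move=> ce uq mq.
  have /choice[p pP] : forall i : I, exists k, [/\ (k < size u)%N, nth false u k = e &
      count_mem e (take k u) = index i q].
    by move=> i; apply: count_mem_pos; rewrite ce -(ssz q) // index_mem.
  have p1 i : (p i < size u)%N by have [] := pP i.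
  have p2 i : nth false u (p i) = e by have [] := pP i.
  have p3 i : count_mem e (take (p i) u) = index i q by have [] := pP i.
  exists p; split=> // k ku ke.
  have lt : (count_mem e (take k u) < size q)%N.
    by have := count_take_lt ku ku ke; rewrite take_size ce ssz.
  have i0 : I by exact: (Ordinal n0).
  exists (nth i0 q (count_mem e (take k u))).
  by apply: (count_take_inj (e := e)) => //; rewrite p3 index_uniq.
have [p [p1 p2 p3 p4]] := pos false sg c0 us ms.
have [r [r1 r2 r3 r4]] := pos true tu c1 ut mt.
exists (h \o p), (h \o r); split.
- by move=> i /=; have [-> ->] := h1 _ (p1 i); rewrite p2.
- by move=> i /=; have [-> ->] := h1 _ (r1 i); rewrite r2.
- move=> j jw wj; have [k ku kj] := h3 j jw.
  have [_ e] := h1 k ku; rewrite kj wj in e.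
  by have [i ik] := p4 k ku (esym e); exists i; rewrite /= ik.
- move=> j jw wj; have [k ku kj] := h3 j jw.
  have [_ e] := h1 k ku; rewrite kj wj in e.
  by have [i ik] := r4 k ku (esym e); exists i; rewrite /= ik.
- move=> i j ij /=; have lt : (p i < r j)%N.
    by apply: (dyck_cross hu (p1 i) (r1 j) (p2 i) (r2 j)); rewrite p3 r3; apply: ov.
  have [_ e1] := h1 _ (p1 i); have [_ e2] := h1 _ (r1 j).
  rewrite ltn_neqAle h2 ?(ltnW lt) ?r1 // andbT; apply/eqP => e.
  by rewrite p2 e e2 r2 in e1.
Qed.

End Letters.

(** [k1 * u] is a sum of two nonnegative numbers, [t] and [- k2 * v]. Applied to coordinates, this
    makes the support of one root the union of the supports of two others. *)
Lemma comb_neq0 (R : realFieldType) (u v t k1 k2 : R) : 0 < k1 -> 0 < k2 ->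
  0 <= u -> v <= 0 -> 0 <= t -> t = k1 * u + k2 * v ->
  u != 0 <-> t != 0 \/ v != 0.
Proof.
move=> k10 k20 u0 v0 t0 tE; split.
  move=> u1; have [v1|] := eqVneq v 0; last by right.
  by left; rewrite tE v1 mulr0 addr0 mulf_neq0 // lt0r_neq0.
move=> h; apply/eqP => u1; rewrite u1 mulr0 add0r in tE.
have h0 : k2 * v = 0 by apply/le_anti; rewrite pmulr_rle0 // v0 -tE t0.
case: h; rewrite ?tE ?h0 ?eqxx // => /negP; apply.
by move/eqP: h0; rewrite mulf_eq0 (gt_eqF k20).
Qed.

(** * The order defined by first births and last deaths *)

Section Backward.
Variables (R : realType) (V : vectType R) (ip : {dot V for idfun}) (Phi Pos Delta : seq V).
Hypothesis hPhi : root_system ip Phi.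
Hypothesis hPos : positive_system Phi Pos.
Hypothesis hD : simple_system Phi Delta.
Hypothesis hDP : forall a, a \in Pos <-> a \in Phi /\ nonneg_comb Delta a.

Notation s := (@simple_root R V Delta).
Notation I := 'I_(size Delta).
Notation touch := (touching ip (Delta := Delta)).
Notation X := (V * R^o)%type.
Notation aff := (@affine_root R V).
Notation lev := (first_level Pos).
Notation A := (affine_pos_roots Pos).
Notation cf := (@cf R V Delta).

Variables (w : seq bool) (b d : I -> nat).
Hypothesis b_letter : forall i, (b i < size w)%N /\ nth false w (b i) = false.
Hypothesis d_letter : forall i, (d i < size w)%N /\ nth false w (d i) = true.
Hypothesis b_surj : forall j, (j < size w)%N -> nth false w j = false -> exists i, b i = j.
Hypothesis d_surj : forall j, (j < size w)%N -> nth false w j = true -> exists i, d i = j.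
Hypothesis b_lt_d : forall i j, touch i j -> (b i < d j)%N.

Lemma posE a : a \in Pos <-> a \in Phi /\ forall i, 0 <= cf i a.
Proof. by rewrite hDP; split=> -[Pa] /(nonneg_combP hD). Qed.

(** Without a touching pair the support of [r] would split into two nonempty orthogonal parts,
    against [support_connected]. *)
Lemma support_touch r f g : r \in Phi ->
  (forall i, cf i r != 0 <-> cf i f != 0 \/ cf i g != 0) ->
  (exists i, cf i f != 0) -> (exists i, cf i g != 0) ->
  exists i j, [/\ cf i f != 0, cf j g != 0 & touch i j].
Proof.
move=> Pr rE [i0 fi0] [j0 gj0]; apply: contrapT => none.
pose S := [set i | cf i f != 0].
have orth i j : cf i f != 0 -> cf j g != 0 -> i <> j /\ ip (s i) (s j) = 0.
  move=> fi gj; split=> [ij|]; first by apply: none; exists i, j; split=> //; left.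
  by apply/eqP/negPn/negP => h; apply: none; exists i, j; split=> //; right.
have [i j|h|h] := @support_connected R V ip Phi hPhi Delta hD S r Pr.
- rewrite !inE => fi; rewrite negbK => /eqP fj /rE[]; first by rewrite fj eqxx.
  by move=> gj; have [] := orth i j fi gj.
- have : cf i0 r != 0 by apply/rE; left.
  by rewrite h ?inE ?eqxx.
- have : cf j0 r != 0 by apply/rE; right.
  rewrite h ?eqxx // inE negbK; apply/eqP/eqP/negPn/negP => fj.
  by have [] := orth j0 j0 fj gj0.
Qed.

Definition ht v := \sum_i cf i v.
(** The weight of delta in [scale]: it exceeds the height of every root in absolute value, so
    negative roots at positive levels also get a positive scale. *)
Definition ht_bound := 1 + \sum_(a <- Phi) `|ht a|.

(** Division by this functional, positive on all positive affine roots, turns positive combinations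
    into convex ones, which a lexicographic order puts between their ends. *)
Definition scale (x : X) : R := ht_bound * x.2 + ht x.1.

Lemma ht_lt a : a \in Phi -> `|ht a| < ht_bound.
Proof.
move=> Pa; rewrite /ht_bound (big_rem a) //=.
have : 0 <= \sum_(y <- rem a Phi) `|ht y| by apply: sumr_ge0.
lra.
Qed.

Lemma ht_bound_ge1 : 1 <= ht_bound.
Proof. by rewrite /ht_bound lerDl sumr_ge0. Qed.

Lemma scale_gt0 x : A x -> 0 < scale x.
Proof.
move=> /(affine_posP hPhi hPos)[a [m [Pa am ->]]]; rewrite /scale /=.
have := ht_lt Pa; rewrite ltr_norml => /andP[h _]; have h1 := ht_bound_ge1.
have [m0|m0] := posnP m; last first.
  have : 1 <= m%:R :> R by rewrite ler1n.
  nra.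
rewrite m0 mulr0 add0r; have aP : a \in Pos.
  by move: am; rewrite m0 /first_level; case: (a \in Pos).
have [_ a0] := (posE a).1 aP; have [i ai] := root_cf_neq0 hPhi hD Pa.
rewrite /ht (bigD1 i) //= ltr_pwDl ?sumr_ge0 // lt_neqAle eq_sym ai a0 //.
Qed.

Lemma scaleD k1 k2 (x y : X) : scale (k1 *: x + k2 *: y) = k1 * scale x + k2 * scale y.
Proof.
rewrite /scale /ht /= (eq_bigr (fun i => k1 * cf i x.1 + k2 * cf i y.1)); last first.
  by move=> i _; rewrite cfD !cfZ.
rewrite big_split /= -!mulr_sumr.
have -> : (k1 *: x.2 + k2 *: y.2 : R) = k1 * x.2 + k2 * y.2 by [].
ring.
Qed.

(** A letter is either 0 or 1, so for a given [j] only one of the two alternatives occurs. *)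
Definition phi j v := \sum_(i | (b i == j) || (d i == j)) cf i v.

Lemma phiD j k1 k2 v v' : phi j (k1 *: v + k2 *: v') = k1 * phi j v + k2 * phi j v'.
Proof.
rewrite /phi (eq_bigr (fun i => k1 * cf i v + k2 * cf i v')); last first.
  by move=> i _; rewrite cfD !cfZ.
by rewrite big_split /= -!mulr_sumr.
Qed.

(* Coordinate 0 determines the order type of a piece, the others break ties. *)
Definition key j (x : X) (k : nat) : R :=
  match k with
  | 0 => - phi j x.1 / scale x
  | 1 => x.2 / scale x
  | k.+2 => (if insub k is Some i then cf i x.1 else 0) / scale x
  end.

Lemma key_mix j k1 k2 (x y : X) : A x -> A y -> 0 < k1 -> 0 < k2 ->
  exists t, [/\ 0 < t, t < 1 & forall k,
    key j (k1 *: x + k2 *: y) k = t * key j x k + (1 - t) * key j y k].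
Proof.
move=> /scale_gt0 sx /scale_gt0 sy k10 k20.
have sz : 0 < k1 * scale x + k2 * scale y by rewrite addr_gt0 // mulr_gt0.
exists (k1 * scale x / (k1 * scale x + k2 * scale y)); split.
- by rewrite divr_gt0 // mulr_gt0.
- by rewrite ltr_pdivrMr // mul1r ltrDl mulr_gt0.
have gen (u v : R) : (k1 * u + k2 * v) / (k1 * scale x + k2 * scale y) =
    k1 * scale x / (k1 * scale x + k2 * scale y) * (u / scale x) +
    (1 - k1 * scale x / (k1 * scale x + k2 * scale y)) * (v / scale y).
  by field; rewrite !lt0r_neq0.
case=> [|[|k]]; rewrite /key scaleD -gen; congr (_ / _).
- by rewrite phiD; ring.
- by case: insub => [i|]; rewrite ?cfD ?cfZ // !mulr0 addr0.
Qed.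

(** The keys determine the ray of [x], and by reducedness a ray contains only one positive affine
    root. *)
Lemma key_inj j (x y : X) : A x -> A y -> (forall k, key j x k = key j y k) -> x = y.
Proof.
move=> Ax Ay e; have [sx sy] := (scale_gt0 Ax, scale_gt0 Ay).
pose t := scale x / scale y.
have t0 : 0 < t by rewrite divr_gt0.
have gen (u v : R) : u / scale x = v / scale y -> u = t * v.
  move=> h; have : u / scale x * scale x = v / scale y * scale x by rewrite h.
  by rewrite divfK ?lt0r_neq0 // => ->; rewrite /t; ring.
have e1 : x.1 = t *: y.1.
  apply/eqP; rewrite -subr_eq0; apply/eqP; apply: (cf_eq0 hD) => i; rewrite cfB cfZ.
  have := e i.+2; rewrite /key; case: insubP => [i' _ /val_inj ->|]; last by rewrite ltn_ord.
  by move=> /gen ->; rewrite subrr.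
have e2 : x.2 = t * y.2 by exact: gen (e 1%N).
have [a [m [Pa am xE]]] := (affine_posP hPhi hPos x).1 Ax.
have [a' [m' [Pa' am' yE]]] := (affine_posP hPhi hPos y).1 Ay.
have t1 : t = 1.
  rewrite xE yE /= in e1; rewrite e1 in Pa.
  by case: (root_scale hPhi Pa' Pa) => // h; rewrite h oppr_gt0 ltr10 in t0.
rewrite t1 scale1r in e1; rewrite t1 mul1r in e2.
by rewrite (surjective_pairing x) e1 e2 -surjective_pairing.
Qed.

Definition supp (v : V) i := cf i v != 0.

Definition is_piece (x : X) (r : nat) :=
  [/\ forall i, 0 <= cf i x.1, exists2 i, supp x.1 i & b i = r &
      forall i, supp x.1 i -> (r <= b i)%N] \/
  [/\ forall i, cf i x.1 <= 0, exists2 i, supp x.1 i & d i = r &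
      forall i, supp x.1 i -> (d i <= r)%N].

Lemma piece_exists x : A x -> exists r, is_piece x r.
Proof.
move=> /(affine_posP hPhi hPos)[a [m [Pa am ->]]]; rewrite /is_piece /=.
have [i0 ai0] := root_cf_neq0 hPhi hD Pa.
have [h|h] := root_sign hD Pa.
  have ex : exists r, [exists i, (cf i a != 0) && (b i == r)].
    by exists (b i0); apply/existsP; exists i0; rewrite ai0 eqxx.
  have [r /existsP[i /andP[ai /eqP bi]] rmin] := ex_minnP ex.
  exists r; left; split=> //; first by exists i.
  by move=> j aj; apply: rmin; apply/existsP; exists j; apply/andP; split; [exact: aj|].
have ex : exists r, [exists i, (cf i a != 0) && (d i == r)].
  by exists (d i0); apply/existsP; exists i0; rewrite ai0 eqxx.
have bd r : [exists i, (cf i a != 0) && (d i == r)] -> (r <= size w)%N.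
  by move=> /existsP[i /andP[_ /eqP <-]]; apply: ltnW; have [] := d_letter i.
have [r /existsP[i /andP[ai /eqP di]] rmax] := ex_maxnP ex bd.
exists r; right; split=> //; first by exists i.
by move=> j aj; apply: rmax; apply/existsP; exists j; apply/andP; split; [exact: aj|].
Qed.

Section Order.
Variable rho : X -> nat.
Hypothesis rhoP : forall x, A x -> is_piece x (rho x).

Definition piece_lt x y := (rho x < rho y)%N \/
  (rho x = rho y /\ lexlt (key (rho x) x) (key (rho x) y)).

Definition pos (x : X) := forall i, 0 <= cf i x.1.
Definition neg (x : X) := forall i, cf i x.1 <= 0.

Lemma supp_exists x : A x -> exists i, supp x.1 i.
Proof.
by move=> /(affine_posP hPhi hPos)[a [m [Pa _ ->]]]; apply: (root_cf_neq0 hPhi hD Pa).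
Qed.

Lemma root_part x : A x -> x.1 \in Phi.
Proof. by move=> /(affine_posP hPhi hPos)[a [m [Pa _ ->]]]. Qed.

Lemma pos_or_neg_part x : A x -> pos x \/ neg x.
Proof. by move=> /rhoP[[]|[]]; [left|right]. Qed.

Lemma pos_supp x i : pos x -> supp x.1 i -> 0 < cf i x.1.
Proof. by move=> p h; rewrite lt_neqAle p andbT eq_sym; exact: h. Qed.

Lemma neg_supp x i : neg x -> supp x.1 i -> cf i x.1 < 0.
Proof. by move=> p h; rewrite lt_neqAle p andbT; exact: h. Qed.

Lemma pos_neg x : A x -> pos x -> ~ neg x.
Proof.
move=> Ax px nx; have [i h] := supp_exists Ax.
by have := pos_supp px h; rewrite ltNge nx.
Qed.

Lemma rho_pos x : A x -> pos x ->
  (exists2 i, supp x.1 i & b i = rho x) /\ forall i, supp x.1 i -> (rho x <= b i)%N.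
Proof. by move=> Ax px; have [[]|[/(pos_neg Ax px)]] := rhoP Ax. Qed.

Lemma rho_neg x : A x -> neg x ->
  (exists2 i, supp x.1 i & d i = rho x) /\ forall i, supp x.1 i -> (d i <= rho x)%N.
Proof.
by move=> Ax nx; have [[p _ _]|[]] := rhoP Ax; first by case: (pos_neg Ax p nx).
Qed.

Lemma rho_lt x : A x -> (rho x < size w)%N.
Proof.
move=> Ax; have [p|n] := pos_or_neg_part Ax.
  by have [[i _ <-] _] := rho_pos Ax p; have [] := b_letter i.
by have [[i _ <-] _] := rho_neg Ax n; have [] := d_letter i.
Qed.

Lemma letter_pos x : A x -> pos x -> nth false w (rho x) = false.
Proof. by move=> Ax p; have [[i _ <-] _] := rho_pos Ax p; have [] := b_letter i. Qed.

Lemma letter_neg x : A x -> neg x -> nth false w (rho x) = true.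
Proof. by move=> Ax p; have [[i _ <-] _] := rho_neg Ax p; have [] := d_letter i. Qed.

Lemma b_neq_d i j : b i != d j.
Proof.
by apply/eqP => e; have [_] := b_letter i; have [_] := d_letter j; rewrite e => ->.
Qed.

Lemma phi_ge0 j x : pos x -> 0 <= phi j x.1.
Proof. by move=> p; apply: sumr_ge0 => i _; apply: p. Qed.

Lemma phi_le0 j x : neg x -> phi j x.1 <= 0.
Proof. by move=> p; apply: sumr_le0 => i _; apply: p. Qed.

Lemma phi_pos x : A x -> pos x -> 0 < phi (rho x) x.1.
Proof.
move=> Ax p; have [[i si bi] _] := rho_pos Ax p.
rewrite /phi (bigD1 i) /= ?bi ?eqxx // ltr_pwDl ?(pos_supp p si) // sumr_ge0 //.
Qed.

Lemma phi_neg x : A x -> neg x -> phi (rho x) x.1 < 0.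
Proof.
move=> Ax p; have [[i si di] _] := rho_neg Ax p.
rewrite /phi (bigD1 i) /= ?di ?eqxx ?orbT //.
have := neg_supp p si.
have : \sum_(j | ((b j == rho x) || (d j == rho x)) && (j != i)) cf j x.1 <= 0.
  by apply: sumr_le0 => j _; apply: p.
lra.
Qed.

(** Lets the key of the piece of [x] be used for [y] as well: coordinate 0 is zero at [y] and
    negative at [x], so a combination falling in that piece comes after [x]. *)
Lemma phi_late x y : A x -> pos x -> A y -> pos y -> (rho x < rho y)%N ->
  phi (rho x) y.1 = 0.
Proof.
move=> Ax px Ay py lt; apply: big1 => i /orP[/eqP e|/eqP e].
  apply/eqP/negPn/negP => h; have := (rho_pos Ay py).2 i h.
  by rewrite e leqNgt lt.
by have [[i' _ e'] _] := rho_pos Ax px; have := b_neq_d i' i; rewrite e' e eqxx.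
Qed.

Lemma phi_early x y : A x -> neg x -> A y -> neg y -> (rho x < rho y)%N ->
  phi (rho y) x.1 = 0.
Proof.
move=> Ax px Ay py lt; apply: big1 => i /orP[/eqP e|/eqP e].
  by have [[i' _ e'] _] := rho_neg Ay py; have := b_neq_d i i'; rewrite e' e eqxx.
apply/eqP/negPn/negP => h; have := (rho_neg Ax px).2 i h.
by rewrite e leqNgt lt.
Qed.

Lemma key_lt j x y : A x -> A y -> phi j y.1 <= 0 -> 0 < phi j x.1 ->
  lexlt (key j x) (key j y).
Proof.
move=> /scale_gt0 sx /scale_gt0 sy h1 h2; exists 0%N; split=> // .
rewrite /key !mulNr ltrN2.
have : 0 < phi j x.1 / scale x by rewrite divr_gt0.
have : phi j y.1 / scale y <= 0 by rewrite pmulr_lle0 // invr_gt0.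
lra.
Qed.

Lemma key_lt' j x y : A x -> A y -> phi j y.1 < 0 -> 0 <= phi j x.1 ->
  lexlt (key j x) (key j y).
Proof.
move=> /scale_gt0 sx /scale_gt0 sy h1 h2; exists 0%N; split=> // .
rewrite /key !mulNr ltrN2.
have : 0 <= phi j x.1 / scale x by rewrite divr_ge0 // ltW.
have : phi j y.1 / scale y < 0 by rewrite pmulr_llt0 // invr_gt0.
lra.
Qed.

Lemma piece_lt_strict_total : strict_total_on A piece_lt.
Proof.
split.
- by move=> x Ax [|[_ /lexlt_irr]]; rewrite ?ltnn.
- move=> x y z Ax Ay Az [h1|[e1 l1]] [h2|[e2 l2]].
  + by left; apply: ltn_trans h1 h2.
  + by left; rewrite -e2.
  + by left; rewrite e1.
  + by right; split; [rewrite e1|rewrite -e1 in l2; apply: lexlt_trans l1 l2].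
- move=> x y Ax Ay; case: (ltngtP (rho x) (rho y)) => h.
  + by constructor 1; left.
  + by constructor 3; left.
  + have [e|[l|l]] := lexlt_total (key (rho x) x) (key (rho x) y).
    * by constructor 2; apply: key_inj e.
    * by constructor 1; right.
    * by constructor 3; right; rewrite -h.
Qed.

Section Triple.
Variables (x y : X) (k1 k2 : R).
Notation z := (k1 *: x + k2 *: y).
Hypotheses (Ax : A x) (Ay : A y) (Az : A z) (k10 : 0 < k1) (k20 : 0 < k2).

Lemma cf_comb i : cf i z.1 = k1 * cf i x.1 + k2 * cf i y.1.
Proof. by rewrite /= cfD !cfZ. Qed.

Lemma piece_lt_left : rho z = rho x -> lexlt (key (rho x) x) (key (rho x) y) -> piece_lt x z.
Proof.
move=> e l; right; split=> //; have [t [t0 t1 E]] := key_mix (rho x) Ax Ay k10 k20.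
by have [] := lexlt_mix t0 t1 E l.
Qed.

Lemma piece_lt_right : rho z = rho y -> lexlt (key (rho y) x) (key (rho y) y) -> piece_lt z y.
Proof.
move=> e l; right; split=> //; have [t [t0 t1 E]] := key_mix (rho y) Ax Ay k10 k20.
by rewrite e; have [] := lexlt_mix t0 t1 E l.
Qed.

Lemma supp_same i : pos x /\ pos y \/ neg x /\ neg y ->
  supp z.1 i <-> supp x.1 i \/ supp y.1 i.
Proof.
rewrite /supp cf_comb => h; split.
  have [->|] := eqVneq (cf i x.1) 0; last by left.
  by have [->|] := eqVneq (cf i y.1) 0; [rewrite !mulr0 addr0 eqxx|right].
case: h => -[hx hy].
  rewrite paddr_eq0 ?(mulr_ge0 (ltW k10)) ?(mulr_ge0 (ltW k20)) //.
  by rewrite !mulf_eq0 (gt_eqF k10) (gt_eqF k20) negb_and /= => -[] ->; rewrite ?orbT.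
rewrite naddr_eq0 ?(mulr_ge0_le0 (ltW k10)) ?(mulr_ge0_le0 (ltW k20)) //.
by rewrite !mulf_eq0 (gt_eqF k10) (gt_eqF k20) negb_and /= => -[] ->; rewrite ?orbT.
Qed.

Lemma between_pos : pos x -> pos y -> piece_lt x y -> piece_lt x z /\ piece_lt z y.
Proof.
move=> px py; have pz : pos z by move=> i; rewrite cf_comb addr_ge0 // mulr_ge0 // ltW.
have sz i := supp_same i (or_introl (conj px py)).
have [[ix six bx] mx] := rho_pos Ax px; have [[iy siy by'] my] := rho_pos Ay py.
have [[iz siz bz] mz] := rho_pos Az pz.
have zx : (rho z <= rho x)%N by rewrite -bx; apply: mz; apply/sz; left.
have zy : (rho z <= rho y)%N by rewrite -by'; apply: mz; apply/sz; right.
have xyz : (rho x <= rho z)%N \/ (rho y <= rho z)%N.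
  by rewrite -bz; case/sz: siz => [/mx|/my]; [left|right].
case=> [lt|[e l]].
  have ez : rho z = rho x by lia.
  split; last by left; rewrite ez.
  apply: piece_lt_left => //; apply: key_lt => //; last exact: phi_pos.
  by rewrite phi_late.
have ez : rho z = rho x by lia.
by split; [apply: piece_lt_left|apply: piece_lt_right; rewrite -?e].
Qed.

Lemma between_neg : neg x -> neg y -> piece_lt x y -> piece_lt x z /\ piece_lt z y.
Proof.
move=> px py; have pz : neg z.
  move=> i; rewrite cf_comb; have := mulr_ge0_le0 (ltW k10) (px i).
  have := mulr_ge0_le0 (ltW k20) (py i); lra.
have sz i := supp_same i (or_intror (conj px py)).
have [[ix six bx] mx] := rho_neg Ax px; have [[iy siy by'] my] := rho_neg Ay py.
have [[iz siz bz] mz] := rho_neg Az pz.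
have zx : (rho x <= rho z)%N by rewrite -bx; apply: mz; apply/sz; left.
have zy : (rho y <= rho z)%N by rewrite -by'; apply: mz; apply/sz; right.
have xyz : (rho z <= rho x)%N \/ (rho z <= rho y)%N.
  by rewrite -bz; case/sz: siz => [/mx|/my]; [left|right].
case=> [lt|[e l]].
  have ez : rho z = rho y by lia.
  split; first by left; rewrite ez.
  apply: piece_lt_right => //; apply: key_lt' => //; first exact: phi_neg.
  by rewrite phi_early.
have ez : rho z = rho x by lia.
by split; [apply: piece_lt_left|apply: piece_lt_right; rewrite -?e].
Qed.

(** That [z] is a root already forces [x] before [y]. If [z] is positive, the support of [x] is the
    union of those of [z] and [y]; these contain a touching pair, so the first birth in [z] precedes
    the last death in [y]. The other case is dual. *)
Lemma between_mixed : pos x -> neg y -> piece_lt x z /\ piece_lt z y.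
Proof.
move=> px ny; have [pz|nz] := pos_or_neg_part Az.
  have sx i : supp x.1 i <-> supp z.1 i \/ supp y.1 i.
    exact: (comb_neq0 k10 k20 (px i) (ny i) (pz i) (cf_comb i)).
  have [i [j [zi yj ij]]] := support_touch (root_part Ax) sx (supp_exists Az) (supp_exists Ay).
  have zy : (rho z < rho y)%N.
    apply: leq_ltn_trans ((rho_pos Az pz).2 i zi) _.
    exact: leq_trans (b_lt_d ij) ((rho_neg Ay ny).2 j yj).
  split; last by left.
  have xz : (rho x <= rho z)%N.
    by have [[i' zi' <-] _] := rho_pos Az pz; apply: (rho_pos Ax px).2; apply/sx; left.
  move: xz; rewrite leq_eqVlt => /orP[/eqP e|lt]; last by left.
  by apply: piece_lt_left => //; apply: key_lt => //; [apply: phi_le0|apply: phi_pos].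
have sy i : supp y.1 i <-> supp x.1 i \/ supp z.1 i.
  rewrite /supp -(oppr_eq0 (cf i y.1)) -(oppr_eq0 (cf i x.1)) -(oppr_eq0 (cf i z.1)).
  rewrite or_comm; apply: (comb_neq0 k20 k10); rewrite ?oppr_ge0 ?oppr_le0 //.
  by rewrite cf_comb; ring.
have [i [j [xi zj ij]]] := support_touch (root_part Ay) sy (supp_exists Ax) (supp_exists Az).
have xz : (rho x < rho z)%N.
  apply: leq_ltn_trans ((rho_pos Ax px).2 i xi) _.
  exact: leq_trans (b_lt_d ij) ((rho_neg Az nz).2 j zj).
split; first by left.
have zy : (rho z <= rho y)%N.
  by have [[i' zi' <-] _] := rho_neg Az nz; apply: (rho_neg Ay ny).2; apply/sy; right.
move: zy; rewrite leq_eqVlt => /orP[/eqP e|lt]; last by left.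
by apply: piece_lt_right => //; apply: key_lt' => //; [apply: phi_neg|apply: phi_ge0].
Qed.

End Triple.

Lemma piece_lt_asym x y : A x -> A y -> piece_lt x y -> ~ piece_lt y x.
Proof. exact: strict_total_asym piece_lt_strict_total. Qed.

Lemma piece_lt_between x y k1 k2 : A x -> A y -> A (k1 *: x + k2 *: y) -> 0 < k1 -> 0 < k2 ->
  piece_lt x y -> piece_lt x (k1 *: x + k2 *: y) /\ piece_lt (k1 *: x + k2 *: y) y.
Proof.
move=> Ax Ay Az k10 k20 xy.
have [px|nx] := pos_or_neg_part Ax; have [py|ny] := pos_or_neg_part Ay.
- exact: between_pos.
- exact: between_mixed.
(* This case is void, as [between_mixed] puts [y] before [x]. *)
- have Az' : A (k2 *: y + k1 *: x) by rewrite addrC.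
  have [yz zx] := between_mixed Ay Ax Az' k20 k10 py nx.
  have [_ tr _] := piece_lt_strict_total.
  by case: (piece_lt_asym Ax Ay xy (tr _ _ _ Ay Az' Ax yz zx)).
- exact: between_neg.
Qed.

Lemma scale_ge a m : A (aff a m) -> a \in Phi -> m%:R - 1 <= scale (aff a m).
Proof.
move=> /scale_gt0 s0 Pa; have [m0|m0] := posnP m; first by rewrite m0 in s0 *; lra.
have := ht_lt Pa; rewrite /scale /= ltr_norml => /andP[h _].
have h1 := ht_bound_ge1; have m1 : 1 <= m%:R :> R by rewrite ler1n.
nra.
Qed.

(* The keys of a piece accumulate only at [0]. *)
Lemma piece_finite j x : A x -> phi j x.1 != 0 -> exists l : seq X, forall y, A y ->
  `|phi j x.1| / scale x <= `|phi j y.1| / scale y -> y \in l.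
Proof.
move=> Ax phi0; have sx := scale_gt0 Ax; have p0 : 0 < `|phi j x.1| by rewrite normr_gt0.
(* [M] bounds [phi j] on the roots, so the assumed inequality bounds [scale y] by
   [M * scale x / |phi j x|]; the level is at most [scale y + 1], hence at most [C]. *)
pose M := \sum_(a <- Phi) `|phi j a|.
pose C := M * scale x / `|phi j x.1| + 1.
have C0 : 0 <= C by rewrite addr_ge0 // divr_ge0 ?mulr_ge0 ?(ltW sx) // sumr_ge0.
exists [seq aff a m | a <- Phi, m <- iota 0 (Num.bound C)] => y Ay.
have := Ay; move=> /(affine_posP hPhi hPos)[a [m [Pa am yE]]]; rewrite yE in Ay *.
have sy := scale_gt0 Ay; rewrite ler_pdivrMr // mulrAC ler_pdivlMr // => h.
apply/allpairsP; exists (a, m); split; [exact: Pa| |exact: erefl].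
rewrite mem_iota add0n /= -(ltr_nat R); apply: le_lt_trans (archi_boundP C0).
rewrite -lerBlDr ler_pdivlMr //; apply: le_trans (_ : scale (aff a m) * `|phi j x.1| <= _).
  by rewrite ler_pM2r // scale_ge.
rewrite mulrC; apply: le_trans h _; rewrite ler_pM2r //.
by rewrite /M (big_rem a) //= lerDl sumr_ge0.
Qed.

Notation piece j := [set x | A x /\ rho x = j]%classic.

Lemma piece_pos j x : nth false w j = false -> piece j x -> pos x.
Proof.
move=> wj [Ax xj]; have [//|n] := pos_or_neg_part Ax.
by have := letter_neg Ax n; rewrite xj wj.
Qed.

Lemma piece_neg j x : nth false w j = true -> piece j x -> neg x.
Proof.
move=> wj [Ax xj]; have [p|//] := pos_or_neg_part Ax.
by have := letter_pos Ax p; rewrite xj wj.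
Qed.

Lemma piece_lt_key j x y : piece j x -> piece j y -> piece_lt x y ->
  phi j y.1 / scale y <= phi j x.1 / scale x.
Proof.
move=> [Ax xj] [Ay yj] [|[_ /lexlt_le0]]; first by rewrite xj yj ltnn.
by rewrite xj /key !mulNr lerN2.
Qed.

Lemma piece_below j : nth false w j = false -> finite_below (piece j) piece_lt.
Proof.
move=> wj x xj; have [Ax ex] := xj; have p := piece_pos wj xj.
have ph := phi_pos Ax p; rewrite ex in ph.
have [l hl] := piece_finite Ax (lt0r_neq0 ph); exists l => y yj yx.
have [Ay _] := yj; apply: hl => //.
rewrite !ger0_norm ?phi_ge0 //; last exact: piece_pos yj.
exact: piece_lt_key yx.
Qed.

Lemma piece_above j : nth false w j = true ->
  finite_below (piece j) (fun x y => piece_lt y x).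
Proof.
move=> wj x xj; have [Ax ex] := xj; have p := piece_neg wj xj.
have ph := phi_neg Ax p; rewrite ex in ph.
have [l hl] := piece_finite Ax (ltr0_neq0 ph); exists l => y yj yx.
have [Ay _] := yj; apply: hl => //.
rewrite !ler0_norm ?phi_le0 //; last exact: piece_neg yj.
by rewrite !mulNr lerN2; apply: piece_lt_key yx.
Qed.

Lemma piece_infinite j : (j < size w)%N -> infinite (piece j).
Proof.
move=> jw; have aff_inj a : injective (fun m => aff a m.+1).
  by move=> m m' /affine_root_inj[_ []].
have lev1 a m : (lev a <= m.+1)%N by apply: leq_trans (first_level_le1 _ _) _.
case wj: (nth false w j).
  have [i di] := d_surj jw wj; apply: (infinite_of_inj (aff_inj (- s i))) => m.
  have Ax : A (aff (- s i) m.+1).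
    by apply: (affine_pos hPhi hPos) => //; apply/(root_opp hPhi)/(simple_in_roots hD).
  have nx : neg (aff (- s i) m.+1).
    by move=> k; rewrite /= cfN (cf_simple hD) oppr_le0 ler0n.
  split=> //; have [[k + <-] _] := rho_neg Ax nx; rewrite /supp /= cfN (cf_simple hD).
  by have [->|ki] := eqVneq k i; rewrite ?mulr0n ?oppr0 ?eqxx.
have [i bi] := b_surj jw wj; apply: (infinite_of_inj (aff_inj (s i))) => m.
have Ax : A (aff (s i) m.+1).
  by apply: (affine_pos hPhi hPos) => //; apply: (simple_in_roots hD).
have px : pos (aff (s i) m.+1) by move=> k; rewrite /= (cf_simple hD) ler0n.
split=> //; have [[k + <-] _] := rho_pos Ax px; rewrite /supp /= (cf_simple hD).
by have [->|ki] := eqVneq k i; rewrite ?mulr0n ?eqxx.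
Qed.

Lemma piece_rank j : (j < size w)%N -> exists rk : X -> nat,
  [/\ forall x y, piece j x -> piece j y ->
        (piece_lt x y <-> if nth false w j then (rk y < rk x)%N else (rk x < rk y)%N),
      forall x y, piece j x -> piece j y -> rk x = rk y -> x = y &
      forall m, exists2 x, piece j x & rk x = m].
Proof.
move=> jw; have hi := piece_infinite jw.
have ho : strict_total_on (piece j) piece_lt.
  by apply: strict_total_sub piece_lt_strict_total => x [].
case wj: (nth false w j).
  have [rk [h1 h2 h3]] := omega_rank (strict_total_flip ho) (piece_above wj) hi.
  by exists rk; split=> // x y xj yj; apply: h1.
by have [rk [h1 h2 h3]] := omega_rank ho (piece_below wj) hi; exists rk.
Qed.

(* Applied to the pairs whose order is changed by [relabel]. *)
Lemma inverted_apart x y : A x -> A y -> (rho y < rho x)%N ->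
  nth false w (rho y) = true -> nth false w (rho x) = false ->
  [/\ pos x, neg y & forall i j, supp x.1 i -> supp y.1 j -> ~ touch i j].
Proof.
move=> Ax Ay lt wy wx; have px : pos x by apply: (piece_pos wx).
have ny : neg y by apply: (piece_neg wy).
split=> // i j xi yj /b_lt_d; have := (rho_pos Ax px).2 i xi.
have := (rho_neg Ay ny).2 j yj; lia.
Qed.

Lemma backward ns : admissible w ns ->
  exists2 prec, reflection_order Pos prec & has_order_type A prec (word_type w ns).
Proof.
move=> adm.
have /choice[rks rksP] : forall j, exists rk : X -> nat, (j < size w)%N ->
    [/\ forall x y, piece j x -> piece j y ->
        (piece_lt x y <-> if nth false w j then (rk y < rk x)%N else (rk x < rk y)%N),
      forall x y, piece j x -> piece j y -> rk x = rk y -> x = y &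
      forall m, exists2 x, piece j x & rk x = m].
  move=> j; have [/piece_rank[rk h]|hj] := ltnP j (size w); first by exists rk.
  by exists (fun _ => 0%N).
pose rk x := rks (rho x) x.
have mono x y : A x -> A y -> piece_lt x y -> (rho x <= rho y)%N.
  by move=> _ _ [/ltnW //|[-> _]].
have rk1 x y : A x -> A y -> rho x = rho y ->
    piece_lt x y <-> if nth false w (rho x) then (rk y < rk x)%N else (rk x < rk y)%N.
  move=> Ax Ay e; have [h _ _] := rksP _ (rho_lt Ax).
  by rewrite /rk -e; apply: h.
have rk2 x y : A x -> A y -> rho x = rho y -> rk x = rk y -> x = y.
  move=> Ax Ay e; have [_ h _] := rksP _ (rho_lt Ax).
  by rewrite /rk -e; apply: h.
have rk3 j m : (j < size w)%N -> exists x, [/\ A x, rho x = j & rk x = m].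
  move=> jw; have [_ _ /(_ m)[x [Ax xj] xm]] := rksP j jw.
  by exists x; split=> //; rewrite /rk xj.
have [prec [ho ht inv]] := relabel piece_lt_strict_total rho_lt mono rk1 rk2 rk3 adm.
exists prec => //; split=> // x y k1 k2 Ax Ay xy k10 k20 Az.
have [irr0 _ tot0] := piece_lt_strict_total; have [irr _ tot] := ho.
have czE i := cf_comb x y k1 k2 i.
have [Nx Ny Nz] := And3 (supp_exists Ax) (supp_exists Ay) (supp_exists Az).
(* An inverted pair has disjoint supports and opposite signs, so no positive combination of it is a
   root. *)
have xy0 : piece_lt x y.
  case: (tot0 x y Ax Ay) => // [e|yx]; first by rewrite e in xy; case: (irr y).
  have [lt wy wx] := inv x y Ax Ay xy yx.
  have [px ny ap] := inverted_apart Ax Ay lt wy wx.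
  have [[i xi] [j yj]] := (Nx, Ny).
  have y0 : cf i y.1 = 0.
    by apply/eqP/negPn/negP => yi; apply: (ap i i xi yi); left.
  have x0 : cf j x.1 = 0.
    by apply/eqP/negPn/negP => xj; apply: (ap j j xj yj); left.
  have [pz|nz] := pos_or_neg_part Az.
    have := pz j; rewrite czE x0 mulr0 add0r pmulr_rge0 // leNgt.
    by rewrite (neg_supp ny yj).
  have := nz i; rewrite czE y0 mulr0 addr0 pmulr_rle0 // leNgt.
  by rewrite (pos_supp px xi).
(* If [x] and [z] were inverted, the support of [y] would be the union of theirs, and its
   connectedness would give a touching pair, which inverted elements do not have. The pair [z], [y]
   is treated alike. *)
have [xz zy] := piece_lt_between Ax Ay Az k10 k20 xy0; split.
  case: (tot _ _ Ax Az) => // [e|zx]; first by rewrite -e in xz; case: (irr0 x).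
  have [lt wx wz] := inv _ _ Az Ax zx xz.
  have [pz nx ap] := inverted_apart Az Ax lt wx wz.
  have py : pos y.
    have [//|ny] := pos_or_neg_part Ay; have [i zi] := Nz.
    have := pos_supp pz zi; rewrite czE.
    have := mulr_ge0_le0 (ltW k10) (nx i); have := mulr_ge0_le0 (ltW k20) (ny i); lra.
  have sy i : supp y.1 i <-> supp (k1 *: x + k2 *: y).1 i \/ supp x.1 i.
    by apply: (comb_neq0 k20 k10 (py i) (nx i) (pz i)); rewrite czE addrC.
  have [i [j [zi xj ij]]] := support_touch (root_part Ay) sy Nz Nx.
  by case: (ap i j zi xj ij).
case: (tot _ _ Az Ay) => // [e|yz]; first by rewrite e in zy; case: (irr0 y).
have [lt wz wy] := inv _ _ Ay Az yz zy.
have [py nz ap] := inverted_apart Ay Az lt wz wy.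
have nx : neg x.
  have [px|//] := pos_or_neg_part Ax; have [i zi] := Nz.
  have := neg_supp nz zi; rewrite czE.
  have := mulr_ge0 (ltW k10) (px i); have := mulr_ge0 (ltW k20) (py i); lra.
have sx i : supp x.1 i <-> supp y.1 i \/ supp (k1 *: x + k2 *: y).1 i.
  rewrite /supp -(oppr_eq0 (cf i y.1)) -(oppr_eq0 (cf i x.1)).
  rewrite -(oppr_eq0 (cf i (k1 *: x + k2 *: y).1)) or_comm.
  apply: (comb_neq0 k10 k20); rewrite ?oppr_ge0 ?oppr_le0 //.
  by rewrite czE; ring.
have [i [j [yi zj ij]]] := support_touch (root_part Ax) sx Ny Nz.
by case: (ap i j yi zj ij).
Qed.

End Order.
End Backward.

Theorem theorem4p3 (R : realType) (V : vectType R) (ip : {dot V for idfun})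
    (Phi Pos : seq V) (n : nat)
    (hPhi : root_system ip Phi) (hirr : irreducible_roots ip Phi)
    (hPos : positive_system Phi Pos) (hn : \dim {:V}%VS = n) :
  (forall prec : V * R^o -> V * R^o -> Prop,
     reflection_order Pos prec ->
     exists (w : seq bool) (ns : nat -> nat),
       [/\ trimmed_dyck n w, admissible w ns &
           has_order_type (affine_pos_roots Pos) prec (word_type w ns)]) /\
  (forall (w : seq bool) (ns : nat -> nat),
     trimmed_dyck n w -> admissible w ns ->
     exists2 prec : V * R^o -> V * R^o -> Prop,
       reflection_order Pos prec &
       has_order_type (affine_pos_roots Pos) prec (word_type w ns)).
Proof.
split; first by move=> prec hR; apply: (forward hPhi hirr hPos hR hn).
have [Delta hD hDP] := hPos; move=> w ns hw adm.
have [b [d [bw dw bs ds bd]]] := simple_letters hPhi hirr hD hn hw.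
have /choice[rho rhoP] : forall x, exists r, affine_pos_roots Pos x ->
    is_piece b d (x : V * R^o) r.
  move=> x; case: (pselect (affine_pos_roots Pos x)) => [Ax|]; last by exists 0%N.
  by have [r hr] := piece_exists hPhi hPos hD b dw Ax; exists r.
exact: (backward hPhi hPos hD hDP bw dw bs ds bd rhoP adm).
Qed.
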